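(* Let $X$ be a transient Markov process with state space $E$, local time process $(L^x_t,x\in E,t\ge0)$ and Green function $g$, and let $(\psi_x,x\in E)$ be the permanental process with index $2$ associated to $X$ (also written $\psi(x)=\psi_x$). Then $\psi$ is an infinitely divisible process, and its Lévy measure $\nu$ is characterized by the following marginals: for every $a\in E$ with $g(a,a)>0$, every $n$ and every $x_2,\dots,x_n\in E$, $$\nu_{(\psi(a)/2,\psi(x_2)/2,\dots,\psi(x_n)/2)}(dy_1,dy_2,\dots,dy_n)=\frac{g(a,a)}{2y_1}\,\tilde{\mathbb{P}}_a\big(L^a_\infty\in dy_1,\ L^{x_i}_\infty\in dy_i,\ 2\le i\le n\big).$$ Equivalently, the Lévy measure of $\psi/2$ is equal to the law of $(L^x_\infty,x\in E)$ under $\frac{g(a,a)}{2L^a_\infty}\tilde{\mathbb{P}}_a$, for every $a$ in the state space.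
   Context: The process $X$ is not assumed symmetric. Its Green function is the (finite) function $g(x,y)=\mathbb{E}_x(L^y_\infty)$. For $a$ with $g(a,a)>0$, the probability $\tilde{\mathbb{P}}_a$ is defined by $\tilde{\mathbb{P}}_a|_{\mathcal{F}_t}=\frac{g(X_t,a)}{g(a,a)}\mathbb{P}_a|_{\mathcal{F}_t}$, where $\mathcal{F}_t=\sigma(X_s,0\le s\le t)$ and $\mathbb{P}_a$ is the law of $X$ started at $a$. The permanental process with index $2$ associated to $X$ is the nonnegative process $\psi$ with $\mathbb{E}[\exp\{-\frac12\sum_{i=1}^n\alpha_i\psi_{x_i}\}]=|I+\alpha G|^{-1/2}$ for all $n$, $\alpha_i\ge0$, $x_i\in E$, with $\alpha=\mathrm{diag}(\alpha_i)$, $G=(g(x_i,x_j))_{1\le i,j\le n}$ and $|\cdot|$ the determinant. A process is infinitely divisible if all its finite-dimensional marginals are. The Lévy measure $\nu_{(Y_1,\dots,Y_n)}$ of a nonnegative infinitely divisible vector $(Y_1,\dots,Y_n)$ (without drift) is the measure such that $\mathbb{E}[e^{-\sum_i\alpha_iY_i}]=\exp\{-\int_{\mathbb{R}_+^n}(1-e^{-\sum_i\alpha_iy_i})\,\nu(dy)\}$ for all $\alpha\in\mathbb{R}_+^n$.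
   Formalization: The Lévy measure formulas are equalities of measures on {y_1>0} (on {y(a)>0} for the process), since ν may also charge {y_1=0}; P̃_a is prescribed on F_t restricted to paths alive at time t, the stated density having mass below 1; the Markov process is taken strong Markov. *)

(* Defs.v *)
From mathcomp Require Import all_boot all_order all_algebra.
From mathcomp Require Import all_classical all_reals all_analysis measurable_realfun.

Set Implicit Arguments.
Unset Strict Implicit.
Unset Printing Implicit Defensive.

Import Order.TTheory GRing.Theory Num.Theory.
Import numFieldNormedType.Exports.

Local Open Scope classical_set_scope.
Local Open Scope ring_scope.

(* The process takes its values in E with a cemetery state added: X t w = None
   means that the path w is dead at time t. Only times t >= 0 are meaningful. *)
Section markov_process.
Context {d dE : measure_display} {R : realType}.
Context {Omega : measurableType d} {E : measurableType dE}.
Implicit Types (X : R -> Omega -> option E) (theta : R -> Omega -> Omega).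
Implicit Types (P : E -> probability Omega R).

Definition visits X (t : R) (B : set E) : set Omega :=
  [set w | (Some @` B) (X t w)].

Definition alive X (t : R) : set Omega := visits X t setT.

Definition history X (t : R) : set (set Omega) :=
  <<s [set A | exists s B, [/\ 0 <= s <= t, measurable B & A = visits X s B] ] >>.

Definition history_infty X : set (set Omega) :=
  <<s [set A | exists s B, [/\ 0 <= s, measurable B & A = visits X s B] ] >>.

Definition progressive X : Prop := forall (t : R) (B : set E),
  0 <= t -> measurable B ->
  <<s [set D | exists (I : set R) (A : set Omega),
         [/\ measurable I, history X t A & D = I `*` A] ] >>
    [set p : R * Omega | 0 <= p.1 <= t /\ visits X p.1 B p.2].

Definition stopping_time X (T : Omega -> \bar R) : Prop :=
  (forall w, (0 <= T w)%E) /\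
  (forall t, 0 <= t -> history X t [set w | (T w <= t%:E)%E]).

Definition history_at X (T : Omega -> \bar R) : set (set Omega) :=
  [set A | history_infty X A /\
    forall t, 0 <= t -> history X t (A `&` [set w | (T w <= t%:E)%E])].

(* A function on E is extended by 0 at the cemetery. *)
Definition at_state {U : Type} (u0 : U) (f : E -> U) (e : option E) : U :=
  if e is Some z then f z else u0.

Definition strong_markov P X theta : Prop :=
  forall (x : E) (T : Omega -> \bar R) (A C : set Omega),
  stopping_time X T -> history_at X T A -> history_infty X C ->
  P x (A `&` [set w | [/\ (T w < +oo)%E, alive X (fine (T w)) w &
                          C (theta (fine (T w)) w)]]) =
  (\int[P x]_(w in A `&` [set w | T w < +oo])
     at_state 0 (fun z => P z C) (X (fine (T w)) w))%E.

Record markov_process P X theta : Prop := MarkovProcess {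
  mp_measurable : forall (t : R) (B : set E), 0 <= t -> measurable B -> measurable (visits X t B) ;
  mp_progressive : progressive X ;
  mp_cemetery : forall (s t : R) w, 0 <= s -> s <= t -> X s w = None -> X t w = None ;
  mp_shift : forall (s t : R) w, 0 <= s -> 0 <= t -> X t (theta s w) = X (t + s) w ;
  mp_kernel : forall C, history_infty X C -> measurable_fun [set: E] (P ^~ C) ;
  mp_start : forall x, {ae P x, forall w, X 0 w = Some x} ;
  mp_strong_markov : strong_markov P X theta }.

(* Local time at x: an adapted continuous additive functional whose Stieltjes
   measure (mu below, for a given path) is carried by {s | X_s = x}.  The
   normalisation is left free, and the functional may vanish identically. *)
Record local_time P X theta (x : E) (A : R -> Omega -> R) : Prop := LocalTime {
  lt_adapted : forall (t : R) (B : set R), 0 <= t -> measurable B -> history X t (A t @^-1` B) ;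
  lt_start : forall w, A 0 w = 0 ;
  lt_nondecreasing : forall (s t : R) w, 0 <= s -> s <= t -> A s w <= A t w ;
  lt_continuous : forall w, {within `[0, +oo[, continuous (A ^~ w)} ;
  lt_cemetery : forall (s t : R) w, 0 <= s -> s <= t -> X s w = None -> A t w = A s w ;
  lt_additive : forall z, {ae P z, forall w, forall s t : R, 0 <= s -> 0 <= t ->
    A (t + s) w = A s w + A t (theta s w)} ;
  lt_carried : forall z, {ae P z, forall w,
    exists mu : {measure set (measurableTypeR R) -> \bar R},
      (forall s t : R, 0 <= s -> s <= t -> mu `]s, t]%classic = (A t w - A s w)%:E) /\
      mu.-negligible [set s | 0 < s /\ X s w <> Some x]} }.

Implicit Types (L : E -> R -> Omega -> R).

(* L^y_infty; L^y is nondecreasing in time. *)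
Definition total_local_time L (y : E) (w : Omega) : \bar R :=
  ereal_sup [set (L y t w)%:E | t in [set t | 0 <= t]].

Definition transient P L : Prop :=
  forall x y, (\int[P x]_w total_local_time L y w < +oo)%E.

Definition green P L (x y : E) : R :=
  fine (\int[P x]_w total_local_time L y w)%E.

(* The law P~_a. With g(cemetery, a) = 0, the change of measure with density
   g(X_t, a) / g(a, a) on F_t is a law of a killed process: it prescribes the
   law on F_t restricted to the event that the path is alive at time t. *)
Definition h_transform P X L (a : E) (Pt : probability Omega R) : Prop :=
  forall (t : R) (A : set Omega), 0 <= t -> history X t A ->
  Pt (A `&` alive X t) =
  (\int[P a]_(w in A)
     (at_state 0 (fun z => green P L z a) (X t w) / green P L a a)%:E)%E.

End markov_process.

Section nonnegative_processes.
Context {d : measure_display} {R : realType} {Omega : measurableType d}.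
Implicit Types (Q : probability Omega R).

Definition permanental_process2 Q {E : Type} (g : E -> E -> R)
    (psi : E -> {RV Q >-> R}) : Prop :=
  (forall x, {ae Q, forall w, 0 <= psi x w}) /\
  forall (n : nat) (x : 'I_n -> E) (alpha : 'rV[R]_n),
    (forall i, 0 <= alpha 0 i) ->
    'E_Q[fun w => expR (- (2^-1 * \sum_(i < n) alpha 0 i * psi (x i) w))]%E =
    ((\det (1%:M + diag_mx alpha *m \matrix_(i, j) g (x i) (x j)))
       `^ (- 2^-1))%:E.

Definition vec n (y : 'I_n -> R) : n.-tuple R := [tuple y i | i < n].

Definition orthant n : set (n.-tuple R) := [set y | forall i, 0 <= tnth y i].

Definition infinitely_divisible_vector Q n (Y : 'I_n -> Omega -> R) : Prop :=
  forall m : nat, (0 < m)%N ->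
  exists (d' : measure_display) (Omega' : measurableType d')
    (Q' : probability Omega' R) (Z : 'I_m -> 'I_n -> {RV Q' >-> R}),
  [/\ (forall B : 'I_m -> set (n.-tuple R), (forall k, measurable (B k)) ->
        Q' [set w | forall k, B k (vec (fun i => Z k i w))] =
        (\prod_(k < m) Q' [set w | B k (vec (fun i => Z k i w))])%E),
      (forall k l (B : set (n.-tuple R)), measurable B ->
        Q' [set w | B (vec (fun i => Z k i w))] =
        Q' [set w | B (vec (fun i => Z l i w))]) &
      (forall B : set (n.-tuple R), measurable B ->
        Q [set w | B (vec (fun i => Y i w))] =
        Q' [set w | B (vec (fun i => \sum_(k < m) Z k i w))])].

Definition infinitely_divisible_process Q {E : Type} (Y : E -> Omega -> R)
    : Prop :=
  forall (n : nat) (x : 'I_n -> E),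
    infinitely_divisible_vector Q (fun i => Y (x i)).

Record levy_measure_vector Q n (Y : 'I_n -> Omega -> R)
    (nu : {measure set (n.-tuple R) -> \bar R}) : Prop := LevyMeasureVector {
  lm_carrier : nu (~` @orthant n) = 0%E ;
  lm_origin : nu [set vec (fun=> 0)] = 0%E ;
  lm_laplace : forall alpha : 'I_n -> R, (forall i, 0 <= alpha i) ->
    'E_Q[fun w => expR (- \sum_(i < n) alpha i * Y i w)]%E =
    expeR (- \int[nu]_(y in @orthant n)
               (1 - expR (- \sum_(i < n) alpha i * tnth y i))%:E)%E }.

End nonnegative_processes.

Arguments vec {R n}.
Arguments orthant {R}.

Definition cylinders (E : Type) (R : realType) : set (set (E -> R)) :=
  [set A | exists x B, measurable B /\ A = [set y | B (y x)]].

(* R^E with the product sigma-algebra *)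
Definition paths (E : Type) (R : realType) :=
  g_sigma_algebraType (@cylinders E R).

(* The Levy measure of a process is the measure on the path space whose
   finite-dimensional marginals, off the origin, are the Levy measures of the
   finite-dimensional marginals of the process, and which does not charge the
   null path. When E is uncountable {0} is not in the product sigma-algebra, and
   the latter condition means that nu A is the inner measure of A minus {0}. *)
Record levy_measure_process {d : measure_display} {R : realType}
    {Omega : measurableType d} (Q : probability Omega R) {E : Type}
    (Y : E -> Omega -> R) (nu : {measure set (paths E R) -> \bar R}) : Prop :=
  LevyMeasureProcess {
  lmp_marginals : forall (n : nat) (x : 'I_n -> E),
    exists nux : {measure set (n.-tuple R) -> \bar R},
      levy_measure_vector Q (fun i => Y (x i)) nux /\
      forall B : set (n.-tuple R), measurable B -> ~ B (vec (fun=> 0)) ->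
        nux B = nu [set y | B (vec (fun i => y (x i)))] ;
  lmp_origin : forall A : set (paths E R), measurable A ->
    nu A = ereal_sup [set nu B | B in
      [set B : set (paths E R) | [/\ measurable B, B `<=` A & ~ B (fun=> 0)]]] }.

(* Main.v *)
(** Let mu_a be the law, under P_a and Lebesgue measure du, of the family of local
   times L^x taken at the inverse local time of a at level u, when that level is
   reached, and let U_s(x,b) be the resolvent of X killed at rate <s,L>.  Then
   U_s(a,a) is the Laplace transform of mu_a, and the strong Markov property at
   inverse local times gives the rank-one resolvent identity
   U_s(x,y) = U_(s+t at b)(x,y) + t U_(s+t at b)(x,b) U_s(b,y).  Adding the
   coefficients one at a time turns it into a product formula for det(I + alpha G)
   with factors 1 + t U_s(b,b), and ln(1 + t h) = int_0^t h/(1 + u h) du (Frullani)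
   identifies (ln det(I + alpha G))/2 with the Levy exponent of the measures
   mu_a(dy) / (2 y_a) on {y_a > 0}.  These agree on overlaps, by uniqueness of
   Laplace transforms, and are glued by a directed supremum over finite sets of
   states.  Discretising time shows that mu_a is g(a,a) times the law of the total
   local times under the h-transform.  For infinite divisibility,
   det(I + alpha G)^(-k) with k <= 1/2 is made the Laplace transform of a
   probability: the factors of the product formula, raised to the power k, are
   mixtures of exponential tilts of mu_a, and the restriction of the family to
   {y_a = 0} accounts for the remaining states. *)

From HB Require Import structures.
Require Import Defs.
From mathcomp Require Import all_boot all_order all_algebra.
From mathcomp Require Import all_classical all_reals all_analysis measurable_realfun.
From mathcomp Require Import ring lra.

Set Implicit Arguments.
Unset Strict Implicit.
Unset Printing Implicit Defensive.

Import Order.TTheory GRing.Theory Num.Theory.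
Import numFieldNormedType.Exports.

Local Open Scope classical_set_scope.
Local Open Scope ring_scope.

(** * Measures and Laplace transforms *)

(** The level u is kept as an extra coordinate under Lebesgue measure: an integral against dL^b_t
    becomes an integral over u of a functional at the inverse local time, to which the strong Markov
    property applies for each fixed u. Three obstacles shape the rest. Singletons of E are not
    assumed measurable, so the position at an inverse local time is never said to be b; it is only
    located in a measurable set that contains b and is chosen for the event at hand. E may be
    uncountable, so each argument involves finitely many states and reaches the path space through
    Laplace transforms. The Levy measure may be infinite while uniqueness of transforms concerns
    finite measures, so measures are compared after multiplication by 1 - exp(-y_a), whose integrals
    are differences of log-determinants. The coordinate u also explains the h-transform: g(X_t,a) is
    the expected length of the levels still to come at time t, so, with mass g(a,a), the lifetime
    plays the part of the inverse local time at a uniformly spread level. *)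

Section nonnegative_functions.
Context d (T : measurableType d) (R : realType).
Local Open Scope ereal_scope.
Import HBNNSimple.

(** The usual passage from indicators through simple functions to monotone limits, packaged once as
    an induction principle for [\bar R]-valued functions. *)
Lemma ge0_measurable_ind (P : (T -> \bar R) -> Prop) :
  P (cst 0) ->
  (forall (k : R) (A : set T) (g : T -> \bar R), (0 <= k)%R -> measurable A ->
    measurable_fun setT g -> (forall x, 0 <= g x) -> P g ->
    P (fun x => k%:E * (\1_A x)%:E + g x)) ->
  (forall g : (T -> \bar R)^nat, (forall n, measurable_fun setT (g n)) ->
    (forall n x, 0 <= g n x) -> (forall x, nondecreasing_seq (g ^~ x)) ->
    (forall n, P (g n)) -> P (fun x => limn (g ^~ x))) ->
  forall f : T -> \bar R, measurable_fun setT f -> (forall x, 0 <= f x) -> P f.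
Proof.
move=> P0 Padd Plim f mf f0.
have Psf (h : {nnsfun T >-> R}) : P (EFin \o h).
  (* The level sets of the nonnegative h at negative k are empty, so taking the positive part of k
     changes nothing and makes every coefficient admissible in the additive step. *)
  have -> : EFin \o h = fun x => \sum_(k <- finmap.enum_fset (fset_set (range h)))
      (Num.max k 0%R)%:E * (\1_(h @^-1` [set k]) x)%:E.
    apply/funext => x /=; rewrite fimfunE fsbig_finite//= -sumEFin.
    apply: eq_bigr => k _; rewrite EFinM.
    have [k0|k0] := leP 0%R k; first by [].
    by rewrite (preimage_nnfun0 _ k0) indicE in_set0 !mule0.
  suff: measurable_fun setT (fun x => \sum_(k <- finmap.enum_fset (fset_set (range h)))
      (Num.max k 0%R)%:E * (\1_(h @^-1` [set k]) x)%:E : \bar R) /\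
    P (fun x => \sum_(k <- finmap.enum_fset (fset_set (range h)))
      (Num.max k 0%R)%:E * (\1_(h @^-1` [set k]) x)%:E) by case.
  elim: (finmap.enum_fset (fset_set (range h))) => [|k s [ms IH]].
    split; last by under eq_fun do rewrite big_nil.
    by under eq_fun do rewrite big_nil; exact: measurable_cst.
  have mh : measurable (h @^-1` [set k]).
    exact: measurable_sfunP.
  under eq_fun do rewrite big_cons; split.
    apply: emeasurable_funD => //; apply: measurable_funeM.
    by apply/measurable_EFinP; exact: measurable_indic.
  apply: Padd => //; first by rewrite le_max lexx orbT.
  move=> x; apply: sume_ge0 => i _; apply: mule_ge0; rewrite lee_fin//.
  by rewrite le_max lexx orbT.
pose g := nnsfun_approx measurableT mf.
rewrite (_ : f = fun x => limn (fun n => (EFin \o g n) x)); last first.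
  by apply/funext => x; apply/esym/cvg_lim => //; exact: cvg_nnsfun_approx.
apply: Plim => //.
- by move=> n; apply/measurable_EFinP.
- by move=> n x; rewrite lee_fin.
- by move=> x m n mn; rewrite lee_fin; exact/lefP/nd_nnsfun_approx.
Qed.

End nonnegative_functions.

Definition image_measure d d' (T : measurableType d)
    (U : measurableType d') (R : realType) (mu : {measure set T -> \bar R})
    (phi : T -> U) (mphi : measurable_fun setT phi) :
  {measure set U -> \bar R} :=
  measure_function_pushforward__canonical__measure_function_Measure mu mphi.

Section weighted_pushforward.
Context d d' (T : measurableType d) (U : measurableType d') (R : realType).
Local Open Scope ereal_scope.
Variables (mu : {measure set T -> \bar R}) (f : T -> R) (phi : T -> U).
Hypotheses (f0 : forall x, (0 <= f x)%R) (mf : measurable_fun setT f).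
Hypothesis mphi : measurable_fun setT phi.

Let m (A : set U) := \int[mu]_x ((f x)%:E * (\1_A (phi x))%:E).

Let m_fun A : measurable A ->
  measurable_fun setT (fun x => (f x)%:E * (\1_A (phi x))%:E).
Proof.
move=> mA; apply: emeasurable_funM; first exact/measurable_EFinP.
  apply/measurable_EFinP.
by apply: measurableT_comp => //; exact: measurable_indic.
Qed.

Let m0 : m set0 = 0.
Proof. by rewrite /m integral0_eq// => x _; rewrite indicE in_set0 mule0. Qed.

Let m_ge0 A : 0 <= m A.
Proof. by apply: integral_ge0 => x _; rewrite mule_ge0 ?lee_fin. Qed.

Let m_sigma_additive : semi_sigma_additive m.
Proof.
move=> F mF tF mUF.
rewrite /m [X in _ --> X](_ : _ =
    \sum_(0 <= n <oo) \int[mu]_x ((f x)%:E * (\1_(F n) (phi x))%:E)).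
  apply: is_cvg_nneseries => n _ _; exact: m_ge0.
rewrite -integral_nneseries//; last 2 first.
- by move=> n; exact: m_fun.
- by move=> n x _; rewrite mule_ge0 ?lee_fin.
apply: eq_integral => x _; rewrite nneseriesZl; last by move=> *; rewrite lee_fin.
congr (_ * _); rewrite [X in X = _](_ : _ = \d_(phi x) (\bigcup_n F n))//.
have /cvg_lim <- // := @measure_semi_sigma_additive _ _ _ (\d_(phi x) : {measure set U -> \bar R}) F mF tF mUF.
Qed.

(** The image under [phi] of the measure with density [f] with respect to [mu]. Levy measures,
    mixtures of tilts and restrictions are all built in this way. *)
Definition wpush : {measure set U -> \bar R} :=
  HB.pack m (isMeasure.Build _ _ _ m m0 m_ge0 m_sigma_additive).

Lemma wpushE A : wpush A = \int[mu]_x ((f x)%:E * (\1_A (phi x))%:E).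
Proof. by []. Qed.

Lemma integral_wpush (g : U -> \bar R) : measurable_fun setT g ->
  (forall x, 0 <= g x) ->
  \int[wpush]_y g y = \int[mu]_x ((f x)%:E * g (phi x)).
Proof.
pose mg g := measurable_fun setT (fun x : T => (f x)%:E * g (phi x) : \bar R).
move=> mg0 g0; apply: (@ge0_measurable_ind _ U R (fun g =>
  \int[wpush]_y g y = \int[mu]_x ((f x)%:E * g (phi x)))) => //.
- by rewrite !integral0_eq// => x _; rewrite mule0.
- move=> k A h k0 mA mh h0 hE.
  have mA1 : measurable_fun setT (fun x => (\1_A x)%:E : \bar R).
    by apply/measurable_EFinP; exact: measurable_indic.
  have A0 x : 0 <= (\1_A x)%:E :> \bar R by rewrite lee_fin.
  have fA0 x : 0 <= (f x)%:E * (\1_A (phi x))%:E.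
    by rewrite mule_ge0 ?lee_fin.
  have fh0 x : 0 <= (f x)%:E * h (phi x) by rewrite mule_ge0 ?lee_fin.
  have kA0 x : 0 <= k%:E * (\1_A x)%:E by rewrite mule_ge0 ?lee_fin.
  have mkA : measurable_fun setT (fun x => k%:E * (\1_A x)%:E).
    exact: measurable_funeM.
  have mfh : measurable_fun setT (fun x => (f x)%:E * h (phi x)).
    apply: emeasurable_funM; first exact/measurable_EFinP.
    exact: measurableT_comp mphi.
  rewrite ge0_integralD// ge0_integralZl// integral_indic// setIT hE wpushE.
  rewrite -ge0_integralZl//; last exact: m_fun.
  rewrite -ge0_integralD//; last 2 first.
    by move=> x _; rewrite mule_ge0.
    exact/measurable_funeM/m_fun.
  apply: eq_integral => x _.
  by rewrite ge0_muleDr// muleCA.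
- move=> h mh h0 ndh hE; rewrite monotone_convergence//.
  under eq_fun do rewrite hE.
  rewrite -monotone_convergence//; last 3 first.
  + move=> n; apply: emeasurable_funM; first exact/measurable_EFinP.
    exact: measurableT_comp mphi.
  + by move=> n x _; rewrite mule_ge0 ?lee_fin.
  + by move=> x _ a b ab; rewrite lee_wpmul2l ?lee_fin ?ndh.
  apply: eq_integral => x _; apply/cvg_lim => //.
  apply: cvgeMl => //.
  by apply: ereal_nondecreasing_is_cvgn; exact: ndh.
Qed.

End weighted_pushforward.

(* The library's lebesgue_measure lives on measurableTypeR R, whose measurable
   structure is only propositionally that of R. *)
Section lebesgue_measure_R.
Context {R : realType}.

Definition lebR (A : set R) : \bar R := @lebesgue_measure R A.

Let lebR0 : lebR set0 = 0%E. Proof. exact: measure0. Qed.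

Let lebR_ge0 A : (0 <= lebR A)%E. Proof. exact: measure_ge0. Qed.

Let lebR_sigma_additive : semi_sigma_additive lebR.
Proof.
move=> F mF tF mUF.
exact: (@measure_semi_sigma_additive _ _ _ (@lebesgue_measure R) F mF tF mUF).
Qed.

HB.instance Definition _ :=
  isMeasure.Build _ R R lebR lebR0 lebR_ge0 lebR_sigma_additive.

Let lebR_sigma_finite : sigma_finite setT lebR.
Proof. exact: (sigma_finiteT (@lebesgue_measure R)). Qed.

HB.instance Definition _ :=
  Measure_isSigmaFinite.Build _ _ _ lebR lebR_sigma_finite.

Lemma integral_lebR (D : set R) (f : R -> \bar R) :
  measurable D -> measurable_fun D f -> (forall x, D x -> 0 <= f x)%E ->
  (\int[lebR]_(x in D) f x = \int[@lebesgue_measure R]_(x in D) f x)%E.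
Proof.
move=> mD mf f0.
have mid : measurable_fun setT (fun x : measurableTypeR R => x : R) by [].
rewrite -[RHS](@ge0_integral_pushforward _ _ (measurableTypeR R) R R _ mid
  (@lebesgue_measure R) D f) //; last by move=> x; rewrite inE; exact: f0.
Qed.

Lemma measurable_addr (c : R) : measurable_fun setT (fun x : R => x + c).
Proof. exact: measurable_funD. Qed.

Lemma lebR_shift (c : R) (A : set R) : measurable A ->
  lebR [set x | A (x + c)] = lebR A.
Proof.
move=> mA; apply/esym.
pose mc : measurable_fun (setT : set (measurableTypeR R))
  (fun x : measurableTypeR R => x + c : measurableTypeR R) := measurable_addr c.
pose m : {measure set (measurableTypeR R) -> \bar R} :=
  @image_measure _ _ _ _ R (@lebesgue_measure R) _ mc.
apply: (@lebesgue_measure_unique R m) => // _ [[a b] _ <-].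
rewrite /m/= /pushforward.
rewrite (_ : _ @^-1` _ = `]a - c, b - c]%classic); last first.
  by apply/seteqP; split=> x /=; rewrite !in_itv/= ltrBlDr lerBrDr.
rewrite !lebesgue_measure_itv/= !lte_fin ltrD2r.
by case: ifP => // _; rewrite -!EFinB; congr (_%:E); ring.
Qed.

Lemma integral_lebR_shift (c : R) (f : R -> \bar R) : measurable_fun setT f ->
  (forall x, 0 <= f x)%E -> (\int[lebR]_x f (x + c)%R = \int[lebR]_x f x)%E.
Proof.
move=> mf f0.
rewrite -[LHS](@ge0_integral_pushforward _ _ R R R _ (measurable_addr c) lebR setT f) //.
apply: (@eq_measure_integral _ _ R setT lebR (image_measure lebR (measurable_addr c))) => A mA _.
exact: lebR_shift.
Qed.

Lemma lebR_itvoc (a b : R) : a <= b -> lebR `]a, b]%classic = (b - a)%:E.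
Proof.
move=> ab; rewrite /lebR lebesgue_measure_itv/= lte_fin.
case: ltP => // ba; have -> : a = b by apply/eqP; rewrite eq_le ab.
by rewrite subrr.
Qed.

Lemma measure_unique_oc (m1 m2 : {measure set R -> \bar R}) :
  (forall k : nat, m1 `](- k%:R)%R, k%:R]%classic < +oo)%E ->
  (forall a b : R, a <= b -> m1 `]a, b]%classic = m2 `]a, b]%classic) ->
  forall A, measurable A -> m1 A = m2 A.
Proof.
move=> m1fin m12.
have ocE : (@measurable _ R) = <<s @ocitv R >> by [].
move=> A mA; refine (@measure_unique _ R R (@ocitv R) (fun k : nat => `]- k%:R, k%:R]%classic) ocE _ _ _ m1 m2 _ _ A mA) => //.
- exact: ocitvI.
- by move=> k; exists (- k%:R, k%:R).
- apply/seteqP; split => // x _; exists (Num.truncn `|x|).+1 => //=.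
  rewrite in_itv/=; have /ltr_normlP[h1 h2] := truncnS_gt `|x|.
  by rewrite ltrNl h1 ltW.
- move=> _ [[a b] _ <-]/=; have [ab|ba] := leP a b; first exact: m12.
  by rewrite set_itv_ge ?measure0// -leNgt bnd_simp ltW.
Qed.

End lebesgue_measure_R.

Section bounded_convergence.
Context d (T : measurableType d) (R : realType).

Lemma bounded_cvg_integral (mu : {measure set T -> \bar R}) (M : R)
    (f_ : (T -> R)^nat) (f : T -> R) : (mu setT < +oo)%E ->
  (forall n, measurable_fun setT (f_ n)) -> measurable_fun setT f ->
  (forall n x, `|f_ n x| <= M) -> (forall x, f_ ^~ x @ \oo --> f x) ->
  (\int[mu]_x (f_ n x)%:E @[n --> \oo] --> \int[mu]_x (f x)%:E)%E.
Proof.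
move=> mufin mf_ mf f_M f_f.
have [//|||||_ _] := @dominated_convergence _ T R mu setT measurableT
  (fun n x => (f_ n x)%:E) (EFin \o f) (cst M%:E); last exact.
- by move=> n; exact/measurable_EFinP.
- exact/measurable_EFinP.
- by apply: aeW => x _; apply/cvg_EFin; [exact: nearW|exact: f_f].
- apply/integrableP; split; first exact: measurable_cst.
  under eq_integral do rewrite /=.
  by rewrite integral_cst//= lte_mul_pinfty// lee_fin.
- by apply: aeW => x n _; rewrite lee_fin.
Qed.

End bounded_convergence.

Lemma measure_eq_off_null d (T : measurableType d) (R : realType)
    (mu : {measure set T -> \bar R}) (A B N : set T) :
  measurable A -> measurable B -> measurable N -> mu N = 0%E ->
  (forall t, ~ N t -> A t <-> B t) -> mu A = mu B.
Proof.
move=> mA mB mN N0 AB.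
have cut (C : set T) : measurable C -> mu C = mu (C `\` N).
  move=> mC; have b0 : mu (C `&` N) = 0%E.
    by apply: (subset_measure0 _ mN) => //; exact: measurableI.
  have mU : mu C = (mu (C `&` N) + mu (C `\` N))%E.
    rewrite -[in LHS](setUIDK C N); apply: measureU.
    - exact: measurableI.
    - exact: measurableD.
    - by apply/seteqP; split => // t [[_ ?] [_]].
  by rewrite mU b0 add0e.
rewrite (cut _ mA) (cut _ mB); congr (mu _).
by apply/seteqP; split => t [/AB h nN]; split => //; exact: (h nN).
Qed.

(** * Uniqueness of Laplace transforms for families of nonnegative coordinates *)

Section laplace_uniqueness.
Context d (T : measurableType d) (R : realType) (I : Type).

(** A finite linear form is coded by a list of pairs (coefficient, index), repetitions allowed:
    adding a coefficient is a cons, and [I] needs no decidable equality. *)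
Definition lsum (s : seq (R * I)) (y : I -> R) : R := \sum_(c <- s) c.1 * y c.2.

Definition lexp (s : seq (R * I)) (y : I -> R) : R := expR (- lsum s y).

Definition nngs (s : seq (R * I)) : bool := all (fun c => 0 <= c.1) s.

Lemma lsum_cons c s y : lsum (c :: s) y = c.1 * y c.2 + lsum s y.
Proof. by rewrite /lsum big_cons. Qed.

Lemma lexp_cons c s y : lexp (c :: s) y = expR (- (c.1 * y c.2)) * lexp s y.
Proof. by rewrite /lexp lsum_cons opprD expRD. Qed.

Lemma lexp_gt0 s y : 0 < lexp s y.
Proof. exact: expR_gt0. Qed.

Lemma lexp_ge0 s y : 0 <= lexp s y.
Proof. exact: expR_ge0. Qed.

Lemma lsum_ge0 s y : nngs s -> (forall i, 0 <= y i) -> 0 <= lsum s y.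
Proof.
move=> + y0; elim: s => [|c s IH] /=; first by rewrite /lsum big_nil.
by case/andP => c0 /IH s0; rewrite lsum_cons addr_ge0// mulr_ge0.
Qed.

Lemma lexp_le1 s y : nngs s -> (forall i, 0 <= y i) -> lexp s y <= 1.
Proof. by move=> ns y0; rewrite -expR0 ler_expR oppr_le0 lsum_ge0. Qed.

Lemma measurable_lsum s (e : I -> T -> R) :
  (forall i, measurable_fun setT (e i)) ->
  measurable_fun setT (fun t => lsum s (e ^~ t)).
Proof.
move=> me; apply: measurable_sum => c.
by apply: measurable_funM => //; exact: measurable_cst.
Qed.

Lemma measurable_lexp s (e : I -> T -> R) :
  (forall i, measurable_fun setT (e i)) ->
  measurable_fun setT (fun t => lexp s (e ^~ t)).
Proof.
move=> me; apply: measurableT_comp => //; apply: measurableT_comp => //.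
exact: measurable_lsum.
Qed.

(** About n exp(n c). The extra factor n sends the limit below to 0 also at y = c, where exp(n c)
    alone would give exp(-1) for c > 0. *)
Let N (c : R) (n : nat) := (Num.truncn (n%:R * expR (n%:R * c))).+1.

(** Each term is a polynomial in exp(-n y), so its integral is known from Laplace transforms. With z
    = exp(-n y), the power is at most exp(-z N) with z N >= n if y <= c, and at least 1 - N z with N
    z -> 0 if y > c. *)
Lemma ray_approx (c y : R) : 0 <= c -> 0 <= y ->
  (1 - expR (- (n%:R * y))) ^+ (N c n) @[n --> \oo] --> ((c < y)%R%:R : R).
Proof.
move=> c0 y0.
pose z n : R := expR (- (n%:R * y)).
have z01 n : 0 <= z n <= 1.
  by rewrite /z expR_ge0 -expR0 ler_expR oppr_le0 mulr_ge0.
have Nlt n : n%:R * expR (n%:R * c) <= (N c n)%:R.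
  by rewrite ltW// truncnS_gt.
have NS n : (N c n)%:R <= n%:R * expR (n%:R * c) + 1.
  by rewrite /N -natr1 lerD2r truncn_le// mulr_ge0// expR_ge0.
have [cy|yc] := ltP c y; last first.
  apply: (@squeeze_cvgr _ _ _ _ (cst 0) (fun n => (n.+1%:R)^-1)).
  - near=> n; have /andP[z0 z1] := z01 n.
    rewrite exprn_ge0 ?subr_ge0//=.
    apply: (@le_trans _ _ (expR (- (z n * (N c n)%:R)))).
      rewrite -[X in _ <= expR X]mulNr expRM_natr; apply: lerXn2r; rewrite ?nnegrE ?subr_ge0 ?expR_ge0//.
      exact: expR_ge1Dx.
    apply: (@le_trans _ _ (expR (- n%:R))).
      rewrite ler_expR lerN2 (le_trans _ (ler_wpM2l z0 (Nlt n)))//.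
      rewrite mulrCA ler_peMr// /z -expRD -expR0 ler_expR -mulrN -mulrDr.
      by rewrite mulr_ge0// addrC subr_ge0.
    rewrite expRN lef_pV2 ?posrE ?expR_gt0// -natr1 addrC.
    exact: expR_ge1Dx.
  - exact: cvg_cst.
  - exact: cvg_harmonic.
pose del := y - c.
have d0 : 0 < del by rewrite subr_gt0.
have yp : 0 < y by rewrite (le_lt_trans c0).
apply: (@squeeze_cvgr _ _ _ _
  (fun n => 1 - (2 / del ^+ 2 + y^-1) * (n.+1%:R)^-1 * 2) (cst 1)).
- near=> n; have /andP[z0 z1] := z01 n.
  have n0 : (0 < n)%N by near: n; exists 1%N.
  have nR : 0 < n%:R :> R by rewrite ltr0n.
  apply/andP; split; last by rewrite exprn_ile1// ?subr_ge0// lerBlDr lerDl.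
  apply: (@le_trans _ _ (1 - (N c n)%:R * z n)); last first.
    elim: (N c n) => [|k IH]; first by rewrite mul0r subr0 expr0.
    rewrite exprS; apply: (@le_trans _ _ ((1 - z n) * (1 - k%:R * z n))).
      rewrite -natr1; have : 0 <= k%:R * z n ^+ 2 by rewrite mulr_ge0// exprn_ge0.
      nra.
    by rewrite ler_wpM2l// subr_ge0.
  rewrite lerD2l lerN2.
  apply: (le_trans (ler_wpM2r z0 (NS n))).
  rewrite mulrDl mul1r -[n%:R * _ * _]mulrA /z -expRD.
  have -> : n%:R * c + - (n%:R * y) = - (n%:R * del) by rewrite /del; ring.
  (* The bound exp(x) >= x^2 / 2 at x = n del turns exponential decay into a decay of order 1/n, the
     form in which the squeeze is stated. *)
  have H1 : n%:R * expR (- (n%:R * del)) <= 2 / del ^+ 2 * n%:R^-1.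
    have nd0 : 0 <= n%:R * del by rewrite mulr_ge0// ltW.
    have := expR_ge1Dxn 1 nd0; rewrite factS => H.
    rewrite expRN ler_pdivrMr ?expR_gt0//.
    apply: (@le_trans _ _ (2 / del ^+ 2 / n%:R * ((n%:R * del) ^+ 2 / 2))).
      by rewrite le_eqVlt; apply/orP; left; apply/eqP; field; rewrite ?gt_eqF//.
    apply: ler_wpM2l; first by rewrite ltW// !mulr_gt0 ?invr_gt0 ?exprn_gt0.
    by apply: le_trans H; rewrite lerDr.
  have H2 : expR (- (n%:R * y)) <= y^-1 * n%:R^-1.
    rewrite expRN -invfM lef_pV2 ?posrE ?expR_gt0// ?mulr_gt0//.
    by rewrite mulrC (le_trans _ (expR_ge1Dx _))// lerDr.
  have H3 : (n%:R)^-1 <= n.+1%:R^-1 * 2 :> R.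
    rewrite mulrC ler_pdivlMr ?ltr0n// mulrC ler_pdivrMr// -natr1.
    have : 1 <= n%:R :> R by rewrite ler1n.
    lra.
  apply: (le_trans (lerD H1 H2)); rewrite -mulrDl -mulrA.
  apply: ler_wpM2l => //.
  by rewrite ltW// addr_gt0 ?mulr_gt0 ?invr_gt0 ?exprn_gt0.
- rewrite -[X in _ --> X]subr0; apply: cvgB; first exact: cvg_cst.
  rewrite -[X in _ --> X](mul0r 2) -(mulr0 (2 / del ^+ 2 + y^-1)).
  apply: cvgM; last exact: cvg_cst.
  by apply: cvgM; [exact: cvg_cst|exact: cvg_harmonic].
- exact: cvg_cst.
Unshelve. all: by end_near. Qed.

Section ray_boxes.
Variables (mu nu : {measure set T -> \bar R}) (e : I -> T -> R).
Hypotheses (mufin : (mu setT < +oo)%E) (nufin : (nu setT < +oo)%E).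
Hypothesis me : forall i, measurable_fun setT (e i).
Hypothesis e0 : forall i t, 0 <= e i t.
Hypothesis laplaceE : forall s, nngs s ->
  (\int[mu]_t (lexp s (e ^~ t))%:E = \int[nu]_t (lexp s (e ^~ t))%:E)%E.

Let good (f : T -> R) := [/\ measurable_fun setT f, forall t, 0 <= f t <= 1 &
  forall s, nngs s -> (\int[mu]_t (f t * lexp s (e ^~ t))%:E =
                       \int[nu]_t (f t * lexp s (e ^~ t))%:E)%E].

Let lexp01 s t : nngs s -> 0 <= lexp s (e ^~ t) <= 1.
Proof. by move=> ns; rewrite lexp_ge0 lexp_le1. Qed.

Let good_integrable (m : {measure set T -> \bar R}) (f : T -> R) s : (m setT < +oo)%E ->
  measurable_fun setT f -> (forall t, 0 <= f t <= 1) -> nngs s ->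
  m.-integrable setT (EFin \o (fun t => f t * lexp s (e ^~ t))).
Proof.
move=> mfin mf f01 ns; apply: measurable_bounded_integrable => //.
  by apply: measurable_funM => //; exact: measurable_lexp.
exists 1; split; first exact: num_real.
move=> x x1 t _ /=; rewrite ger0_norm.
  apply: le_trans (ltW x1); have /andP[f0 f1] := f01 t.
  by have /andP[l0 l1] := lexp01 t ns; exact: mulr_ile1.
have /andP[f0 f1] := f01 t; exact: mulr_ge0 (lexp_ge0 _ _).
Qed.

Let good_factor f i (k : R) : 0 <= k -> good f ->
  good (fun t => f t * (1 - expR (- (k * e i t)))).
Proof.
move=> k0 [mf f01 fE]; split.
- apply: measurable_funM => //; apply: measurable_funB => //.
  do 2 apply: measurableT_comp => //.
  by apply: measurable_funM => //; exact: measurable_cst.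
- move=> t; have /andP[f0 f1] := f01 t.
  have : 0 <= expR (- (k * e i t)) <= 1.
    by rewrite expR_ge0 -expR0 ler_expR oppr_le0 mulr_ge0.
  by move=> /andP[z0 z1]; rewrite mulr_ge0 ?subr_ge0//= mulr_ile1 ?subr_ge0// lerBlDr lerDl.
- move=> s ns.
  have E t : (f t * (1 - expR (- (k * e i t))) * lexp s (e ^~ t))%:E =
     ((f t * lexp s (e ^~ t))%:E - (f t * lexp ((k, i) :: s) (e ^~ t))%:E)%E.
    by rewrite -EFinB lexp_cons/=; congr (_%:E); ring.
  have nks : nngs ((k, i) :: s) by rewrite /nngs/= k0.
  under eq_integral do rewrite E.
  under [RHS]eq_integral do rewrite E.
  by rewrite !integralB_EFin ?fE//; exact: good_integrable.
Qed.

Let good_ray f i (c : R) : good f -> good (fun t => f t * (c < e i t)%R%:R).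
Proof.
move=> gf; have [c0|c0] := ltP c 0.
  rewrite (_ : (fun t => _) = f)//; apply/funext => t.
  by rewrite (lt_le_trans c0 (e0 i t)) mulr1.
have [mf f01 fE] := gf.
have mray : measurable_fun setT (fun t => (c < e i t)%R%:R : R).
  apply: (measurableT_comp (f := fun b : bool => b%:R : R)) => //.
  by apply: measurable_fun_ltr => //; exact: measurable_cst.
split.
- exact: measurable_funM.
- by move=> t; case: (c < e i t); rewrite ?mulr1 ?mulr0// lexx ler01.
- move=> s ns.
  pose g n t := f t * (1 - expR (- (n%:R * e i t))) ^+ N c n.
  have gg n : good (g n).
    rewrite /g; elim: (N c n) => [|k IH].
      by rewrite (_ : (fun t => _) = f)//; apply/funext => t; rewrite expr0 mulr1.
    rewrite (_ : (fun t => _) = fun t => f t *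
        (1 - expR (- (n%:R * e i t))) ^+ k * (1 - expR (- (n%:R * e i t)))).
      exact: good_factor.
    by apply/funext => t; rewrite exprSr mulrA.
  have cvg (m : {measure set T -> \bar R}) : (m setT < +oo)%E ->
      (\int[m]_t (g n t * lexp s (e ^~ t))%:E @[n --> \oo] -->
       \int[m]_t (f t * (c < e i t)%R%:R * lexp s (e ^~ t))%:E)%E.
    move=> mfin; apply: (bounded_cvg_integral (M := 1)) => //.
    + move=> n; apply: measurable_funM; first by have [] := gg n.
      exact: measurable_lexp.
    + by apply: measurable_funM; [exact: measurable_funM|exact: measurable_lexp].
    + move=> n t; have [_ /(_ t)/andP[g0 g1] _] := gg n.
      have /andP[l0 l1] := lexp01 t ns.
      rewrite ger0_norm; first exact: mulr_ile1.
      exact: mulr_ge0.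
    + move=> t; apply: cvgM; last exact: cvg_cst.
      by apply: cvgM; [exact: cvg_cst|exact: ray_approx].
  have := cvg _ mufin; rewrite (_ : (fun n => _) =
      fun n => \int[nu]_t (g n t * lexp s (e ^~ t))%:E)%E.
    by move=> h; apply: (cvg_unique _ h (cvg _ nufin)).
  by apply/funext => n; have [_ _ ->] := gg n.
Qed.

Lemma measure_ray_box (r : seq (R * I)) :
  mu [set t | all (fun p => p.1 < e p.2 t) r] =
  nu [set t | all (fun p => p.1 < e p.2 t) r].
Proof.
have : good (fun t => (all (fun p => p.1 < e p.2 t) r)%:R).
  elim: r => [|[c i] r IH] /=.
    split; [exact: measurable_cst|by move=> t; rewrite ler01 lexx|].
    by move=> s ns; under eq_integral do rewrite mul1r;
      under [RHS]eq_integral do rewrite mul1r; exact: laplaceE.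
  rewrite (_ : (fun t => _) =
    (fun t => (all (fun p => p.1 < e p.2 t) r)%:R * (c < e i t)%R%:R)).
    exact: good_ray.
  by apply/funext => t; rewrite andbC -natrM mulnb.
move=> [ma _ /(_ [::] isT)]; rewrite /lexp.
have E t : ((all (fun p : R * I => p.1 < e p.2 t) r)%:R *
    expR (- lsum [::] (e ^~ t)) = \1_[set t | all (fun p => p.1 < e p.2 t) r] t :> R).
  by rewrite /lsum big_nil oppr0 expR0 mulr1 indicE mem_setE.
under eq_integral do rewrite E.
under [in X in _ = X -> _]eq_integral do rewrite E.
have mA : measurable [set t | all (fun p => p.1 < e p.2 t) r].
  have := ma measurableT [set 1] (measurable_set1 _); rewrite setTI.
  congr (measurable _); apply/seteqP; split => t /=.
    by case: all => // /eqP; rewrite eq_sym oner_eq0.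
  by move=> ->.
by rewrite !integral_indic// !setIT.
Qed.

End ray_boxes.

(** Boxes of open rays generate and are stable under intersection, and [measure_ray_box] compares
    them. Nonnegativity is known only almost everywhere, one coordinate at a time, so the
    coordinates are first replaced by their positive parts. *)
Lemma laplace_unique (mu nu : {measure set T -> \bar R}) (e : I -> T -> R) :
  (@measurable _ T `<=` <<s [set A | exists i B, measurable B /\ A = e i @^-1` B] >>) ->
  (mu setT < +oo)%E -> (nu setT < +oo)%E ->
  (forall i, measurable_fun setT (e i)) ->
  (forall i, mu [set t | e i t < 0] = 0%E) ->
  (forall i, nu [set t | e i t < 0] = 0%E) ->
  (forall s, nngs s -> (\int[mu]_t (lexp s (e ^~ t))%:E =
                        \int[nu]_t (lexp s (e ^~ t))%:E)%E) ->
  forall A, measurable A -> mu A = nu A.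
Proof.
move=> mE mufin nufin me mu0 nu0 lE.
pose e' i t : R := Num.max 0 (e i t).
have me' i : measurable_fun setT (e' i).
  by apply: measurable_maxr => //; exact: measurable_cst.
have e'0 i t : 0 <= e' i t by rewrite le_max lexx.
have mneg i : measurable [set t | e i t < 0].
  have := me i measurableT `]-oo, 0[%classic (measurable_itv _); rewrite setTI.
  by congr measurable; apply/seteqP; split => t /=; rewrite in_itv.
(* [I] may be uncountable, so the exceptional set is formed over the indices of the list in use
   only. *)
pose bad (r : seq (R * I)) := \big[setU/set0]_(p <- r) [set t | e p.2 t < 0].
have mbad r : measurable (bad r) by apply: bigsetU_measurable => p _.
have bad0 (m : {measure set T -> \bar R}) r :
    (forall i, m [set t | e i t < 0] = 0%E) -> m (bad r) = 0%E.
  move=> m0; rewrite /bad; elim: r => [|p r IH]; rewrite ?big_nil ?measure0// big_cons.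
  apply/eqP; rewrite eq_le measure_ge0 andbT.
  apply: (le_trans (measureU2 _ _ _)); [exact: mneg|exact: mbad|].
  rewrite -[leRHS]adde0; apply: leeD; rewrite le_eqVlt; apply/orP; left;
    by apply/eqP; do [exact: m0|exact: IH].
have e'E r t : ~ bad r t -> forall p, List.In p r -> e' p.2 t = e p.2 t.
  rewrite /bad; elim: r => [//|q r IH]; rewrite big_cons => /not_orP[/negP].
  rewrite -leNgt => q0 /IH{}IH p /= [<-|/IH//].
  by rewrite /e' max_r.
have lE' s : nngs s -> (\int[mu]_t (lexp s (e' ^~ t))%:E =
                        \int[nu]_t (lexp s (e' ^~ t))%:E)%E.
  have E (m : {measure set T -> \bar R}) :
      (forall i, m [set t | e i t < 0] = 0%E) ->
      (\int[m]_t (lexp s (e' ^~ t))%:E = \int[m]_t (lexp s (e ^~ t))%:E)%E.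
    move=> m0; apply: ge0_ae_eq_integral => //.
    - by apply/measurable_EFinP; exact: measurable_lexp.
    - by apply/measurable_EFinP; exact: measurable_lexp.
    - by move=> t _; rewrite lee_fin lexp_ge0.
    - by move=> t _; rewrite lee_fin lexp_ge0.
    - exists (bad s); split; [exact: mbad|exact: bad0|].
      move=> t /= /not_implyP[_]; apply: contra_notP => /e'E bt.
      congr (_%:E); rewrite /lexp /lsum; congr (expR (- _)).
      elim: s bt => [|c s IH] bt; rewrite ?big_nil// !big_cons bt; last by left.
      by rewrite IH// => p ps; apply: bt; right.
  by move=> ns; rewrite !E// lE.
have boxE (m : {measure set T -> \bar R}) r :
    (forall i, m [set t | e i t < 0] = 0%E) ->
    m [set t | all (fun p => p.1 < e p.2 t) r] =
    m [set t | all (fun p => p.1 < e' p.2 t) r].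
  move=> m0.
  have mall (f : I -> T -> R) : (forall i, measurable_fun setT (f i)) ->
      measurable [set t | all (fun p => p.1 < f p.2 t) r].
    move=> mf; elim: r => [|[c i] r IH] /=.
      by rewrite (_ : [set t | _] = setT)//; apply/seteqP; split.
    rewrite (_ : [set t | _] = (f i @^-1` `]c, +oo[) `&`
        [set t | all (fun p => p.1 < f p.2 t) r]).
      apply: measurableI => //; rewrite -[X in measurable X]setTI.
      by apply: mf => //; exact: measurable_itv.
    by apply/seteqP; split => t /=; rewrite in_itv/= andbT; [move/andP|case=> -> ->].
  have allE t : ~ bad r t -> all (fun p => p.1 < e p.2 t) r =
      all (fun p => p.1 < e' p.2 t) r.
    move/e'E; elim: (r) => [//|q r' IH] bt /=.
    rewrite -(bt q); last by left.
    by congr andb; apply: IH => p pr; apply: bt; right.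
  apply: (measure_eq_off_null (mall _ me) (mall _ me') (mbad r) (bad0 _ _ m0)).
  by move=> t nb /=; rewrite allE.
pose G := [set A | exists r : seq (R * I), A = [set t | all (fun p => p.1 < e p.2 t) r]].
have GT : G setT by exists [::]; apply/seteqP; split.
apply: (@measure_unique _ R T G (fun=> setT)).
- apply/seteqP; split.
    apply: (subset_trans mE); apply: smallest_sub; first exact: smallest_sigma_algebra.
    move=> _ [i [B [mB ->]]].
    have mi : measurable_fun (setT : set (g_sigma_algebraType G)) (e i : g_sigma_algebraType G -> R).
      apply: (measurability _ (RGenOInfty.measurableE R)) => _ [_ [c ->] <-].
      apply: sub_sigma_algebra; exists [:: (c, i)]; apply/seteqP; split => t /=;
        by rewrite in_itv/= !andbT // => -[].
    by have := mi measurableT B mB; rewrite setTI.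
  apply: smallest_sub; first exact: sigma_algebra_measurable.
  move=> _ [r ->]; elim: r => [|[c i] r IH] /=.
    by rewrite (_ : [set t | _] = setT)//; apply/seteqP; split.
  rewrite (_ : [set t | _] = (e i @^-1` `]c, +oo[) `&`
      [set t | all (fun p => p.1 < e p.2 t) r]).
    apply: measurableI => //; rewrite -[X in measurable X]setTI.
    by apply: me => //; exact: measurable_itv.
  by apply/seteqP; split => t /=; rewrite in_itv/= andbT; [move/andP|case=> -> ->].
- move=> _ _ [r ->] [r' ->]; exists (r ++ r'); apply/seteqP; split => t /=;
    rewrite all_cat; [by case=> -> ->|by move/andP].
- by [].
- by apply/seteqP; split => // t _; exists 0%N.
- move=> _ [r ->]; rewrite !boxE//.
  exact: (@measure_ray_box mu nu e').
- by [].
Qed.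

End laplace_uniqueness.

(** * Inverses of continuous nondecreasing functions *)

Section clock_inverse.
Context (R : realType).
Implicit Types (f g h : R -> R) (s t u v r e : R).

Definition clock f := [/\ f 0 = 0, (forall s t : R, 0 <= s -> s <= t -> f s <= f t) &
  {within `[0, +oo[, continuous f}].

Definition reached f u : Prop := exists2 t, 0 <= t & u <= f t.

(** The left-continuous inverse of f. Its value means nothing when the level is not reached, hence
    the hypothesis [reached] in what follows. *)
Definition hit f u : R := inf [set t | 0 <= t /\ u <= f t].

Lemma clock_eps f t e : clock f -> 0 <= t -> 0 < e ->
  exists2 dl : R, 0 < dl & forall s : R, 0 <= s -> `|t - s| < dl -> `|f t - f s| < e.
Proof.
move=> [_ _ /subspace_continuousP fc] t0 e0.
have /(fc t) /cvgrPdist_lt /(_ e e0) : `[0, +oo[%classic t by rewrite /= in_itv/= t0.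
rewrite near_withinE => -[dl /= dl0 fdl]; exists dl => // s s0 ts.
by apply: fdl => //=; rewrite in_itv/= s0.
Qed.

Lemma clock_ge0 f t : clock f -> 0 <= t -> 0 <= f t.
Proof. by move=> [f0 fnd _] t0; rewrite -f0; exact: fnd. Qed.

Lemma hit_ge0 f u : reached f u -> 0 <= hit f u.
Proof.
move=> [t t0 ut]; apply: lb_le_inf; first by exists t.
by move=> s [].
Qed.

Let hit_lbound f u : has_lbound [set t | 0 <= t /\ u <= f t].
Proof. by exists 0 => t []. Qed.

Lemma le_hit f u : clock f -> reached f u -> u <= f (hit f u).
Proof.
move=> cf ru; rewrite leNgt; apply/negP => fu.
have h0 := hit_ge0 ru.
have [dl dl0 fdl] : exists2 dl : R, 0 < dl & forall s : R, 0 <= s ->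
    `|hit f u - s| < dl -> `|f (hit f u) - f s| < u - f (hit f u).
  by apply: clock_eps => //; rewrite subr_gt0.
have [t [t0 ut] tlt] : exists2 t : R, 0 <= t /\ u <= f t & t < hit f u + dl.
  apply: (@inf_adherent R [set t | 0 <= t /\ u <= f t]) => //; split => //.
  by case: ru => t ? ?; exists t.
have ht : hit f u <= t by apply: ge_inf => //; exact: hit_lbound.
have := fdl t t0; rewrite distrC ger0_norm ?subr_ge0// ltrBlDl => /(_ tlt).
rewrite ltr_distlC => /andP[_ h2]; move: ut; lra.
Qed.

Lemma hit_leP f u t : clock f -> reached f u -> 0 <= t -> (hit f u <= t) = (u <= f t).
Proof.
move=> cf ru t0; apply/idP/idP => [ht|ut].
  by case: (cf) => _ fnd _; apply: (le_trans (le_hit cf ru)); apply: fnd => //; exact: hit_ge0.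
by apply: ge_inf => //; exact: hit_lbound.
Qed.

Lemma lt_hitP f u t : clock f -> reached f u -> 0 <= t -> (t < hit f u) = (f t < u).
Proof. by move=> cf ru t0; rewrite !ltNge hit_leP. Qed.

Lemma clock_hit f u : clock f -> 0 <= u -> reached f u -> f (hit f u) = u.
Proof.
move=> cf u0 ru; apply/eqP; rewrite eq_le; apply/andP; split; last exact: le_hit.
rewrite leNgt; apply/negP => uf.
have h0 := hit_ge0 ru; have [f0 fnd fc] := cf.
have [||t] := @IVT _ f 0 (hit f u) u h0.
- by apply: continuous_subspaceW fc => x /=; rewrite !in_itv/= andbT => /andP[].
- have p0 := clock_ge0 cf h0; by rewrite f0 min_l// max_r// u0 ltW.
- rewrite in_itv/= => /andP[t0 th] ft; move: uf.
  suff -> : hit f u = t by rewrite ft ltxx.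
  by apply/eqP; rewrite eq_le th hit_leP// ft lexx.
Qed.

Lemma reached_nat f u : clock f -> reached f u <-> exists k : nat, u <= f k%:R.
Proof.
move=> cf; split=> [[t t0 ut]|[k ku]]; last by exists k%:R.
exists (Num.truncn t).+1; apply: (le_trans ut).
by case: cf => _ fnd _; apply: fnd => //; rewrite ltW// truncnS_gt.
Qed.

(** By continuity of g just after the hitting time, a rational time witnesses the inequality; values
    at inverse times become measurable through countable unions. *)
Lemma clock_lt_rat f g u r : clock f -> clock g ->
  (reached f u /\ g (hit f u) < r) <->
  exists q : rat, [/\ 0 <= ratr q :> R, u <= f (ratr q) & g (ratr q) < r].
Proof.
move=> cf cg; split => [[ru gr]|[q [q0 uq gq]]]; last first.
  have ru : reached f u by exists (ratr q).
  split=> //; apply: le_lt_trans gq; case: cg => _ gnd _; apply: gnd.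
    exact: hit_ge0.
  by rewrite hit_leP.
have h0 := hit_ge0 ru.
have [dl dl0 gdl] : exists2 dl : R, 0 < dl & forall s : R, 0 <= s ->
    `|hit f u - s| < dl -> `|g (hit f u) - g s| < r - g (hit f u).
  by apply: clock_eps => //; rewrite subr_gt0.
have : hit f u < hit f u + dl by rewrite ltrDl.
move=> /rat_in_itvoo[q]; rewrite in_itv/= => /andP[hq qd].
have q0 : 0 <= ratr q :> R by rewrite (le_trans h0)// ltW.
exists q; split => //; first by rewrite -hit_leP// ltW.
have := gdl _ q0; rewrite distrC gtr0_norm ?subr_gt0// ltrBlDl => /(_ qd).
rewrite ltr_distlC => /andP[_]; lra.
Qed.

(** The form that adaptedness requires, with times up to t only. If the hitting time is t itself,
    there may be no rational in [0, t] at or beyond it, hence the separate clause on g t. *)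
Lemma clock_lt_rat_le f g u r t : clock f -> clock g -> 0 <= t -> u <= f t ->
  g (hit f u) < r <-> g t < r \/
  exists q : rat, [/\ 0 <= (ratr q : R) <= t, u <= f (ratr q) & g (ratr q) < r].
Proof.
move=> cf cg t0 ut; have ru : reached f u by exists t.
have ht : hit f u <= t by rewrite hit_leP.
split => [gr|[gt|[q [/andP[q0 _] uq gq]]]]; last first.
- by have [] := (clock_lt_rat u r cf cg).2 (ex_intro _ q (And3 q0 uq gq)).
- by apply: le_lt_trans gt; case: cg => _ gnd _; apply: gnd => //; exact: hit_ge0.
have [q [q0 uq gq]] := (clock_lt_rat u r cf cg).1 (conj ru gr).
have [qt|tq] := leP (ratr q) t; first by right; exists q; rewrite q0 qt.
by left; apply: le_lt_trans gq; case: cg => _ gnd _; apply: gnd => //; exact: ltW.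
Qed.

Lemma clock_cst0 : clock (fun=> 0 : R).
Proof. by split => //; apply: continuous_subspaceT => x; exact: cvg_cst. Qed.

Lemma clock_id : clock (fun t => t : R).
Proof. by split => //; apply: continuous_subspaceT => x; exact: cvg_id. Qed.

Lemma clockD f g : clock f -> clock g -> clock (fun t => f t + g t).
Proof.
move=> [f0 fnd fc] [g0 gnd gc]; split; first by rewrite f0 g0 addr0.
  by move=> s t s0 st; rewrite lerD ?fnd ?gnd.
move=> x; apply: cvgD; [exact: fc|exact: gc].
Qed.

Lemma clockM f (k : R) : 0 <= k -> clock f -> clock (fun t => k * f t).
Proof.
move=> k0 [f0 fnd fc]; split; first by rewrite f0 mulr0.
  by move=> s t s0 st; rewrite ler_wpM2l ?fnd.
by move=> x; apply: cvgMr; exact: fc.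
Qed.

Lemma clock_lsum (I : Type) (s : seq (R * I)) (F : I -> R -> R) :
  nngs s -> (forall i, clock (F i)) -> clock (fun t => lsum s (F ^~ t)).
Proof.
move=> + cF; elim: s => [_|c s IH /= /andP[c0 /IH cs]].
  by under eq_fun do rewrite /lsum big_nil; exact: clock_cst0.
by under eq_fun do rewrite lsum_cons; apply: clockD => //; exact: clockM.
Qed.

Section shift.
Variables (f g : R -> R) (r : R).
Hypotheses (cf : clock f) (cg : clock g) (r0 : 0 <= r).
Hypothesis fgE : forall t, 0 <= t -> f (t + r) = f r + g t.

Lemma reached_shift v : f r < v -> reached f v <-> reached g (v - f r).
Proof.
move=> rv; split=> [[t t0 vt]|[t t0 vt]].
  have rt : r <= t.
    rewrite leNgt; apply/negP => tr; move: (lt_le_trans rv vt); rewrite ltNge.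
    by case: cf => _ fnd _; rewrite fnd// ltW.
  by exists (t - r); rewrite ?subr_ge0// lerBlDl -fgE ?subr_ge0// subrK.
by exists (t + r); rewrite ?addr_ge0// fgE// -lerBlDl.
Qed.

(** Levels above f r are reached after r, where f is f r plus the shifted clock. At v = f r the
    formula fails if f is flat just before r, hence the strict inequality. *)
Lemma hit_shift v : f r < v -> reached f v -> hit f v = r + hit g (v - f r).
Proof.
move=> rv fv; have gv := (reached_shift rv).1 fv.
have h0 := hit_ge0 gv.
apply/eqP; rewrite eq_le; apply/andP; split.
  rewrite hit_leP ?addr_ge0// addrC fgE// -lerBlDl.
  exact: le_hit.
have rh : r <= hit f v by rewrite ltW// lt_hitP.
rewrite addrC -lerBrDr hit_leP ?subr_ge0// lerBlDl -fgE ?subr_ge0// subrK.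
exact: le_hit.
Qed.

End shift.

End clock_inverse.

Section integral_comp.
Context d1 d2 d (T1 : measurableType d1) (T2 : measurableType d2)
  (U : measurableType d) (R : realType).
Local Open Scope ereal_scope.
Variables (mu1 : {measure set T1 -> \bar R}) (mu2 : {measure set T2 -> \bar R}).
Variables (f1 : T1 -> U) (f2 : T2 -> U) (g1 : T1 -> \bar R) (g2 : T2 -> \bar R).
Hypotheses (mf1 : measurable_fun setT f1) (mf2 : measurable_fun setT f2).
Hypotheses (mg1 : measurable_fun setT g1) (mg2 : measurable_fun setT g2).
Hypotheses (g10 : forall x, 0 <= g1 x) (g20 : forall x, 0 <= g2 x).

(** The hypothesis is equality of two image measures with densities. The weights may be infinite,
    which is needed when a nonnegative functional of the future serves as weight. *)
Lemma integral_comp_eq : (forall A, measurable A ->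
    \int[mu1]_x (g1 x * (\1_A (f1 x))%:E) = \int[mu2]_x (g2 x * (\1_A (f2 x))%:E)) ->
  forall h : U -> \bar R, measurable_fun setT h -> (forall x, 0 <= h x) ->
    \int[mu1]_x (g1 x * h (f1 x)) = \int[mu2]_x (g2 x * h (f2 x)).
Proof.
have mgf d' (T : measurableType d') (g : T -> \bar R) (f : T -> U) (h : U -> \bar R) :
    measurable_fun setT g -> measurable_fun setT f -> measurable_fun setT h ->
    measurable_fun setT (fun x => g x * h (f x)).
  by move=> mg mf mh; apply: emeasurable_funM => //; exact: measurableT_comp mf.
have mind A : measurable A -> measurable_fun setT (fun x : U => (\1_A x)%:E : \bar R).
  by move=> mA; apply/measurable_EFinP; exact: measurable_indic.
move=> E h mh h0; move: h mh h0; apply: ge0_measurable_ind.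
- by rewrite !integral0_eq// => x _; rewrite mule0.
- move=> k A h k0 mA mh h0 hE.
  have split d' (T : measurableType d') (mu : {measure set T -> \bar R}) (g : T -> \bar R) (f : T -> U) :
      measurable_fun setT g -> (forall x, 0 <= g x) -> measurable_fun setT f ->
      \int[mu]_x (g x * (k%:E * (\1_A (f x))%:E + h (f x))) =
      k%:E * \int[mu]_x (g x * (\1_A (f x))%:E) + \int[mu]_x (g x * h (f x)).
    move=> mg g0 mf.
    have mgA := mgf _ _ _ _ _ mg mf (mind _ mA).
    rewrite -ge0_integralZl//; last by move=> x _; rewrite mule_ge0 ?lee_fin.
    rewrite -ge0_integralD//; last 4 first.
    + by move=> x _; rewrite !mule_ge0 ?lee_fin.
    + exact: measurable_funeM.
    + by move=> x _; rewrite mule_ge0.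
    + exact: mgf.
    apply: eq_integral => x _; rewrite ge0_muleDr// ?mule_ge0 ?lee_fin//.
    by rewrite muleCA.
  by rewrite !split// E// hE.
- move=> h mh h0 ndh hE.
  have lim d' (T : measurableType d') (mu : {measure set T -> \bar R}) (g : T -> \bar R) (f : T -> U) :
      measurable_fun setT g -> (forall x, 0 <= g x) -> measurable_fun setT f ->
      \int[mu]_x (g x * limn (h ^~ (f x))) = limn (fun n => \int[mu]_x (g x * h n (f x))).
    move=> mg g0 mf; rewrite -monotone_convergence//; last 3 first.
    + by move=> n; exact: mgf.
    + by move=> n x _; rewrite mule_ge0.
    + by move=> x _ a b ab; rewrite lee_wpmul2l ?ndh.
    apply: eq_integral => x _; apply/esym/cvg_lim => //.
    have nd : nondecreasing_seq (fun n => g x * h n (f x)).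
      by move=> a b ab; rewrite lee_wpmul2l ?ndh.
    suff -> : g x * limn (h ^~ (f x)) = limn (fun n => g x * h n (f x)).
      exact: ereal_nondecreasing_is_cvgn.
    have ch : cvgn (h ^~ (f x)) by apply: ereal_nondecreasing_is_cvgn; exact: ndh.
    case: (g x) (g0 x) => [r _|_|//]; first by rewrite limeMl.
    (* Multiplication by +oo does not commute with limits in general; along a nondecreasing sequence
       either all terms vanish or the products are eventually +oo. *)
    have [all0|/existsNP[N /eqP hN]] := pselect (forall n, h n (f x) = 0).
      have -> : h ^~ (f x) = cst 0 by apply/funext => n; exact: all0.
      have -> : (fun n => +oo * h n (f x)) = cst 0.
        by apply/funext => n; rewrite all0 mule0.
      by rewrite lim_cst// mule0.
    have hN0 : 0 < h N (f x) by rewrite lt0e hN h0.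
    rewrite gt0_mulye; last first.
      apply: (lt_le_trans hN0).
      by apply: (@lime_ge _ _ _ _ _ _ ch); exists N => // n /= Nn; exact: ndh.
    apply/esym; apply: lim_near_cst => //; exists N => // n /= Nn.
    by rewrite gt0_mulye// (lt_le_trans hN0)// ndh.
  by rewrite !lim//; under eq_fun do rewrite hE.
Qed.

End integral_comp.

Lemma integral_exponential (R : realType) (t l : R) : 0 <= t -> 0 <= l ->
  (\int[@lebR R]_u ((0 < u <= l)%R%:R * (t * expR (- (t * u))))%:E =
   (1 - expR (- (t * l)))%:E)%E.
Proof.
move=> t0 l0; pose f u : R := t * expR (- (t * u)).
have cf : continuous f.
  move=> u; apply: cvgM; first exact: cvg_cst.
  apply: continuous_comp; last exact: continuous_expR.
  by apply: cvgN; apply: cvgM; [exact: cvg_cst|exact: cvg_id].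
have mf : measurable_fun setT (fun u => (f u)%:E).
  by apply/measurable_EFinP; exact: continuous_measurable_fun.
transitivity (\int[@lebR R]_(u in `]0%R, l]) (f u)%:E)%E.
  rewrite [RHS]integral_mkcond; apply: eq_integral => u _.
  rewrite patchE; have [|] := boolP (u \in _).
    by rewrite inE/= in_itv/= => ->; rewrite mul1r.
  by rewrite notin_setE/= in_itv/= => /negP/negbTE ->; rewrite mul0r.
rewrite integral_lebR//; last 2 first.
- exact: measurable_funTS.
- by move=> u _; rewrite lee_fin mulr_ge0// expR_ge0.
rewrite integral_itv_obnd_cbnd; last exact: measurable_funTS.
move: l0; rewrite le_eqVlt => /predU1P[<-|l0].
  by rewrite set_itv1 integral_set1 mulr0 oppr0 expR0 subrr.
have dF x : is_derive x (1:R) (fun u : R => - expR (- (t * u))) (f x).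
  rewrite (_ : (fun u : R => _) = - (expR \o ((- t) \*: (@id R)))); last first.
    by apply/funext => u; rewrite -mulNr.
  apply: is_derive_eq; rewrite /f /= /GRing.scale/= mulNr; ring.
rewrite (@continuous_FTC2 _ f (fun u => - expR (- (t * u))) 0 l)//.
- by rewrite mulr0 oppr0 expR0 -EFinB; congr (_%:E); ring.
- exact: continuous_subspaceT.
- have cF : continuous (fun u : R => - expR (- (t * u))).
    by move=> x; apply/differentiable_continuous/derivable1_diffP; apply: ex_derive.
  split; first by move=> x _; exact: ex_derive.
    exact/cvg_at_right_filter/cF.
  exact/cvg_at_left_filter/cF.
- by move=> x _; rewrite derive1E; apply: derive_val.
Qed.

Section inverse_part.
Context {R : realType}.

(** The inverse cut to 0 outside the positive half-line, so that densities built from it are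
    nonnegative everywhere; the power form gives measurability. *)
Definition invp (u : R) : R := (0 < u)%R%:R * u `^ (-1).

Lemma invpE u : 0 < u -> invp u = u^-1.
Proof. by move=> u0; rewrite /invp u0 mul1r powR_inv1// ltW. Qed.

Lemma invp_le0 u : u <= 0 -> invp u = 0.
Proof. by rewrite /invp leNgt => /negbTE ->; rewrite mul0r. Qed.

Lemma invp_ge0 u : 0 <= invp u.
Proof. by rewrite mulr_ge0// powR_ge0. Qed.

Lemma measurable_pos_ind : measurable_fun setT (fun u : R => (0 < u)%R%:R : R).
Proof.
apply: (measurableT_comp (f := fun b : bool => b%:R : R)) => //.
by apply: measurable_fun_ltr => //; exact: measurable_cst.
Qed.

Lemma measurable_invp : measurable_fun setT invp.
Proof.
by apply: measurable_funM; [exact: measurable_pos_ind|exact: measurable_powR].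
Qed.

(** The function 1 - exp(-u) cut to 0 for u <= 0. It is positive exactly where u is, so it can serve
    as a weight although coordinates are nonnegative only almost everywhere. *)
Definition posexp (u : R) : R := (0 < u)%R%:R * (1 - expR (- u)).

Lemma posexpE u : 0 <= u -> posexp u = 1 - expR (- u).
Proof.
rewrite le_eqVlt => /predU1P[<-|u0]; last by rewrite /posexp u0 mul1r.
by rewrite /posexp ltxx mul0r oppr0 expR0 subrr.
Qed.

Lemma posexp_le0 u : u <= 0 -> posexp u = 0.
Proof. by rewrite /posexp leNgt => /negbTE ->; rewrite mul0r. Qed.

Lemma posexp_gt0 u : 0 < u -> 0 < posexp u.
Proof.
by move=> u0; rewrite posexpE ?ltW// subr_gt0 -expR0 ltr_expR oppr_lt0.
Qed.

Lemma posexp_ge0 u : 0 <= posexp u.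
Proof.
by have [/posexp_le0 ->//|/posexp_gt0/ltW] := leP u 0.
Qed.

Lemma measurable_posexp : measurable_fun setT posexp.
Proof.
apply: measurable_funM; first exact: measurable_pos_ind.
by apply: measurable_funB => //; do 2 apply: measurableT_comp => //.
Qed.

End inverse_part.

Lemma wpush_null d d' (T : measurableType d) (U : measurableType d') (R : realType)
    (mu : {measure set T -> \bar R}) (f : T -> R) (phi : T -> U)
    (f0 : forall x, 0 <= f x) (mf : measurable_fun setT f)
    (mphi : measurable_fun setT phi) N :
  measurable N -> mu (phi @^-1` N) = 0%E -> wpush mu f0 mf mphi N = 0%E.
Proof.
move=> mN N0.
have mpN : measurable (phi @^-1` N) by rewrite -[X in measurable X]setTI; exact: mphi.
rewrite wpushE (_ : (\int[mu]_x _)%E = (\int[mu]_(x in phi @^-1` N) (f x)%:E)%E).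
  apply: null_set_integral => //; apply/measurable_EFinP.
  exact: measurable_funTS.
rewrite [RHS]integral_mkcond; apply: eq_integral => x _.
rewrite patchE indicE; have -> : (x \in phi @^-1` N) = (phi x \in N).
  by apply/idP/idP; rewrite !inE.
by case: ifP; rewrite ?mule1 ?mule0.
Qed.

Lemma lexp_nil (R : realType) (I : Type) y : lexp ([::] : seq (R * I)) y = 1.
Proof. by rewrite /lexp /lsum big_nil oppr0 expR0. Qed.

Lemma lsum_nil (R : realType) (I : Type) y : lsum ([::] : seq (R * I)) y = 0.
Proof. by rewrite /lsum big_nil. Qed.

Lemma lsum_cat (R : realType) (I : Type) (s t : seq (R * I)) y :
  lsum (s ++ t) y = lsum s y + lsum t y.
Proof. by rewrite /lsum big_cat. Qed.

(** Reduction of possibly infinite measures to finite ones: multiply both by W, apply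
    [laplace_unique], and divide by W again on {W > 0}. *)
Lemma laplace_unique_weight d (T : measurableType d) (R : realType) (I : Type)
    (mu nu : {measure set T -> \bar R}) (e : I -> T -> R) (W : T -> R) :
  (@measurable _ T `<=` <<s [set A | exists i B, measurable B /\ A = e i @^-1` B] >>) ->
  (forall i, measurable_fun setT (e i)) ->
  measurable_fun setT W -> (forall t, 0 <= W t) ->
  (forall i, mu ([set t | e i t < 0] `&` [set t | 0 < W t]) = 0%E) ->
  (forall i, nu ([set t | e i t < 0] `&` [set t | 0 < W t]) = 0%E) ->
  (forall s, nngs s ->
    \int[mu]_t (W t * lexp s (e ^~ t))%:E = \int[nu]_t (W t * lexp s (e ^~ t))%:E)%E ->
  (\int[mu]_t (W t)%:E < +oo)%E ->
  forall A, measurable A -> A `<=` [set t | 0 < W t] -> mu A = nu A.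
Proof.
move=> mE me mW W0 mu0 nu0 lE Wfin.
have mid : measurable_fun setT (fun t : T => t) by [].
pose m (r : {measure set T -> \bar R}) := wpush r W0 mW mid.
have mT r : m r setT = (\int[r]_t (W t)%:E)%E.
  by rewrite wpushE; apply: eq_integral => t _; rewrite indicT mule1.
have mneg i : measurable [set t | e i t < 0].
  have := me i measurableT `]-oo, 0[%classic (measurable_itv _); rewrite setTI.
  by congr measurable; apply/seteqP; split => t /=; rewrite in_itv.
have mpos : measurable [set t | 0 < W t].
  have := mW measurableT `]0, +oo[%classic (measurable_itv _); rewrite setTI.
  by congr measurable; apply/seteqP; split => t /=; rewrite in_itv/= andbT.
have m_neg (r : {measure set T -> \bar R}) i :
    r ([set t | e i t < 0] `&` [set t | 0 < W t]) = 0%E ->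
    m r [set t | e i t < 0] = 0%E.
  move=> r0; rewrite wpushE.
  transitivity (\int[r]_(t in [set t | (e i t < 0)%R] `&` [set t | (0 < W t)%R]) (W t)%:E)%E.
    rewrite [RHS]integral_mkcond; apply: eq_integral => t _.
    rewrite patchE -EFinM indicE in_setI; case: (t \in [set t | e i t < 0]) => /=.
      case: ifPn; rewrite ?mulr1// notin_setE/= => /negP; rewrite -leNgt => Wt.
      by congr EFin; apply/eqP; rewrite eq_le Wt W0.
    by rewrite mulr0.
  apply: null_set_integral => //.
  - exact: measurableI.
  - by apply/measurable_EFinP; exact: measurable_funTS.
have m_lexp (r : {measure set T -> \bar R}) s :
    (\int[m r]_t (lexp s (e ^~ t))%:E = \int[r]_t (W t * lexp s (e ^~ t))%:E)%E.
  rewrite integral_wpush//; last by move=> t; rewrite lee_fin lexp_ge0.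
  by apply/measurable_EFinP; exact: measurable_lexp.
have mm A : measurable A -> m mu A = m nu A.
  move=> mA; apply: (@laplace_unique _ _ _ _ (m mu) (m nu) e) => //.
  - by rewrite mT.
  - rewrite mT; have := lE [::] isT; under eq_integral do rewrite lexp_nil mulr1.
    by under [X in _ = X -> _]eq_integral do rewrite lexp_nil mulr1; move=> <-.
  - by move=> i; exact: m_neg.
  - by move=> i; exact: m_neg.
  - by move=> s ns; rewrite !m_lexp lE.
move=> A mA AW.
have rE (r : {measure set T -> \bar R}) :
    r A = (\int[m r]_t ((invp (W t))%:E * (\1_A t)%:E))%E.
  rewrite integral_wpush//; last 2 first.
  - apply: emeasurable_funM; apply/measurable_EFinP => //.
    exact: measurableT_comp measurable_invp mW.
  - by move=> t; rewrite mule_ge0 ?lee_fin// invp_ge0.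
  rewrite -[in LHS](setIT A) -integral_indic//; apply: eq_integral => t _.
  rewrite indicE; have [|_] := boolP (t \in A); last by rewrite !mule0.
  by rewrite inE => /AW /= Wt; rewrite mule1 -EFinM invpE// divff// gt_eqF.
rewrite !rE; apply: eq_measure_integral => B mB _; exact: mm.
Qed.

(** * The product sigma-algebra on paths *)

Section path_space.
Context {R : realType} {E : Type}.

Lemma measurable_coord (a : E) : measurable_fun setT (fun y : paths E R => y a).
Proof.
move=> _ B mB; rewrite setTI; apply: sub_sigma_algebra.
by exists a, B.
Qed.

Lemma measurable_to_paths d (T : measurableType d) (f : T -> paths E R) :
  (forall a, measurable_fun setT (fun t => f t a)) -> measurable_fun setT f.
Proof.
move=> mf; apply: (measurability _ (erefl : @measurable _ (paths E R) = <<s @cylinders E R >>)).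
move=> _ [_ [a [B [mB ->]]] <-]; rewrite setTI.
by have := mf a measurableT B mB; rewrite setTI.
Qed.

Lemma paths_generated : @measurable _ (paths E R) `<=`
  <<s [set A | exists i B, measurable B /\ A = (fun y : paths E R => y i) @^-1` B] >>.
Proof. by apply: sub_sigma_algebra2 => A [x [B [mB ->]]]; exists x, B. Qed.

Lemma measurable_vec n (x : 'I_n -> E) :
  measurable_fun setT (fun y : paths E R => vec (fun i => y (x i)) : n.-tuple R).
Proof.
apply/measurable_fun_tnthP => i.
rewrite (_ : _ \o _ = fun y : paths E R => y (x i)); first exact: measurable_coord.
by apply/funext => y /=; rewrite tnth_mktuple.
Qed.

Lemma measurable_pos_coord (a : E) : measurable [set y : paths E R | 0 < y a].
Proof.
have := @measurable_coord a measurableT `]0, +oo[%classic (measurable_itv _).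
by rewrite setTI; congr measurable; apply/seteqP; split => t /=; rewrite in_itv/= andbT.
Qed.

Lemma measurable_neg_coord (a : E) : measurable [set y : paths E R | y a < 0].
Proof.
have := @measurable_coord a measurableT `]-oo, 0[%classic (measurable_itv _).
by rewrite setTI; congr measurable; apply/seteqP; split => t /=; rewrite in_itv/=.
Qed.

End path_space.

Lemma tuple_generated (R : realType) n : @measurable _ (n.-tuple R) `<=`
  <<s [set A | exists i B, measurable B /\ A = (fun y : n.-tuple R => tnth y i) @^-1` B] >>.
Proof.
apply: sub_sigma_algebra2 => A; rewrite -bigcup_seq => -[i _ [B mB <-]].
by exists i, B; rewrite setTI.
Qed.

(** * Suprema of directed families of measures *)

Section directed_sup.
Context d (T : measurableType d) (R : realType) (I : Type).
Variables (m : I -> {measure set T -> \bar R}) (i0 : I).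
Hypothesis directed : forall i j, exists k, forall A, measurable A ->
  (m i A <= m k A /\ m j A <= m k A)%E.
Local Open Scope ereal_scope.

Definition supm (A : set T) : \bar R := ereal_sup (range (fun i => m i A)).

Lemma le_supm i A : m i A <= supm A.
Proof. by apply: ereal_sup_ubound; exists i. Qed.

Lemma supm_le A S : (forall i, m i A <= S) -> supm A <= S.
Proof. by move=> h; apply: ge_ereal_sup => _ [i _ <-]. Qed.

Let supm0 : supm set0 = 0.
Proof.
apply/eqP; rewrite eq_le; apply/andP; split.
  by apply: supm_le => i; rewrite measure0.
by rewrite (le_trans _ (le_supm i0 _))// measure0.
Qed.

Let supm_ge0 A : 0 <= supm A.
Proof. by rewrite (le_trans _ (le_supm i0 _)). Qed.

Let supm_mono A B : measurable A -> measurable B -> A `<=` B -> supm A <= supm B.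
Proof.
move=> mA mB AB; apply: supm_le => i; apply: le_trans (le_supm i B).
by apply: le_measure; rewrite ?inE.
Qed.

(** Directedness puts one measure above both m i on A and m j on B; a general supremum of measures
    is only subadditive. The value +oo is set apart so that terms can be subtracted. *)
Let supmU A B : measurable A -> measurable B -> A `&` B = set0 ->
  supm A + supm B <= supm (A `|` B).
Proof.
move=> mA mB AB.
have mAB := measurableU _ _ mA mB.
have [->|Sfin] := eqVneq (supm (A `|` B)) +oo; first exact: leey.
have fin C : measurable C -> C `<=` A `|` B -> supm C \is a fin_num.
  move=> mC CAB; rewrite ge0_fin_numE//.
  by apply: le_lt_trans (supm_mono mC mAB CAB) _; rewrite ltey.
have finA := fin _ mA (@subsetUl _ A B); have finB := fin _ mB (@subsetUr _ A B).
have fini i C : measurable C -> C `<=` A `|` B -> m i C \is a fin_num.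
  move=> mC /(fin _ mC) fC; rewrite ge0_fin_numE//.
  by apply: le_lt_trans (le_supm i C) _; rewrite ltey_eq fC.
rewrite -leeBrDr//; apply: supm_le => i; rewrite leeBrDr// addeC.
have fiA := fini i _ mA (@subsetUl _ A B).
rewrite -leeBrDr//; apply: supm_le => j; rewrite leeBrDr// addeC.
have [k mk] := directed i j.
apply: le_trans (le_supm k _); rewrite measureU//.
by apply: leeD; [have [] := mk _ mA|have [] := mk _ mB].
Qed.

Let supm_sigma_additive : semi_sigma_additive supm.
Proof.
move=> F mF tF mUF.
have cv : (fun n => \sum_(0 <= i < n) supm (F i)) @ \oo -->
    \sum_(0 <= i <oo) supm (F i) by apply: is_cvg_nneseries.
rewrite (_ : supm _ = \sum_(0 <= i <oo) supm (F i))//.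
apply/eqP; rewrite eq_le; apply/andP; split.
  apply: supm_le => i.
  have /cvg_lim <- // := @measure_semi_sigma_additive _ _ _ (m i) F mF tF mUF.
  by apply: lee_nneseries => n *; [exact: measure_ge0|exact: le_supm].
apply: lime_le; first exact: is_cvg_nneseries.
apply: nearW => n.
suff h : \sum_(0 <= i < n) supm (F i) <= supm (\big[setU/set0]_(i < n) F i).
  apply: (le_trans h); apply: supm_mono => //.
    exact: bigsetU_measurable.
  exact: bigsetU_bigcup.
elim: n => [|n IH]; first by rewrite big_nil big_ord0 supm0.
rewrite big_nat_recr//= big_ord_recr/=.
apply: le_trans (leeD2r _ IH) _; apply: supmU => //.
  exact: bigsetU_measurable.
by rewrite (@trivIset_bigsetUI _ predT F)//; exact: sub_trivIset tF.
Qed.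

Definition sup_measure : {measure set T -> \bar R} :=
  HB.pack supm (isMeasure.Build _ _ _ supm supm0 supm_ge0 supm_sigma_additive).

End directed_sup.

Lemma measurable_itv_ind (R : realType) (t : R) :
  measurable_fun setT (fun r : R => (0 < r <= t)%R%:R : R).
Proof.
apply: (measurableT_comp (f := fun b : bool => b%:R : R)) => //.
by apply: measurable_and; [apply: measurable_fun_ltr|apply: measurable_fun_ler];
  do 1?exact: measurable_cst.
Qed.

Lemma integral_log_derivative (R : realType) (t h : R) : 0 <= t -> 0 <= h ->
  (\int[@lebR R]_u ((0 < u <= t)%R%:R * (h / (1 + u * h)))%:E =
   (ln (1 + t * h))%:E)%E.
Proof.
(* The positive part of u keeps the denominator positive on the whole line, so f is continuous
   everywhere and agrees with the intended integrand on [0, t]. *)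
move=> t0 h0; pose f u : R := h / (1 + Num.max 0 u * h).
have cmax : continuous (fun u : R => Num.max 0 u).
  by move=> u; apply: continuous_max; [exact: cvg_cst|exact: cvg_id].
have fpos u : 0 < 1 + Num.max 0 u * h.
  by rewrite ltr_pwDl// mulr_ge0// le_max lexx.
have cf : continuous f.
  move=> u; apply: cvgM; first exact: cvg_cst.
  apply: cvgV; first by rewrite gt_eqF.
  by apply: cvgD; [exact: cvg_cst|apply: cvgM; [exact: cmax|exact: cvg_cst]].
have fE u : 0 <= u -> f u = h / (1 + u * h).
  by move=> u0; rewrite /f (max_r u0).
have mf : measurable_fun setT (fun u => (f u)%:E).
  by apply/measurable_EFinP; exact: continuous_measurable_fun.
transitivity (\int[@lebR R]_(u in `]0%R, t]) (f u)%:E)%E.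
  rewrite [RHS]integral_mkcond; apply: eq_integral => u _.
  rewrite patchE; have [|] := boolP (u \in _).
    by rewrite inE/= in_itv/= => ut; rewrite ut mul1r fE//; case/andP: ut => /ltW.
  by rewrite notin_setE/= in_itv/= => /negP/negbTE ->; rewrite mul0r.
rewrite integral_lebR//; last 2 first.
- exact: measurable_funTS.
- by move=> u _; rewrite lee_fin divr_ge0// ltW.
rewrite integral_itv_obnd_cbnd; last exact: measurable_funTS.
move: t0; rewrite le_eqVlt => /predU1P[<-|t0].
  by rewrite set_itv1 integral_set1 mul0r addr0 ln1.
have dF x : 0 < 1 + x * h -> is_derive x (1:R) (fun u : R => ln (1 + u * h)) (h / (1 + x * h)).
  move=> x0; rewrite (_ : (fun u : R => _) = @ln R \o (fun u => 1 + u * h))//.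
  have := is_derive1_ln x0 => ?.
  have ? : is_derive x (1:R) (fun u : R => 1 + u * h) h.
    rewrite (_ : (fun u : R => _) = (cst 1 \+ (h \*: (@id R)))); last first.
      by apply/funext => u /=; rewrite /GRing.scale/= mulrC.
    by apply: is_derive_eq; rewrite add0r /GRing.scale/= mulr1.
  by apply: is_derive_eq; rewrite /GRing.scale/= mulrC.
have pos x : 0 <= x -> 0 < 1 + x * h by move=> x0; rewrite ltr_pwDl// mulr_ge0.
have cF x : 0 <= x -> {for x, continuous (fun u : R => ln (1 + u * h))}.
  move=> x0; apply/differentiable_continuous/derivable1_diffP.
  by have := dF x (pos _ x0) => ?; apply: ex_derive.
rewrite (@continuous_FTC2 _ f (fun u => ln (1 + u * h)) 0 t)//.
- by rewrite mul0r addr0 ln1 sube0.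
- exact: continuous_subspaceT.
- split.
  + move=> x; rewrite in_itv/= => /andP[/ltW x0 _].
    by have := dF x (pos _ x0) => ?; apply: ex_derive.
  + by apply/cvg_at_right_filter/cF.
  + by apply/cvg_at_left_filter/cF; exact: ltW.
- move=> x; rewrite in_itv/= => /andP[/ltW x0 _].
  by have := dF x (pos _ x0) => ?; rewrite derive1E fE//; apply: derive_val.
Qed.

(** * Levy measure of a family given by resolvents *)

Section permanental_law.
Context {R : realType} {E : Type} {d' : measure_display}.
Context {Omega' : measurableType d'}.
Variables (Q : probability Omega' R) (Y : E -> Omega' -> R).
Variable mu : E -> {finite_measure set (paths E R) -> \bar R}.

(* [resm s a] stands for the diagonal entry at [a] of G (I + alpha G)^-1 and
   [detm s] for det(I + alpha G), alpha being the diagonal matrix encoded by [s]. *)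
Definition resm (s : seq (R * E)) (a : E) : R := fine (\int[mu a]_y (lexp s y)%:E)%E.

Fixpoint detm (s : seq (R * E)) : R :=
  if s is c :: s' then detm s' * (1 + c.1 * resm s' c.2) else 1.

Hypothesis resm_lty : forall s a, nngs s -> (\int[mu a]_y (lexp s y)%:E < +oo)%E.
Hypothesis mu_neg : forall a x, mu a [set y : paths E R | y x < 0] = 0%E.
Hypothesis mu_pos : forall a, mu a (~` [set y : paths E R | 0 < y a]) = 0%E.
(** The rank-one resolvent identity with all three states equal to a. With K = [resm s a], tilting
    by exp(-t y_a) gives K / (1 + t K). *)
Hypothesis resm_cons : forall s a t, nngs s -> 0 <= t ->
  resm s a = resm ((t, a) :: s) a * (1 + t * resm s a).
Hypothesis laplace_Y : forall s, nngs s ->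
  (\int[Q]_w (lexp s (Y ^~ w))%:E = (detm s `^ (- 2^-1))%:E)%E.

Local Notation leb := (@lebR R).

Let mlexp s : measurable_fun setT (fun y : paths E R => lexp s y).
Proof. exact: (measurable_lexp _ measurable_coord). Qed.

Let mlexpE s : measurable_fun setT (fun y : paths E R => (lexp s y)%:E).
Proof. by apply/measurable_EFinP. Qed.

Let resmE s a : nngs s -> (resm s a)%:E = (\int[mu a]_y (lexp s y)%:E)%E.
Proof.
move=> ns; rewrite /resm fineK// ge0_fin_numE ?resm_lty//.
by apply: integral_ge0 => y _; rewrite lee_fin lexp_ge0.
Qed.

Let resm_ge0 s a : 0 <= resm s a.
Proof. by apply: fine_ge0; apply: integral_ge0 => y _; rewrite lee_fin lexp_ge0. Qed.

Let nngs_cons t b (s : seq (R * E)) : 0 <= t -> nngs s -> nngs ((t, b) :: s).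
Proof. by move=> t0 ns; rewrite /nngs/= t0. Qed.

Let detm_gt0 s : nngs s -> 0 < detm s.
Proof.
elim: s => [//|c s IH] /= /andP[c0 /IH s0].
by rewrite mulr_gt0// ltr_pwDl// mulr_ge0.
Qed.

Let ae_mu_pos a (f g : paths E R -> \bar R) : measurable_fun setT f ->
  measurable_fun setT g -> (forall y, 0 <= f y)%E -> (forall y, 0 <= g y)%E ->
  (forall y, 0 < y a -> f y = g y) -> (\int[mu a]_y f y = \int[mu a]_y g y)%E.
Proof.
move=> mf mg f0 g0 fg; apply: ge0_ae_eq_integral => //.
exists (~` [set y : paths E R | 0 < y a]); split.
- by apply: measurableC; exact: measurable_pos_coord.
- exact: mu_pos.
- by move=> y /= /not_implyP[_ fgy] ya; apply: fgy; exact: fg.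
Qed.

Let lnd (s : seq (R * E)) : R := ln (detm s).

(** The quotient (1 - exp(-t y)) / y is the integral of exp(-r y) over 0 < r <= t. After Tonelli the
    inner integral is [resm ((r, a) :: s) a] = K / (1 + r K) with K = [resm s a], and integrating in
    r gives the logarithm of the factor that the cons adds to [detm]. *)
Lemma frullani s a t : nngs s -> 0 <= t ->
  (\int[mu a]_y (invp (y a) * (lexp s y * posexp (t * y a)))%:E =
   (lnd ((t, a) :: s) - lnd s)%:E)%E.
Proof.
move=> ns t0.
pose F (p : paths E R * R) : \bar R :=
  (((0 < p.2 <= t)%R%:R : R) * (((0 < p.1 a)%R%:R : R) * lexp ((p.2, a) :: s) p.1))%:E.
have mcoord (x : E) : measurable_fun setT (fun p : paths E R * R => p.1 x).
  exact: (measurableT_comp (measurable_coord x) measurable_fst).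
have F0 p : (0 <= F p)%E by rewrite lee_fin mulr_ge0// mulr_ge0// lexp_ge0.
have mF : measurable_fun setT F.
  apply/measurable_EFinP; apply: measurable_funM.
    exact: (measurableT_comp (measurable_itv_ind t) measurable_snd).
  apply: measurable_funM.
    by apply: measurableT_comp (measurable_pos_ind) (mcoord a).
  rewrite (_ : (fun p : paths E R * R => lexp _ _) = fun p : paths E R * R =>
     expR (- (p.2 * p.1 a)) * lexp s p.1); last by apply/funext => p; rewrite lexp_cons.
  apply: measurable_funM.
    do 2 apply: measurableT_comp => //.
    by apply: measurable_funM => //; exact: measurable_snd.
  exact: (measurable_lexp _ mcoord).
transitivity (\int[mu a]_y \int[leb]_r F (y, r))%E.
  apply: eq_integral => y _; have [ya|ya] := ltP 0 (y a); last first.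
    rewrite invp_le0// mul0r integral0_eq// => r _.
    by move: ya; rewrite /F/= leNgt => /negbTE ->; rewrite mul0r mulr0.
  rewrite invpE// posexpE ?mulr_ge0 ?(ltW ya)//.
  have c0 : (0 <= ((y a)^-1 * lexp s y)%:E)%E by rewrite lee_fin mulr_ge0 ?lexp_ge0// invr_ge0 ltW.
  have FE r : F (y, r) = (((y a)^-1 * lexp s y)%:E *
      ((0 < r <= t)%R%:R * (y a * expR (- (y a * r))))%:E)%E.
    rewrite /F /= ya mul1r lexp_cons/= -EFinM [r * _]mulrC; congr EFin.
    by field; rewrite gt_eqF.
  under eq_integral do rewrite FE.
  rewrite ge0_integralZl//.
  - by rewrite integral_exponential// ?(ltW ya)// -EFinM [t * _]mulrC mulrA.
  - apply/measurable_EFinP; apply: measurable_funM; first exact: measurable_itv_ind.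
    by apply: measurable_funM => //; do 2 apply: measurableT_comp => //.
  - by move=> r _; rewrite lee_fin mulr_ge0// mulr_ge0 ?expR_ge0// ltW.
rewrite (@fubini_tonelli _ _ _ _ R (mu a) leb F mF F0).
transitivity (\int[leb]_r ((0 < r <= t)%R%:R * (resm s a / (1 + r * resm s a)))%:E)%E.
  apply: eq_integral => r _.
  case rt : (0 < r <= t); last first.
    by rewrite mul0r integral0_eq// => y _; rewrite /F/= rt mul0r.
  case/andP: (rt) => /ltW r0 _.
  have nr := nngs_cons a r0 ns.
  have -> : true%:R * (resm s a / (1 + r * resm s a)) = resm ((r, a) :: s) a.
    rewrite mul1r {1}(resm_cons a ns r0) mulfK// gt_eqF//.
    by rewrite ltr_pwDl// mulr_ge0.
  rewrite resmE//; apply: ae_mu_pos.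
  - apply: (measurableT_comp mF (measurable_fun_pair _ _)) => //.
  - exact: mlexpE.
  - by move=> y; exact: F0.
  - by move=> y; rewrite lee_fin lexp_ge0.
  - by move=> y ya; rewrite /F/= rt ya !mul1r.
rewrite integral_log_derivative//; congr EFin.
by rewrite /lnd /= lnM ?posrE ?detm_gt0// ?ltr_pwDl// ?mulr_ge0//; ring.
Qed.

Let frul_ge0 (I : Type) (s : seq (R * I)) y u : 0 <= lexp s y * posexp u.
Proof. exact: mulr_ge0 (lexp_ge0 _ _) (posexp_ge0 _). Qed.

Let double_ge0 (I : Type) (s : seq (R * I)) y u v : 0 <= posexp u * posexp v * lexp s y.
Proof. exact: mulr_ge0 (mulr_ge0 (posexp_ge0 _) (posexp_ge0 _)) (lexp_ge0 _ _). Qed.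

Let nu_weight_ge0 a (y : paths E R) : 0 <= invp (y a) / 2.
Proof. by rewrite mulr_ge0// invp_ge0. Qed.

Let measurable_nu_weight a : measurable_fun setT (fun y : paths E R => invp (y a) / 2).
Proof.
apply: measurable_funM => //.
exact: (measurableT_comp measurable_invp (measurable_coord a)).
Qed.

(* the Levy measure on {y_a > 0}: mu_a(dy) / (2 y_a) *)
Definition num (a : E) : {measure set (paths E R) -> \bar R} :=
  wpush (mu a) (nu_weight_ge0 a) (measurable_nu_weight a) (@measurable_id _ _ setT).

Let num_null a N : measurable N -> mu a N = 0%E -> num a N = 0%E.
Proof. by move=> mN N0; exact: wpush_null. Qed.

Let num_neg a x : num a [set y : paths E R | y x < 0] = 0%E.
Proof. by apply: num_null => //; exact: measurable_neg_coord. Qed.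

Let num_pos a : num a (~` [set y : paths E R | 0 < y a]) = 0%E.
Proof. by apply: num_null => //; apply: measurableC; exact: measurable_pos_coord. Qed.

Let mfrul (s : seq (R * E)) (t : R) (a : E) :
  measurable_fun setT (fun y : paths E R => (lexp s y * posexp (t * y a))%:E).
Proof.
apply/measurable_EFinP; apply: measurable_funM => //.
apply: (measurableT_comp measurable_posexp); apply: measurable_funM => //.
exact: measurable_coord.
Qed.

Lemma num_frullani s a t : nngs s -> 0 <= t ->
  (\int[num a]_y (lexp s y * posexp (t * y a))%:E =
   ((lnd ((t, a) :: s) - lnd s) / 2)%:E)%E.
Proof.
move=> ns t0; rewrite integral_wpush//; last first.
  by move=> y; rewrite lee_fin frul_ge0.
have i0 y : (0 <= (invp (y a) * (lexp s y * posexp (t * y a)))%:E)%E.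
  by rewrite lee_fin; apply: mulr_ge0 (invp_ge0 _) (frul_ge0 s _ _).
rewrite [RHS]EFinM -frullani// muleC -ge0_integralZl//.
- by apply: eq_integral => y _; rewrite -!EFinM; congr EFin; ring.
- apply/measurable_EFinP; apply: measurable_funM; last first.
    by apply/measurable_EFinP; exact: mfrul.
  exact: (measurableT_comp measurable_invp (measurable_coord a)).
Qed.

(** Invariance under reordering is not visible on the product formula. It comes from Y: the power
    -1/2 of [detm] is a Laplace transform of Y, which depends on the linear form alone. *)
Lemma detm_lsum s s' : nngs s -> nngs s' -> (forall y, lsum s y = lsum s' y) ->
  detm s = detm s'.
Proof.
move=> ns ns' ss'.
have : (detm s `^ (- 2^-1) = detm s' `^ (- 2^-1)).
  apply: EFin_inj; rewrite -!laplace_Y//.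
  by apply: eq_integral => w _; rewrite /lexp ss'.
have n2 : - 2^-1 != 0 :> R by rewrite oppr_eq0 invr_eq0.
move/(congr1 (@ln R)); rewrite !ln_powR => /(mulfI n2).
by apply: ln_inj; rewrite posrE detm_gt0.
Qed.

(** A second difference of the log-determinant. Up to the order of the two new entries, which
    [detm_lsum] makes irrelevant, it is symmetric in a and b. *)
Lemma num_double s a b : nngs s ->
  (\int[num a]_y (posexp (y a) * posexp (y b) * lexp s y)%:E =
   ((lnd ((1, a) :: s) + lnd ((1, b) :: s) - lnd s - lnd ((1, a) :: (1, b) :: s)) / 2)%:E)%E.
Proof.
move=> ns; have n1 := @nngs_cons 1 b s ler01 ns.
have mW : measurable_fun setT (fun y : paths E R => (posexp (y a) * posexp (y b) * lexp s y)%:E).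
  apply/measurable_EFinP; apply: measurable_funM => //.
  by apply: measurable_funM; apply: (measurableT_comp measurable_posexp);
    exact: measurable_coord.
have H : (\int[num a]_y (posexp (y a) * posexp (y b) * lexp s y)%:E +
    \int[num a]_y (lexp ((1%R, b) :: s) y * posexp (1 * y a))%:E =
    \int[num a]_y (lexp s y * posexp (1 * y a))%:E)%E.
  rewrite -ge0_integralD//.
  - apply: ge0_ae_eq_integral => //.
    + exact: emeasurable_funD.
    + by move=> y _; rewrite -EFinD lee_fin (addr_ge0 (double_ge0 s _ _ _) (frul_ge0 ((1, b) :: s) _ _)).
    + by move=> y _; rewrite lee_fin ?frul_ge0 ?double_ge0.
    exists [set y : paths E R | y b < 0]; split => //.
      exact: measurable_neg_coord.
    move=> y /= /not_implyP[_]; apply: contra_notP => /negP; rewrite -leNgt => yb.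
    rewrite -EFinD (posexpE yb) lexp_cons/= !mul1r; congr EFin; ring.
  - by move=> y _; rewrite lee_fin ?frul_ge0 ?double_ge0.
  - by move=> y _; rewrite lee_fin ?frul_ge0 ?double_ge0.
move: H; rewrite !num_frullani//.
case: (\int[num a]_y _)%E => [r| |]//=; rewrite -EFinD => -[rE].
by congr EFin; rewrite -[r](addrK ((lnd [:: (1, a), (1, b) & s] - lnd ((1, b) :: s)) / 2)) rE; field.
Qed.

(** The weight posexp(y_a) posexp(y_b) is positive exactly where both coordinates are, and by the
    symmetry of [num_double] the two measures have the same weighted transforms. *)
Lemma num_consistent a b (A : set (paths E R)) : measurable A ->
  A `<=` [set y | 0 < y a] -> A `<=` [set y | 0 < y b] -> num a A = num b A.
Proof.
move=> mA Aa Ab.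
have prodgt0 (u v : R) : (0 < posexp u * posexp v) = (0 < u) && (0 < v).
  have [/posexp_le0 ->|u0] := leP u 0; first by rewrite mul0r ltxx.
  have [/posexp_le0 ->|v0] := leP v 0; first by rewrite mulr0 ltxx.
  by rewrite mulr_gt0 ?posexp_gt0.
have mW : measurable_fun setT (fun y : paths E R => posexp (y a) * posexp (y b)).
  by apply: measurable_funM; apply: (measurableT_comp measurable_posexp);
    exact: measurable_coord.
have null c i : num c ([set t : paths E R | t i < 0] `&`
    [set t | 0 < posexp (t a) * posexp (t b)]) = 0%E.
  have mpos : measurable [set t : paths E R | 0 < posexp (t a) * posexp (t b)].
    have := mW measurableT `]0, +oo[%classic (measurable_itv _); rewrite setTI.
    by congr measurable; apply/seteqP; split => t /=; rewrite in_itv/= andbT.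
  have mneg := @measurable_neg_coord R E i.
  apply: (subset_measure0 (measurableI _ _ mneg mpos) mneg _ (num_neg c i)).
  by move=> t [].
apply: (@laplace_unique_weight _ _ _ E (num a) (num b) (fun x y => y x)
  (fun y => posexp (y a) * posexp (y b))); [| | |move=> y| | | | |exact: mA|].
- exact: paths_generated.
- exact: measurable_coord.
- exact: mW.
- exact: mulr_ge0 (posexp_ge0 _) (posexp_ge0 _).
- exact: null.
- exact: null.
- move=> s ns; rewrite num_double//.
  under eq_integral do rewrite [posexp (_ a) * _]mulrC.
  rewrite num_double//; congr EFin.
  have -> : lnd [:: (1, a), (1, b) & s] = lnd [:: (1, b), (1, a) & s].
    congr ln; apply: detm_lsum; [exact/nngs_cons/nngs_cons|exact/nngs_cons/nngs_cons|].
    by move=> y; rewrite !lsum_cons addrCA.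
  by congr (_ / 2); ring.
- rewrite (_ : (\int[num a]_t _)%E =
      (\int[num a]_y (posexp (y a) * posexp (y b) * lexp [::] y)%:E)%E).
    by rewrite num_double// ltry.
  by apply: eq_integral => y _; rewrite lexp_nil mulr1.
- by move=> y Ay; rewrite /= prodgt0 Aa ?Ab.
Qed.

Let ge0_integral_agree d1 (T : measurableType d1) (m1 m2 : {measure set T -> \bar R})
    (D : set T) (f : T -> \bar R) : measurable D -> measurable_fun setT f ->
  (forall t, 0 <= f t)%E -> (forall t, ~ D t -> f t = 0%E) ->
  (forall A, measurable A -> A `<=` D -> m1 A = m2 A) ->
  (\int[m1]_t f t = \int[m2]_t f t)%E.
Proof.
move=> mD mf f0 fD m12.
have cut (m : {measure set T -> \bar R}) : (\int[m]_t f t = \int[m]_(t in D) f t)%E.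
  rewrite [RHS]integral_mkcond; apply: eq_integral => t _.
  by rewrite patchE; case: ifPn => //; rewrite notin_setE => /fD.
by rewrite !cut; exact: eq_measure_integral.
Qed.

Let measurable_orthant n : measurable (@orthant R n).
Proof.
rewrite (_ : @orthant R n = \bigcap_i (fun y => tnth y i) @^-1` `[0, +oo[%classic).
  apply: fin_bigcap_measurable => // i _; rewrite -[X in measurable X]setTI.
  exact: measurable_tnth.
apply/seteqP; split => y /= h i; first by move=> _ /=; rewrite in_itv/= andbT.
by have := h i I; rewrite /= in_itv/= andbT.
Qed.

Let measurable_pos_tnth n (i : 'I_n) : measurable [set y : n.-tuple R | 0 < tnth y i].
Proof.
have := @measurable_tnth _ R n i measurableT `]0, +oo[%classic (measurable_itv _).
by rewrite setTI; congr measurable; apply/seteqP; split => t /=; rewrite in_itv/= andbT.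
Qed.

Let mfrul_tuple n (s : seq (R * 'I_n)) (t : R) (i : 'I_n) :
  measurable_fun setT (fun y : n.-tuple R => (lexp s (tnth y) * posexp (t * tnth y i))%:E).
Proof.
apply/measurable_EFinP; apply: measurable_funM.
  exact: (measurable_lexp _ (@measurable_tnth _ R n)).
apply: (measurableT_comp measurable_posexp); apply: measurable_funM => //.
exact: measurable_tnth.
Qed.

Let relabel n (x : 'I_n -> E) (s : seq (R * 'I_n)) := [seq (c.1, x c.2) | c <- s].

Let nngs_relabel n (x : 'I_n -> E) s : nngs s -> nngs (relabel x s).
Proof. by rewrite /nngs /relabel all_map; apply: sub_all. Qed.

Let lexp_relabel n (x : 'I_n -> E) s (y : E -> R) :
  lexp (relabel x s) y = lexp s (tnth (vec (fun i => y (x i)))).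
Proof.
rewrite /lexp /lsum big_map; congr (expR (- _)).
by apply: eq_bigr => c _; rewrite tnth_mktuple.
Qed.

Let image_vec n (x : 'I_n -> E) (m : {measure set (paths E R) -> \bar R}) :
  {measure set (n.-tuple R) -> \bar R} := image_measure m (measurable_vec x).

Let integral_image_vec n (x : 'I_n -> E) (m : {measure set (paths E R) -> \bar R})
    (f : n.-tuple R -> \bar R) : measurable_fun setT f -> (forall y, 0 <= f y)%E ->
  (\int[image_vec x m]_y f y = \int[m]_y f (vec (fun i => y (x i))))%E.
Proof.
move=> mf f0.
exact: (@ge0_integral_pushforward _ _ _ _ R _ (measurable_vec x) m setT f).
Qed.

Let num_frullani_tuple n (x : 'I_n -> E) s (t : R) i : nngs s -> 0 <= t ->
  (\int[image_vec x (num (x i))]_y (lexp s (tnth y) * posexp (t * tnth y i))%:E =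
   ((lnd (relabel x ((t, i) :: s)) - lnd (relabel x s)) / 2)%:E)%E.
Proof.
move=> ns t0; rewrite integral_image_vec//; last first.
  by move=> y; rewrite lee_fin frul_ge0.
rewrite -[RHS](@num_frullani (relabel x s) (x i) t)//; last exact: nngs_relabel.
by apply: eq_integral => y _; rewrite lexp_relabel tnth_mktuple.
Qed.

Let collect n (s : seq (R * 'I_n)) (i : 'I_n) : R := \sum_(c <- s | c.2 == i) c.1.

Let lsum_collect n (s : seq (R * 'I_n)) y :
  lsum s y = \sum_(i < n) collect s i * y i.
Proof.
rewrite /lsum /collect; under [RHS]eq_bigr do rewrite mulr_suml big_mkcond.
rewrite exchange_big/=; apply: eq_bigr => c _.
by rewrite -big_mkcond/= (big_pred1 c.2)// => i; exact: eq_sym.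
Qed.

Let spread n (al : 'I_n -> R) : seq (R * 'I_n) := [seq (al i, i) | i <- enum 'I_n].

Let lsum_spread n (al : 'I_n -> R) y : lsum (spread al) y = \sum_(i < n) al i * y i.
Proof. by rewrite /lsum /spread big_map/= big_enum. Qed.

(* 1 - exp(-(u + v)) = (1 - exp(-u)) + exp(-u) (1 - exp(-v)) *)
Let levy_split n (nux : {measure set (n.-tuple R) -> \bar R}) (s : seq (R * 'I_n))
    (t : R) (i : 'I_n) : nux (~` orthant n) = 0%E -> nngs s -> 0 <= t ->
  (\int[nux]_(y in orthant n) (1 - lexp ((t, i) :: s) (tnth y))%:E =
   \int[nux]_(y in orthant n) (1 - lexp s (tnth y))%:E +
   \int[nux]_y (lexp s (tnth y) * posexp (t * tnth y i))%:E)%E.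
Proof.
move=> nuxo ns t0; have [mo mf] := (@measurable_orthant n, @mfrul_tuple n s t i).
transitivity (\int[nux]_(y in orthant n) ((1 - lexp s (tnth y))%:E +
    (lexp s (tnth y) * posexp (t * tnth y i))%:E))%E.
  apply: eq_integral => y; rewrite inE => oy.
  rewrite posexpE; last by rewrite mulr_ge0//; exact: oy.
  by rewrite lexp_cons/= -EFinD; congr EFin; ring.
rewrite ge0_integralD; [|exact: mo| | | |]; last 4 first.
- by move=> y oy; rewrite lee_fin subr_ge0; exact: lexp_le1.
- apply: measurable_funTS; apply/measurable_EFinP; apply: measurable_funB => //.
  exact: (measurable_lexp _ (@measurable_tnth _ R n)).
- by move=> y _; rewrite lee_fin frul_ge0.
- exact: measurable_funTS mf.
congr (_ + _)%E; rewrite integral_mkcond; apply: ge0_ae_eq_integral => //.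
- by apply/measurable_restrict => //; rewrite setTI; exact: measurable_funTS.
- by move=> y _; rewrite patchE; case: ifP => // _; rewrite lee_fin frul_ge0.
- by move=> y _; rewrite lee_fin frul_ge0.
exists (~` orthant n); split => //; first exact: measurableC.
by move=> y /= /not_implyP[_ h] oy; apply: h; rewrite patchE mem_set.
Qed.

(** Telescoping along the list: by [levy_split] a new entry (t, i) adds an integral carried by {y_i
    > 0}, where nux is known, and [num_frullani_tuple] evaluates it as the increment of half the
    log-determinant. *)
Let levy_exponent n (x : 'I_n -> E) (nux : {measure set (n.-tuple R) -> \bar R})
    (s : seq (R * 'I_n)) : nux (~` orthant n) = 0%E ->
  (forall i (B : set (n.-tuple R)), measurable B -> B `<=` [set y | 0 < tnth y i] ->
    nux B = image_vec x (num (x i)) B) -> nngs s ->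
  (\int[nux]_(y in orthant n) (1 - lexp s (tnth y))%:E = (lnd (relabel x s) / 2)%:E)%E.
Proof.
move=> nuxo nuxE; elim: s => [_|[t i] s IH /= /andP[t0 ns]].
  rewrite /lnd /= ln1 mul0r; apply: integral0_eq => y _.
  by rewrite lexp_nil subrr.
rewrite levy_split// IH// (@ge0_integral_agree _ _ nux (image_vec x (num (x i))) _ _
  (@measurable_pos_tnth n i) (mfrul_tuple s t i)).
- by rewrite num_frullani_tuple// -EFinD; congr EFin; ring.
- by move=> y; rewrite lee_fin frul_ge0.
- move=> y /= /negP; rewrite -leNgt => yi.
  by rewrite posexp_le0 ?mulr0// mulr_ge0_le0.
- exact: nuxE.
Qed.

Lemma levy_vector_of_marginals n (x : 'I_n -> E)
    (nux : {measure set (n.-tuple R) -> \bar R}) :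
  nux (~` orthant n) = 0%E -> nux [set vec (fun=> 0)] = 0%E ->
  (forall i (B : set (n.-tuple R)), measurable B -> B `<=` [set y | 0 < tnth y i] ->
    nux B = num (x i) [set y | B (vec (fun j => y (x j)))]) ->
  levy_measure_vector Q (fun i => Y (x i)) nux.
Proof.
move=> nuxo nux0 nuxE; split => // al al0.
have nsp : nngs (spread al) by rewrite /nngs all_map; apply/allP => i _ /=.
have := levy_exponent nuxo nuxE nsp.
rewrite (_ : (\int[nux]_(y in _) _)%E = (\int[nux]_(y in orthant n)
   (1 - expR (- \sum_(i < n) al i * tnth y i))%:E)%E); last first.
  by apply: eq_integral => y _; rewrite /lexp lsum_spread.
move=> ->; rewrite unlock.
transitivity (\int[Q]_w (lexp (relabel x (spread al)) (Y ^~ w))%:E)%E.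
  by apply: eq_integral => w _; rewrite lexp_relabel /lexp lsum_spread; congr (expR (- _))%:E; apply: eq_bigr => i _; rewrite tnth_mktuple.
rewrite laplace_Y ?nngs_relabel//= /lnd; congr EFin.
rewrite -[LHS]lnK ?posrE ?powR_gt0 ?detm_gt0 ?nngs_relabel// ln_powR.
by congr expR; rewrite mulNr mulrC.
Qed.

(** Logarithms in the Laplace formula give the exponent for every list. The difference of the
    exponents at (1, i) :: s and at s is the transform of nux weighted by posexp(y_i), which is
    finite, so weighted uniqueness applies. *)
Lemma marginals_of_levy_vector n (x : 'I_n -> E)
    (nux : {measure set (n.-tuple R) -> \bar R}) :
  levy_measure_vector Q (fun i => Y (x i)) nux ->
  forall i (B : set (n.-tuple R)), measurable B -> B `<=` [set y | 0 < tnth y i] ->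
    nux B = num (x i) [set y | B (vec (fun j => y (x j)))].
Proof.
move=> [nuxo nux0 nuxL] i B mB Bi.
have mo := @measurable_orthant n.
pose I (s : seq (R * 'I_n)) := (\int[nux]_(y in orthant n) (1 - lexp s (tnth y))%:E)%E.
have IE s : nngs s -> I s = (lnd (relabel x s) / 2)%:E.
  move=> ns; have al0 j : 0 <= collect s j.
    rewrite /collect; elim: (s) ns => [|c s' IH] /=; first by rewrite big_nil.
    by case/andP => c0 /IH h; rewrite big_cons; case: ifP => // _; rewrite addr_ge0.
  have := nuxL _ al0; rewrite unlock.
  rewrite (_ : (\int[nux]_(y in _) _)%E = I s); last first.
    by apply: eq_integral => y _; rewrite /lexp lsum_collect.
  rewrite (_ : (\int[Q]_w _)%E = (\int[Q]_w (lexp (relabel x s) (Y ^~ w))%:E)%E); last first.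
    apply: eq_integral => w _; rewrite lexp_relabel /lexp lsum_collect; congr (expR (- _))%:E.
    by apply: eq_bigr => j _; rewrite tnth_mktuple.
  rewrite laplace_Y ?nngs_relabel//.
  have D0 := powR_gt0 (- 2^-1) (detm_gt0 (nngs_relabel x ns)).
  (* An infinite exponent is excluded because the Laplace transform of Y is positive and finite. *)
  case: (I s) => [r| |] //= [].
    by move/(congr1 (@ln R)); rewrite ln_powR expRK => h; congr EFin;
      rewrite -[r]opprK -h /lnd; ring.
  by move=> D0'; move: D0; rewrite D0' ltxx.
have mW : measurable_fun setT (fun y : n.-tuple R => posexp (tnth y i)).
  exact: (measurableT_comp measurable_posexp (@measurable_tnth _ R n i)).
have mneg j : measurable [set y : n.-tuple R | tnth y j < 0].
  have := @measurable_tnth _ R n j measurableT `]-oo, 0[%classic (measurable_itv _).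
  by rewrite setTI; congr measurable; apply/seteqP; split => t /=; rewrite in_itv.
have mpos : measurable [set y : n.-tuple R | 0 < posexp (tnth y i)].
  have := mW measurableT `]0, +oo[%classic (measurable_itv _); rewrite setTI.
  by congr measurable; apply/seteqP; split => t /=; rewrite in_itv/= andbT.
have negW (m : {measure set (n.-tuple R) -> \bar R}) j :
    m [set y : n.-tuple R | tnth y j < 0] = 0%E ->
    m ([set y | tnth y j < 0] `&` [set y | 0 < posexp (tnth y i)]) = 0%E.
  move=> m0; apply: (subset_measure0 (measurableI _ _ (mneg j) mpos) (mneg j) _ m0).
  by move=> t [].
have WE s : nngs s -> (\int[nux]_y (posexp (tnth y i) * lexp s (tnth y))%:E =
    ((lnd (relabel x ((1, i) :: s)) - lnd (relabel x s)) / 2)%:E)%E.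
  move=> ns; have n1 : nngs ((1, i) :: s) by rewrite /nngs/= ler01.
  have := levy_split i nuxo ns ler01; rewrite -!/(I _) !IE//.
  under eq_integral do rewrite mul1r mulrC.
  case: (\int[nux]_y _)%E => [r| |]//=; rewrite -EFinD => -[rE].
  by congr EFin; rewrite mulrBl rE addrC addKr.
apply: (@laplace_unique_weight _ _ _ 'I_n nux (image_vec x (num (x i)))
  (fun j y => tnth y j) (fun y => posexp (tnth y i))).
- exact: tuple_generated.
- exact: measurable_tnth.
- exact: mW.
- by move=> y; exact: posexp_ge0.
- move=> j; apply: negW; apply: (subset_measure0 (mneg j) (measurableC mo) _ nuxo).
  by move=> y /= yj oy; have := oy j; rewrite leNgt yj.
- move=> j; apply: negW; rewrite -[RHS](num_neg (x i) (x j)).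
  by congr (num _ _); apply/seteqP; split => y /=; rewrite tnth_mktuple.
- move=> s ns; rewrite WE// -num_frullani_tuple//.
  by apply: eq_integral => y _; rewrite mul1r mulrC.
- rewrite (_ : (\int[nux]_y _)%E = (\int[nux]_y (posexp (tnth y i) * lexp [::] (tnth y))%:E)%E).
    by rewrite WE// ltry.
  by apply: eq_integral => y _; rewrite lexp_nil mulr1.
- exact: mB.
- by move=> y /Bi /= yi; exact: posexp_gt0.
Qed.

(* The mass is split according to the first state of [F] where the path is positive. *)
Fixpoint numF (F : seq E) : {measure set (paths E R) -> \bar R} :=
  if F is a :: F' then
    measure_add (mrestr (num a) (@measurable_pos_coord R E a))
      (mrestr (numF F') (measurableC (@measurable_pos_coord R E a)))
  else mzero.

Let numF_cons a F A : numF (a :: F) A =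
  (num a (A `&` [set y | (0 < y a)%R]) + numF F (A `&` ~` [set y | (0 < y a)%R]))%E.
Proof. exact: measure_addE. Qed.

Fixpoint carr (F : seq E) : set (paths E R) :=
  if F is a :: F' then [set y | 0 < y a] `|` carr F' else set0.

Let measurable_carr F : measurable (carr F).
Proof.
elim: F => [|a F IH]; first exact: measurable0.
exact: measurableU (measurable_pos_coord a) IH.
Qed.

Let numF_null F N : measurable N -> (forall a, num a N = 0%E) -> numF F N = 0%E.
Proof.
move=> mN N0; have mp := @measurable_pos_coord R E.
elim: F N mN N0 => [//|a F IH] N mN N0.
have sub0 D : measurable D -> forall b, num b (N `&` D) = 0%E.
  move=> mD b; apply: (subset_measure0 (measurableI _ _ mN mD) mN _ (N0 b)).
  exact: subIsetl.
rewrite numF_cons sub0// IH ?adde0//.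
- by apply: measurableI => //; exact: measurableC.
- exact: (sub0 _ (measurableC (mp a))).
Qed.

Let numF_agree F a (A : set (paths E R)) : List.In a F -> measurable A -> A `<=` [set y | 0 < y a] ->
  numF F A = num a A.
Proof.
have mp := @measurable_pos_coord R E.
elim: F A => [//|b F IH] A [<-|aF] mA Aa; rewrite numF_cons.
  rewrite (_ : A `&` ~` _ = set0) ?measure0 ?adde0; last first.
    by apply/seteqP; split => // y [/Aa].
  by congr (num b _); apply/seteqP; split => y; [case|move=> Ay; split => //; exact: Aa].
have mAb : measurable (A `&` [set y | 0 < y b]) by exact: measurableI.
have mAc : measurable (A `&` ~` [set y | 0 < y b]).
  by apply: measurableI => //; exact: measurableC.
rewrite IH//; last by move=> y [/Aa].
rewrite (@num_consistent b a)//; last by move=> y [/Aa].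
rewrite -measureU//; last by rewrite setIACA setICr setI0.
by rewrite -setIUr setUv setIT.
Qed.

Let numF_off F (A : set (paths E R)) : A `&` carr F = set0 -> numF F A = 0%E.
Proof.
elim: F A => [//|a F IH] A /= Aoff; rewrite numF_cons.
have h y : A y -> ~ (0 < y a \/ carr F y) by move=> Ay ay; rewrite -[False]/(set0 y) -Aoff.
rewrite (_ : A `&` _ = set0) ?measure0 ?add0e; last first.
  by apply/seteqP; split => // y [/h hy ya]; apply: hy; left.
by apply: IH; apply/seteqP; split => // y [[/h hy _] yc]; apply: hy; right.
Qed.

Let agree_on_carr (m1 m2 : {measure set (paths E R) -> \bar R}) F :
  (forall a (A : set (paths E R)), List.In a F -> measurable A -> A `<=` [set y | 0 < y a] -> m1 A = m2 A) ->
  forall A, measurable A -> A `<=` carr F -> m1 A = m2 A.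
Proof.
have mp := @measurable_pos_coord R E.
elim: F => [_ A _|a F IH H A mA AF]; first by rewrite subset0 => ->; rewrite !measure0.
have cut (m : {measure set (paths E R) -> \bar R}) :
    (m A = m (A `&` [set y | 0 < y a]%R) + m (A `&` ~` [set y | 0 < y a]%R))%E.
  rewrite -measureU.
  - by rewrite -setIUr setUv setIT.
  - exact: measurableI.
  - by apply: measurableI => //; exact: measurableC.
  - by rewrite setIACA setICr setI0.
have Ha : m1 (A `&` [set y | 0 < y a]) = m2 (A `&` [set y | 0 < y a]).
  by apply: (H a); [left|exact: measurableI|move=> y []].
rewrite !cut Ha; congr (_ + _)%E; apply: IH => [b B bF|  | ].
- by apply: H; right.
- by apply: measurableI => //; exact: measurableC.
- by move=> y [/AF[]].
Qed.

Let numF_carr F A : measurable A -> numF F A = numF F (A `&` carr F).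
Proof.
move=> mA; have mc := measurable_carr F.
rewrite -[in LHS](setIT A) -(setUv (carr F)) setIUr measureU.
- rewrite [X in (_ + X)%E](_ : _ = 0%E) ?adde0//; apply: numF_off.
  by rewrite -setIA setICl setI0.
- exact: measurableI.
- by apply: measurableI => //; exact: measurableC.
- by rewrite setIACA setICr setI0.
Qed.

(** On [carr F] both measures are given by the same [num a], so enlarging the list only adds mass
    outside [carr F]. *)
Let numF_incl F G A : measurable A -> List.incl F G -> (numF F A <= numF G A)%E.
Proof.
move=> mA FG; have mc := measurable_carr F.
rewrite numF_carr//.
rewrite (@agree_on_carr (numF F) (numF G) F).
- apply: le_measure; [exact/mem_set/measurableI|exact/mem_set|exact: subIsetl].
- by move=> a B aF mB Ba; rewrite (numF_agree aF)// (numF_agree (FG _ aF)).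
- exact: measurableI.
- exact: subIsetr.
Qed.

Let numF_directed F G : exists H, forall A, measurable A ->
  (numF F A <= numF H A /\ numF G A <= numF H A)%E.
Proof.
by exists (F ++ G) => A mA; split; apply: numF_incl => // a aF;
  apply/List.in_or_app; [left|right].
Qed.

Definition path_levy : {measure set (paths E R) -> \bar R} :=
  @sup_measure _ _ R _ numF [::] numF_directed.

Let carrP F y : carr F y <-> exists2 a, List.In a F & 0 < y a.
Proof.
elim: F => [|a F IH] /=; first by split => // -[].
rewrite IH; split => [[ya|[b bF yb]]|[b [<-|bF] yb]].
- by exists a => //; left.
- by exists b => //; right.
- by left.
- by right; exists b.
Qed.

Let numF_orthant n (x : 'I_n -> E) F :
  numF F [set y | ~ orthant n (vec (fun i => y (x i)))] = 0%E.
Proof.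
have mO : measurable [set y : paths E R | ~ orthant n (vec (fun i => y (x i)))].
  have := measurable_vec x measurableT (measurableC (@measurable_orthant n)).
  by rewrite setTI.
apply: numF_null => // b; apply/negligibleP => //.
suff h : (num b).-negligible (\big[setU/set0]_(i < n) [set y : paths E R | y (x i) < 0]).
  apply: negligibleS h => y /existsNP[i]; rewrite tnth_mktuple => /negP.
  by rewrite -ltNge => yi; rewrite -bigcup_seq; exists i => //=; rewrite mem_index_enum.
elim/big_ind : _ => [|A B|i _]; first exact: negligible_set0.
  exact: negligibleU.
by apply/negligibleP; [exact: measurable_neg_coord|exact: num_neg].
Qed.

(** For the marginal at x the list F of values of x suffices: off a null set of paths with a
    negative coordinate, a cylinder over x that avoids the origin lies in [carr F], so larger lists
    add nothing to it. The null path lies in no [carr F], which gives the inner-measure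
    condition. *)
Lemma path_levyP : levy_measure_process Q Y path_levy.
Proof.
split=> [n x|A mA].
  pose F := [seq x i | i <- enum 'I_n].
  have xF i : List.In (x i) F.
    apply: List.in_map; have : i \in enum 'I_n by rewrite mem_enum.
    elim: (enum _) => [//|j l IH]; rewrite inE => /predU1P[->|/IH]; first by left.
    by right.
  have Fx a : List.In a F -> exists i, a = x i.
    by move=> /List.in_map_iff[i [<- _]]; exists i.
  exists (image_vec x (numF F)); split.
    apply: levy_vector_of_marginals => [| |i B mB Bi].
    - exact: numF_orthant.
    - apply: numF_off; apply/seteqP; split => // y [/= y0 /carrP[a /Fx[i ->]]].
      have := congr1 (fun t : n.-tuple R => tnth t i) y0.
      by rewrite !tnth_mktuple => ->; rewrite ltxx.
    - apply: numF_agree => //.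
        by rewrite -[X in measurable X]setTI; exact: measurable_vec.
      by move=> y /Bi /=; rewrite tnth_mktuple.
  move=> B mB B0; apply/eqP; rewrite eq_le; apply/andP; split.
    exact: (le_supm numF F).
  set C := [set y : paths E R | _].
  have mC : measurable C by rewrite -[X in measurable X]setTI; exact: measurable_vec.
  have mc := measurable_carr F.
  apply: supm_le => G; apply: (@le_trans _ _ (numF G (C `&` carr F))).
    rewrite -[in leLHS](setIT C) -(setUv (carr F)) setIUr measureU.
    - rewrite [X in (_ + X)%E](_ : _ = 0%E) ?adde0//.
      apply: (subset_measure0 _ _ _ (numF_orthant x G)).
      + by apply: measurableI => //; exact: measurableC.
      + have := measurable_vec x measurableT (measurableC (@measurable_orthant n)).
        by rewrite setTI.
      + move=> y [Cy yF] oy; apply: B0; rewrite (_ : vec _ = vec (fun i => y (x i)))//.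
        apply: eq_from_tnth => i; rewrite !tnth_mktuple; apply/esym/eqP.
        rewrite eq_le; have := oy i; rewrite tnth_mktuple => ->; rewrite andbT leNgt.
        by apply/negP => yi; apply: yF; apply/carrP; exists (x i).
    - exact: measurableI.
    - by apply: measurableI => //; exact: measurableC.
    - by rewrite setIACA setICr setI0.
  apply: (@le_trans _ _ (numF (F ++ G) (C `&` carr F))).
    apply: numF_incl; first exact: measurableI.
    by move=> a aG; apply/List.in_or_app; right.
  rewrite -(@agree_on_carr (numF F) (numF (F ++ G)) F).
  - apply: le_measure; [exact/mem_set/measurableI|exact/mem_set|exact: subIsetl].
  - move=> a D aF mD Da; rewrite !(@numF_agree _ a)//.
    by apply/List.in_or_app; left.
  - exact: measurableI.
  - exact: subIsetr.
apply/eqP; rewrite eq_le; apply/andP; split; last first.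
  apply: ge_ereal_sup => _ [B [mB BA _] <-].
  by apply: le_measure; rewrite ?inE.
apply: supm_le => F; rewrite numF_carr//.
apply: le_trans (le_supm numF F _) _; apply: ereal_sup_ubound.
exists (A `&` carr F) => //; split.
- by apply: measurableI => //; exact: measurable_carr.
- exact: subIsetl.
- by move=> [_ /carrP[a _]]; rewrite ltxx.
Qed.

(** A weighted transform involves finitely many coordinates, so the marginals of nu determine it;
    weighted uniqueness on the path space then gives nu on {y_a > 0}. *)
Lemma path_levy_unique (nu : {measure set (paths E R) -> \bar R}) :
  levy_measure_process Q Y nu ->
  forall a (A : set (paths E R)), measurable A ->
    A `<=` [set y | 0 < y a] -> nu A = num a A.
Proof.
move=> [nuM _] a.
have cyl n (x : 'I_n -> E) i (B : set (n.-tuple R)) : x i = a -> measurable B ->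
    B `<=` [set y | 0 < tnth y i] -> image_vec x nu B = image_vec x (num a) B.
  move=> <- mB Bi; have [nux [nuxL nuxE]] := nuM n x.
  rewrite -[LHS]nuxE//; last by move=> /Bi/=; rewrite tnth_mktuple ltxx.
  exact: (marginals_of_levy_vector nuxL mB Bi).
have WE (s : seq (R * E)) : nngs s ->
    (\int[nu]_y (posexp (y a) * lexp s y)%:E =
     \int[num a]_y (posexp (y a) * lexp s y)%:E)%E.
  move=> ns; pose n := (size s).+1.
  (* Index 0 is kept for a, and the later indices run through the entries of s, repetitions
     included. *)
  pose x (i : 'I_n) := if unlift ord0 i is Some k then (tnth (in_tuple s) k).2 else a.
  pose s' : seq (R * 'I_n) :=
    [seq ((tnth (in_tuple s) k).1, lift ord0 k) | k <- enum 'I_(size s)].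
  have ss' : relabel x s' = s.
    rewrite /relabel -map_comp -[RHS](map_tnth_enum (in_tuple s)).
    by apply: eq_map => k /=; rewrite /x liftK -surjective_pairing.
  have x0 : x ord0 = a by rewrite /x unlift_none.
  pose f (t : n.-tuple R) := (lexp s' (tnth t) * posexp (1 * tnth t ord0))%:E.
  have mf : measurable_fun setT f := mfrul_tuple s' 1 ord0.
  have f0 t : (0 <= f t)%E by rewrite lee_fin frul_ge0.
  have fE (m : {measure set (paths E R) -> \bar R}) :
      (\int[m]_y (posexp (y a) * lexp s y)%:E = \int[image_vec x m]_t f t)%E.
    rewrite integral_image_vec//; apply: eq_integral => y _.
    by rewrite /f -lexp_relabel ss' tnth_mktuple x0 mul1r mulrC.
  rewrite !fE; apply: (ge0_integral_agree (@measurable_pos_tnth n ord0)) => //.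
  - move=> t /= /negP; rewrite -leNgt => t0.
    by rewrite /f mul1r posexp_le0 ?mulr0.
  - by move=> B mB B0; exact: (cyl n x ord0 B x0 mB B0).
have mW : measurable_fun setT (fun y : paths E R => posexp (y a)).
  exact: (measurableT_comp measurable_posexp (measurable_coord a)).
have mneg := @measurable_neg_coord R E.
have mpos : measurable [set y : paths E R | 0 < posexp (y a)].
  have := mW measurableT `]0, +oo[%classic (measurable_itv _); rewrite setTI.
  by congr measurable; apply/seteqP; split => t /=; rewrite in_itv/= andbT.
have num0 z : num a ([set y | y z < 0] `&` [set y | 0 < posexp (y a)]) = 0%E.
  apply: (subset_measure0 (measurableI _ _ (mneg z) mpos) (mneg z) _ (num_neg a z)).
  by move=> t [].
move=> A mA Aa; apply: (@laplace_unique_weight _ _ _ E nu (num a) (fun z y => y z) (fun y => posexp (y a))).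
- exact: paths_generated.
- exact: measurable_coord.
- exact: mW.
- by move=> y; exact: posexp_ge0.
- move=> z; rewrite -[RHS](num0 z).
  (* The event involves only a and z and lies in {y_a > 0}, so a two-dimensional marginal decides
     it. *)
  pose x (i : 'I_2) := if i == ord0 then a else z.
  pose B := [set t : 2.-tuple R | tnth t ord_max < 0] `&` [set t | 0 < posexp (tnth t ord0)].
  have BE : [set y : paths E R | y z < 0] `&` [set y | 0 < posexp (y a)] =
      [set y | B (vec (fun i => y (x i)))].
    by apply/seteqP; split => y; rewrite /B /= !tnth_mktuple.
  rewrite BE; apply: (cyl 2 x ord0) => //.
    apply: measurableI.
      have := @measurable_tnth _ R 2 ord_max measurableT `]-oo, 0[%classic (measurable_itv _).
      by rewrite setTI; congr measurable; apply/seteqP; split => t /=; rewrite in_itv.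
    have := (measurableT_comp measurable_posexp (@measurable_tnth _ R 2 ord0))
      measurableT `]0, +oo[%classic (measurable_itv _).
    by rewrite setTI; congr measurable; apply/seteqP; split => t /=; rewrite in_itv/= andbT.
  move=> t [_ /=]; apply: contraTT; rewrite -!leNgt => /posexp_le0 ->.
  by [].
- exact: num0.
- exact: WE.
- rewrite (_ : (\int[nu]_y _)%E = (\int[nu]_y (posexp (y a) * lexp [::] y)%:E)%E); last first.
    by apply: eq_integral => y _; rewrite lexp_nil mulr1.
  rewrite WE// (_ : (\int[num a]_y _)%E =
    (\int[num a]_y (lexp [::] y * posexp (1 * y a))%:E)%E); last first.
    by apply: eq_integral => y _; rewrite mul1r mulrC.
  by rewrite num_frullani// ltry.
- exact: mA.
- by move=> y /Aa /= ya; exact: posexp_gt0.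
Qed.

End permanental_law.

(** * Infinite divisibility *)

Section finite_measures.
Context d (T : measurableType d) (R : realType).
Variable m : {measure set T -> \bar R}.

(** A copy of m indexed by its proof of finiteness, to which the structure of finite measure can be
    attached. *)
Definition bounded_fun (mfin : (m setT < +oo)%E) (A : set T) : \bar R := m A.

HB.instance Definition _ mfin := Measure.copy (bounded_fun mfin) m.

HB.instance Definition _ mfin :=
  Measure_isFinite.Build _ _ _ (bounded_fun mfin) (lty_fin_num_fun mfin).

Definition finite_meas (mfin : (m setT < +oo)%E) : {finite_measure set T -> \bar R} :=
  bounded_fun mfin.

Definition normed_fun (m1 : m setT = 1%E) (A : set T) : \bar R := m A.

HB.instance Definition _ m1 := Measure.copy (normed_fun m1) m.

HB.instance Definition _ m1 := Measure_isProbability.Build _ _ _ (normed_fun m1) m1.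

Definition probability_meas (m1 : m setT = 1%E) : probability T R := normed_fun m1.

End finite_measures.

(** * Fractional powers as mixtures over exponential rates *)

Section logistic_kernel.
Context {R : realType}.
Variable k : R.
Hypotheses (k0 : 0 < k) (k2 : k <= 2^-1).
Local Notation leb := (@lebR R).

Let a : R := 1 - k.
Let g (z : R) : R := expR (a * z) / (1 + expR z).

(** With w = exp z this is the Beta integral of w^(-k) / (1 + w), equal to pi / sin(pi k). *)
Definition logistic_mass : \bar R := (\int[leb]_z (g z)%:E)%E.

Let g_gt0 z : 0 < g z.
Proof. by rewrite divr_gt0 ?expR_gt0// ltr_pwDl// expR_ge0. Qed.

Let cexp (c : R) : continuous (fun z : R => expR (c * z)).
Proof.
move=> z; apply: continuous_comp; last exact: continuous_expR.
by apply: cvgM; [exact: cvg_cst|exact: cvg_id].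
Qed.

Let measurable_g : measurable_fun setT g.
Proof.
apply: continuous_measurable_fun => z; apply: cvgM; first exact: cexp.
apply: cvgV; first by rewrite gt_eqF// ltr_pwDl// expR_ge0.
by apply: cvgD; [exact: cvg_cst|exact: continuous_expR].
Qed.

(** The derivative of -(1 + exp(k z))^-1, so its integral is at most 1. It dominates (k/4) exp(-k
    |z|), while g is at most exp(-k |z|): for z < 0 this uses 1 - k >= k. Hence the constant 4/k
    below. *)
Let h (z : R) : R := k * expR (k * z) / (1 + expR (k * z)) ^+ 2.

Let h_ge0 z : 0 <= h z.
Proof. by rewrite divr_ge0 ?mulr_ge0 ?expR_ge0 ?exprn_ge0 ?addr_ge0 ?expR_ge0// ltW. Qed.

Let g_le z : g z <= 4 / k * h z.
Proof.
have e0 := expR_gt0 (k * z).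
have -> : 4 / k * h z = 4 * expR (k * z) / (1 + expR (k * z)) ^+ 2.
  by rewrite /h; field; rewrite ?gt_eqF// ltr_pwDl// ltW.
have d0 : 0 < (1 + expR (k * z)) ^+ 2 by rewrite exprn_gt0// ltr_pwDl// ltW.
rewrite ler_pdivlMr//; have [z0|z0] := leP 0 z.
  have g1 : g z <= expR (- (k * z)).
    rewrite ler_pdivrMr ?ltr_pwDl ?expR_ge0// mulrDr mulr1 -expRD.
    have -> : - (k * z) + z = a * z by rewrite /a; ring.
    by rewrite lerDr expR_ge0.
  apply: (le_trans (ler_wpM2r (ltW d0) g1)).
  have -> : 4 * expR (k * z) = expR (- (k * z)) * (2 * expR (k * z)) ^+ 2.
    by rewrite expRN; field; rewrite gt_eqF.
  apply: ler_wpM2l; first exact: expR_ge0.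
  apply: lerXn2r; rewrite ?nnegrE ?addr_ge0 ?mulr_ge0 ?expR_ge0//.
  rewrite mulrDl mul1r lerD2r -expR0 ler_expR mulr_ge0//; exact: ltW.
have g1 : g z <= expR (k * z).
  rewrite ler_pdivrMr ?ltr_pwDl ?expR_ge0//.
  apply: (@le_trans _ _ (expR (k * z))).
    rewrite ler_expR ler_wnM2r ?(ltW z0)//.
    by rewrite /a; move: k2; lra.
  by rewrite ler_peMr ?expR_ge0// lerDl expR_ge0.
have e1 : expR (k * z) <= 1 by rewrite -expR0 ler_expR nmulr_lle0// ltW.
apply: (@le_trans _ _ (expR (k * z) * 2 ^+ 2)).
  apply: ler_pM; rewrite ?expR_ge0 ?exprn_ge0 ?addr_ge0 ?expR_ge0 ?(ltW (g_gt0 _))//.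
  by apply: lerXn2r; rewrite ?nnegrE ?addr_ge0 ?expR_ge0// lerD2l.
by rewrite mulrC le_eqVlt; apply/orP; left; apply/eqP; ring.
Qed.

Let ch : continuous h.
Proof.
move=> z; apply: cvgM; first by apply: cvgM; [exact: cvg_cst|exact: cexp].
apply: cvgV; first by rewrite gt_eqF// exprn_gt0// ltr_pwDl// expR_ge0.
by apply: cvgM; apply: cvgD; [exact: cvg_cst|exact: cexp|exact: cvg_cst|exact: cexp].
Qed.

Let integral_h (n : nat) : (\int[leb]_(z in `](- n%:R)%R, n%:R]) (h z)%:E <= 1)%E.
Proof.
have mh : measurable_fun setT (fun z => (h z)%:E).
  by apply/measurable_EFinP; exact: continuous_measurable_fun.
rewrite integral_lebR//; last 2 first.
- exact: measurable_funTS.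
- by move=> z _; rewrite lee_fin h_ge0.
rewrite integral_itv_obnd_cbnd; last exact: measurable_funTS.
case: n => [|n]; first by rewrite oppr0 set_itv1 integral_set1 lee01.
pose H (z : R) := - (1 + expR (k * z))^-1.
have dH x : is_derive x (1:R) H (h x).
  have x0 : 1 + expR (k * x) != 0 by rewrite gt_eqF// ltr_pwDl// expR_ge0.
  have d1 : is_derive x (1:R) (fun z : R => 1 + expR (k * z)) (k * expR (k * x)).
    rewrite (_ : (fun z : R => _) = cst 1 \+ (expR \o (k \*: (@id R)))); last first.
      by apply/funext => u.
    by apply: is_derive_eq; rewrite add0r /GRing.scale/= mulr1 mulrC.
  have d2 := @is_deriveV R _ x _ 1 x0 d1.
  rewrite (_ : H = - (fun z : R => (1 + expR (k * z))^-1)); last by apply/funext.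
  by apply: is_derive_eq; rewrite /h /GRing.scale/=; field.
have cH : continuous H.
  by move=> x; apply/differentiable_continuous/derivable1_diffP; apply: ex_derive.
have nn : - n.+1%:R < n.+1%:R :> R by rewrite -subr_gt0 opprK -natrD ltr0n.
rewrite (@continuous_FTC2 _ h H (- n.+1%:R) n.+1%:R nn).
- rewrite -EFinB lee_fin /H opprK addrC lerBlDr.
  have e0 (u : R) : 0 <= (1 + expR u)^-1 by rewrite invr_ge0 addr_ge0// expR_ge0.
  apply: (@le_trans _ _ 1); last by rewrite lerDl.
  by rewrite invf_le1 ?lerDl ?expR_ge0// ltr_pwDl// expR_ge0.
- exact: continuous_subspaceT.
- split; first by move=> x _; exact: ex_derive.
    exact/cvg_at_right_filter/cH.
  exact/cvg_at_left_filter/cH.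
- by move=> x _; rewrite derive1E; apply: derive_val.
Qed.

Lemma logistic_mass_lty : (logistic_mass < +oo)%E.
Proof.
pose f (n : nat) z := ((z \in `](- n%:R)%R, n%:R])%:R * g z)%:E.
have cvf z : (f ^~ z) @ \oo --> (g z)%:E.
  apply: cvg_near_cst; near=> n; rewrite /f in_itv/=.
  have : (Num.truncn `|z|).+1%:R <= n%:R :> R by rewrite ler_nat; near: n; exact: nbhs_infty_ge.
  move=> /(lt_le_trans (truncnS_gt `|z|))/ltr_normlP[h1 h2].
  by rewrite ltrNl h1 ltW// mul1r.
have mf n : measurable_fun setT (f n).
  apply/measurable_EFinP; apply: measurable_funM => //.
  rewrite (_ : (fun z => _) = (\1_(`](- n%:R)%R, n%:R]%classic) : R -> R)).
    exact: measurable_indic.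
  by apply/funext => z; rewrite indicE mem_setE.
have f0 n z : (0 <= f n z)%E by rewrite lee_fin mulr_ge0// ltW.
have ndf z : nondecreasing_seq (f ^~ z).
  move=> p q pq; rewrite lee_fin ler_wpM2r ?(ltW (g_gt0 _))// ler_nat.
  rewrite !in_itv/=; case: (boolP (_ && _)) => //= /andP[z1 z2].
  rewrite (le_trans z2) ?ler_nat// andbT (le_lt_trans _ z1)//.
  by rewrite lerN2 ler_nat.
have -> : logistic_mass = limn (fun n => \int[leb]_z f n z)%E.
  rewrite -monotone_convergence//.
  by apply: eq_integral => z _; apply/esym/cvg_lim => //; exact: cvf.
apply: (@le_lt_trans _ _ (4 / k)%:E); last exact: ltry.
apply: lime_le.
  apply: ereal_nondecreasing_is_cvgn => p q pq; apply: ge0_le_integral => // z _.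
  exact: ndf.
apply: nearW => n.
apply: (@le_trans _ _ (\int[leb]_(z in `](- n%:R)%R, n%:R]) ((4 / k)%:E * (h z)%:E))%E).
  rewrite [leRHS]integral_mkcond; apply: ge0_le_integral => //.
  - apply/measurable_restrict => //; rewrite setTI; apply: measurable_funTS.
    apply: measurable_funeM; apply/measurable_EFinP; exact: continuous_measurable_fun.
  - move=> z _; rewrite patchE mem_setE /f; case: ifP => _; last by rewrite mul0r.
    by rewrite mul1r -EFinM lee_fin; exact: g_le.
rewrite ge0_integralZl//.
- rewrite -[leRHS]mule1; apply: lee_wpmul2l; last exact: integral_h.
  by rewrite lee_fin divr_ge0// ltW.
- apply: measurable_funTS; apply/measurable_EFinP; exact: continuous_measurable_fun.
- by move=> z _; rewrite lee_fin.
- by rewrite lee_fin divr_ge0// ltW.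
Unshelve. all: by end_near. Qed.

Lemma logistic_mass_gt0 : (0 < logistic_mass)%E.
Proof.
apply: (@lt_le_trans _ _ (\int[leb]_z (((1 + expR 1)^-1)%:E * (\1_(`]0%R, 1%R]%classic) z)%:E))%E).
  have i1 : (\int[leb]_z (\1_(`]0%R, 1%R]%classic : set R) z)%:E = 1)%E.
    rewrite integral_indic// setIT; apply: (etrans (lebR_itvoc ler01)).
    by rewrite subr0.
  rewrite ge0_integralZl//.
  - by rewrite i1 mule1 lte_fin invr_gt0 ltr_pwDl// expR_ge0.
  - by apply/measurable_EFinP; exact: measurable_indic.
apply: ge0_le_integral => //.
- by apply: measurable_funeM; apply/measurable_EFinP; exact: measurable_indic.
- exact/measurable_EFinP.
move=> z _; rewrite -EFinM lee_fin indicE mem_setE in_itv/=.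
case: (boolP (_ && _)) => [/andP[z0 z1]|_]; last by rewrite mulr0 ltW.
rewrite mulr1 -[leLHS]mul1r; apply: ler_pM => //.
- by rewrite -expR0 ler_expR mulr_ge0// ?(ltW z0)// /a; move: k2; lra.
- by rewrite lef_pV2 ?posrE ?ltr_pwDl ?expR_ge0// lerD2l ler_expR.
Qed.

(* For K = resm s i, K / (1 + u K) is the Laplace transform at [s] of mu_i tilted by
   exp(- u y_i); this writes K^k as the transform of a mixture of such tilts. *)
Lemma logistic_scale (K : R) : 0 < K ->
  (\int[leb]_z (expR (a * z) * (K / (1 + expR z * K)))%:E = (K `^ k)%:E * logistic_mass)%E.
Proof.
(* Writing K = exp c turns the product K exp z into a translation of z. *)
move=> K0; have [c KE] : exists c, K = expR c by exists (ln K); rewrite lnK.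
rewrite KE /powR gt_eqF ?expR_gt0// expRK.
rewrite /logistic_mass -(@integral_lebR_shift _ c (fun z => (g z)%:E)); last 2 first.
- exact/measurable_EFinP.
- by move=> z; rewrite lee_fin ltW.
rewrite -ge0_integralZl//.
- apply: eq_integral => z _; rewrite -EFinM; congr EFin.
  rewrite /g expRD mulrCA !mulrA -!expRD; congr (expR _ / _).
  by rewrite /a; ring.
- apply/measurable_EFinP; apply: (measurableT_comp measurable_g).
  exact: measurable_addr.
- by move=> z _; rewrite lee_fin ltW.
Qed.

End logistic_kernel.

Section convolution.
Context {R : realType} {I : Type}.
Variables P1 P2 : probability (paths I R) R.

Let add (p : paths I R * paths I R) : paths I R := fun x => p.1 x + p.2 x.

Let madd : measurable_fun setT add.
Proof.
apply: measurable_to_paths => a; apply: measurable_funD.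
  exact: (measurableT_comp (measurable_coord a) measurable_fst).
exact: (measurableT_comp (measurable_coord a) measurable_snd).
Qed.

Let conv_setT : image_measure (P1 \x P2)%E madd setT = 1%E.
Proof. by rewrite /image_measure/= /pushforward preimage_setT; exact: probability_setT. Qed.

Definition convolution : probability (paths I R) R := probability_meas conv_setT.

Lemma convolution_neg x : P1 [set y : paths I R | y x < 0] = 0%E ->
  P2 [set y : paths I R | y x < 0] = 0%E -> convolution [set y : paths I R | y x < 0] = 0%E.
Proof.
move=> n1 n2; have mN := @measurable_neg_coord R I x.
have mA : measurable ([set y : paths I R | y x < 0] `*` [set: paths I R]) by exact: measurableX.
have mB : measurable ([set: paths I R] `*` [set y : paths I R | y x < 0]) by exact: measurableX.
apply: (@subset_measure0 _ _ _ (P1 \x P2)%E _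
  ([set y : paths I R | y x < 0] `*` setT `|` setT `*` [set y : paths I R | y x < 0])).
- by rewrite -[X in measurable X]setTI; exact: madd.
- exact: measurableU.
- move=> p /=; rewrite /add => p0; have [p1|p1] := ltP (p.1 x) 0; first by left.
  by right; split => //=; apply: contraTT p0; rewrite -!leNgt => p2; rewrite addr_ge0.
- apply/eqP; rewrite eq_le measure_ge0 andbT.
  apply: (le_trans (measureU2 _ mA mB)).
  rewrite [X in (X + _)%E](_ : _ = 0%E) ?[X in (_ + X)%E](_ : _ = 0%E) ?adde0//.
    by apply: (etrans (product_measure1E P1 P2 measurableT mN));
      apply/eqP; rewrite mule_eq0; apply/orP; right; apply/eqP; exact: n2.
  by apply: (etrans (product_measure1E P1 P2 mN measurableT));
    apply/eqP; rewrite mule_eq0; apply/orP; left; apply/eqP; exact: n1.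
Qed.

Lemma convolution_laplace s :
  (\int[convolution]_y (lexp s y)%:E = \int[P1]_y (lexp s y)%:E * \int[P2]_y (lexp s y)%:E)%E.
Proof.
have ml : measurable_fun setT (fun y : paths I R => (lexp s y)%:E).
  by apply/measurable_EFinP; exact: (measurable_lexp _ measurable_coord).
have l0 (y : paths I R) : (0 <= (lexp s y)%:E)%E by rewrite lee_fin lexp_ge0.
have mla : measurable_fun setT (fun p => (lexp s (add p))%:E).
  exact: (measurableT_comp ml madd).
transitivity (\int[(P1 \x P2)%E]_p (lexp s (add p))%:E)%E.
  exact: (@ge0_integral_pushforward _ _ _ _ R _ madd (P1 \x P2)%E setT (fun y => (lexp s y)%:E)).
rewrite (@fubini_tonelli1 _ _ _ _ R P1 P2 (fun p => (lexp s (add p))%:E) mla (fun p => l0 _)).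
rewrite /fubini_F /=.
have lE y z : (lexp s (add (y, z)))%:E = ((lexp s y)%:E * (lexp s z)%:E)%E.
  rewrite -EFinM /lexp -expRD /lsum -opprD -big_split/=; congr (expR (- _))%:E.
  by apply: eq_bigr => c _; rewrite mulrDr.
under eq_integral => y _ do under eq_integral => z _ do rewrite lE.
under eq_integral => y _ do rewrite ge0_integralZl//.
rewrite ge0_integralZr//.
by apply: integral_ge0.
Qed.

End convolution.

Section green_family.
Context {R : realType} {I : eqType}.
Local Notation leb := (@lebR R).
Implicit Types (mu : I -> {finite_measure set (paths I R) -> \bar R}) (s : seq (R * I)).

(** What the construction of roots asks of mu. The symmetry [gf_sym] is a field here, whereas
    [detm_lsum] draws it from a process Y: the thinned families below come with no such process. *)
Record green_family mu : Prop := GreenFamily {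
  gf_lty : forall s a, nngs s -> (\int[mu a]_y (lexp s y)%:E < +oo)%E ;
  gf_neg : forall a x, mu a [set y : paths I R | y x < 0] = 0%E ;
  gf_pos : forall a, mu a (~` [set y : paths I R | 0 < y a]) = 0%E ;
  gf_cons : forall s a (t : R), nngs s -> 0 <= t ->
    resm mu s a = resm mu ((t, a) :: s) a * (1 + t * resm mu s a) ;
  gf_sym : forall s s', nngs s -> nngs s' -> (forall y, lsum s y = lsum s' y) ->
    detm mu s = detm mu s' }.

Let mlexpE s : measurable_fun setT (fun y : paths I R => (lexp s y)%:E).
Proof. by apply/measurable_EFinP; exact: (measurable_lexp _ measurable_coord). Qed.

Let lexp0 s (y : paths I R) : (0 <= (lexp s y)%:E)%E.
Proof. by rewrite lee_fin lexp_ge0. Qed.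

Let gf_resmE mu s a : green_family mu -> nngs s ->
  (resm mu s a)%:E = (\int[mu a]_y (lexp s y)%:E)%E.
Proof.
move=> gf ns; rewrite /resm fineK// ge0_fin_numE ?(gf_lty gf)//.
exact: integral_ge0.
Qed.

Let gf_resm_ge0 mu s a : 0 <= resm mu s a.
Proof. by apply: fine_ge0; exact: integral_ge0. Qed.

Let gf_resm0 mu a : green_family mu -> (resm mu [::] a)%:E = mu a setT.
Proof.
move=> gf; rewrite gf_resmE//; under eq_integral do rewrite lexp_nil.
by rewrite integral_cst// mul1e.
Qed.

Let gf_resm_gt0 mu s a : green_family mu -> nngs s ->
  0 < resm mu [::] a -> 0 < resm mu s a.
Proof.
move=> gf ns; rewrite !lt0r !gf_resm_ge0 !andbT; apply: contra => /eqP r0.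
have := gf_resmE a gf ns; rewrite r0 => /esym i0.
have : (\int[mu a]_y `|(lexp s y)%:E| = 0)%E.
  by rewrite -[RHS]i0; apply: eq_integral => y _; rewrite gee0_abs.
move/(ae_eq_integral_abs (mu a) measurableT (mlexpE s)).
move=> [N [mN N0 NE]].
have N1 : N = setT.
  apply/seteqP; split => // y _; apply: NE => /= /(_ Logic.I)[].
  by move/eqP; rewrite gt_eqF// lexp_gt0.
by rewrite -eqe gf_resm0// -N1 N0.
Qed.

Let nngs_cons (t : R) (b : I) s : 0 <= t -> nngs s -> nngs ((t, b) :: s).
Proof. by move=> t0 ns; rewrite /nngs/= t0. Qed.

Let gf_detm_gt0 mu s : nngs s -> 0 < detm mu s.
Proof.
elim: s => [//|c s IH] /= /andP[c0 /IH s0].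
by rewrite mulr_gt0// ltr_pwDl// mulr_ge0.
Qed.

Section stable_piece.
Variables (mu : I -> {finite_measure set (paths I R) -> \bar R}) (i : I) (k : R).
Hypotheses (gf : green_family mu) (i0 : 0 < resm mu [::] i).
Hypotheses (k0 : 0 < k) (k2 : k <= 2^-1).

(** The total mass before normalisation, given by [logistic_scale] at the empty list. *)
Let c : R := resm mu [::] i `^ k * fine (logistic_mass k).

Let massE : (fine (logistic_mass k))%:E = logistic_mass k.
Proof.
by rewrite fineK// ge0_fin_numE ?logistic_mass_lty// ltW// logistic_mass_gt0.
Qed.

Let c_gt0 : 0 < c.
Proof. by rewrite mulr_gt0 ?powR_gt0// -lte_fin massE logistic_mass_gt0. Qed.

(** In terms of u = exp z: the tilt exp(-u y_i), with the mixing measure u^(1-k) du / u. *)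
Let f (p : paths I R * R) : R := c^-1 * (expR ((1 - k) * p.2) * expR (- (expR p.2 * p.1 i))).

Let f_ge0 p : 0 <= f p.
Proof. by rewrite mulr_ge0 ?invr_ge0 ?(ltW c_gt0)// mulr_ge0// expR_ge0. Qed.

Let measurable_f : measurable_fun setT f.
Proof.
apply: measurable_funM => //; apply: measurable_funM.
  by apply: measurableT_comp => //; apply: measurable_funM => //; exact: measurable_snd.
do 2 apply: measurableT_comp => //; apply: measurable_funM.
  by apply: measurableT_comp => //; exact: measurable_snd.
exact: (measurableT_comp (measurable_coord i) measurable_fst).
Qed.

Let piece := wpush (mu i \x leb)%E f_ge0 measurable_f measurable_fst.

(** Integrating in y gives K / (1 + u K) with K = [resm s i], by [gf_cons]; [logistic_scale]
    integrates over the rate u. *)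
Let piece_laplace s : nngs s ->
  (\int[piece]_y (lexp s y)%:E = ((resm mu s i / resm mu [::] i) `^ k)%:E)%E.
Proof.
move=> ns; rewrite integral_wpush//.
have mfl : measurable_fun setT (fun p : paths I R * R => ((f p)%:E * (lexp s p.1)%:E)%E).
  apply: emeasurable_funM; first exact/measurable_EFinP.
  exact: (measurableT_comp (mlexpE s) measurable_fst).
have fl0 (p : paths I R * R) : (0 <= (f p)%:E * (lexp s p.1)%:E)%E by rewrite mule_ge0// lee_fin.
rewrite (@fubini_tonelli2 _ _ _ _ R (mu i) leb _ mfl fl0) /fubini_G /=.
have K0 := gf_resm_gt0 gf ns i0.
transitivity (\int[leb]_z ((c^-1)%:E *
    (expR ((1 - k) * z) * (resm mu s i / (1 + expR z * resm mu s i)))%:E))%E.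
  apply: eq_integral => z _; have z0 := expR_ge0 z; have nz := nngs_cons i z0 ns.
  have -> : resm mu s i / (1 + expR z * resm mu s i) = resm mu ((expR z, i) :: s) i.
    rewrite {1}(gf_cons gf i ns z0) mulfK// gt_eqF//.
    by rewrite ltr_pwDl// mulr_ge0// ltW.
  rewrite EFinM gf_resmE// -!ge0_integralZl//; last 3 first.
  - exact: measurable_funeM.
  - by move=> y _; rewrite mule_ge0 ?lee_fin ?expR_ge0.
  - by rewrite lee_fin invr_ge0 ltW.
  - by apply: eq_integral => y _; rewrite lexp_cons -!EFinM /f/=; congr EFin; ring.
rewrite ge0_integralZl//; last 3 first.
- apply/measurable_EFinP; apply: continuous_measurable_fun => z; apply: cvgM.
    apply: continuous_comp; last exact: continuous_expR.
    by apply: cvgM; [exact: cvg_cst|exact: cvg_id].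
  apply: cvgM; first exact: cvg_cst.
  apply: cvgV; first by rewrite gt_eqF// ltr_pwDl// mulr_ge0 ?expR_ge0// ltW.
  apply: cvgD; first exact: cvg_cst.
  by apply: cvgM; [exact: continuous_expR|exact: cvg_cst].
- move=> z _; rewrite lee_fin mulr_ge0 ?expR_ge0// divr_ge0 ?addr_ge0 ?mulr_ge0 ?expR_ge0//.
- by rewrite lee_fin invr_ge0 ltW.
rewrite logistic_scale// -massE -!EFinM; congr EFin.
have <- : (resm mu s i / resm mu [::] i) `^ k * resm mu [::] i `^ k = resm mu s i `^ k.
  by rewrite -powRM ?divr_ge0// divfK// gt_eqF.
rewrite /c; field; rewrite !gt_eqF ?powR_gt0//.
by rewrite -lte_fin massE logistic_mass_gt0.
Qed.

Lemma stable_piece : exists rho : probability (paths I R) R,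
  (forall x, rho [set y : paths I R | y x < 0] = 0%E) /\
  forall s, nngs s ->
    (\int[rho]_y (lexp s y)%:E = ((resm mu s i / resm mu [::] i) `^ k)%:E)%E.
Proof.
have p1 : piece setT = 1%E.
  have := piece_laplace (isT : nngs [::]); rewrite divff ?gt_eqF// powR1.
  by under eq_integral do rewrite lexp_nil; rewrite integral_cst// mul1e.
exists (probability_meas p1); split; last exact: piece_laplace.
move=> x; have mN := @measurable_neg_coord R I x.
apply: wpush_null => //.
have -> : fst @^-1` [set y : paths I R | y x < 0] =
    [set y : paths I R | y x < 0] `*` [set: R].
  by apply/seteqP; split => [p|p []].
apply: (etrans (product_measure1E (mu i) leb mN measurableT)).
by apply/eqP; rewrite mule_eq0; apply/orP; left; apply/eqP; exact: gf_neg.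
Qed.

End stable_piece.

(** * Restriction to the paths that vanish at one state *)

Section thinning.
Variables (mu : I -> {finite_measure set (paths I R) -> \bar R}) (i : I).
Hypotheses (gf : green_family mu) (i0 : 0 < resm mu [::] i).

Let off (y : paths I R) : R := (~~ (0 < y i))%R%:R.

Let off_ge0 y : 0 <= off y. Proof. by []. Qed.

Let measurable_off : measurable_fun setT off.
Proof.
rewrite (_ : off = \1_(~` [set y : paths I R | 0 < y i])).
  by apply: measurable_indic; apply: measurableC; exact: measurable_pos_coord.
by apply/funext => y; rewrite indicE in_setC mem_setE.
Qed.

Let cut a : {measure set (paths I R) -> \bar R} :=
  wpush (mu a) off_ge0 measurable_off (@measurable_id _ _ setT).

Let integral_cut a s : (\int[cut a]_y (lexp s y)%:E = \int[mu a]_y (off y * lexp s y)%:E)%E.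
Proof. by rewrite integral_wpush. Qed.

Let moff s : measurable_fun setT (fun y : paths I R => (off y * lexp s y)%:E).
Proof.
apply/measurable_EFinP; apply: measurable_funM => //.
exact: (measurable_lexp _ measurable_coord).
Qed.

Let cut_le a s : (\int[cut a]_y (lexp s y)%:E <= \int[mu a]_y (lexp s y)%:E)%E.
Proof.
rewrite integral_cut; apply: ge0_le_integral => //.
- by move=> y _; rewrite lee_fin mulr_ge0// lexp_ge0.
- by move=> y _; rewrite lee_fin ler_piMl ?lexp_ge0// /off; case: (_ < _).
Qed.

Let cut_lty a : (cut a setT < +oo)%E.
Proof.
have := cut_le a [::]; under eq_integral do rewrite lexp_nil.
rewrite integral_cst// mul1e => h; apply: (le_lt_trans h).
exact: (gf_lty gf).
Qed.

(* The restriction to {y_i = 0} is the limit of killing at [i] at an infinite rate. *)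
Definition thin a : {finite_measure set (paths I R) -> \bar R} := finite_meas (cut_lty a).

Let thin_cvg s a : nngs s ->
  resm mu ((n%:R, i) :: s) a @[n --> \oo] --> resm thin s a.
Proof.
move=> ns.
have nn n : nngs ((n%:R, i) :: s) by exact: nngs_cons.
have intl : (mu a).-integrable setT (fun y => (lexp s y)%:E).
  apply/integrableP; split => //.
  under eq_integral do rewrite gee0_abs//; exact: (gf_lty gf).
have thinfin : (\int[mu a]_y (off y * lexp s y)%:E)%E \is a fin_num.
  rewrite ge0_fin_numE; first by rewrite -integral_cut (le_lt_trans (cut_le a s))// (gf_lty gf).
  by apply: integral_ge0 => y _; rewrite lee_fin mulr_ge0// lexp_ge0.
have thinE : (resm thin s a)%:E = (\int[mu a]_y (off y * lexp s y)%:E)%E.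
  by rewrite /resm (_ : (\int[thin a]_y _)%E = (\int[cut a]_y (lexp s y)%:E)%E)// integral_cut fineK.
apply: fine_cvg; rewrite thinE.
have Nneg := gf_neg gf a i; have mneg := @measurable_neg_coord R I i.
have [//|||||_ _] := @dominated_convergence _ _ R (mu a) setT measurableT
  (fun n y => (lexp ((n%:R, i) :: s) y)%:E) (fun y => (off y * lexp s y)%:E)
  (fun y => (lexp s y)%:E); last exact.
- exact: moff.
- exists [set y : paths I R | y i < 0]; split => // y /= /not_implyP[_].
  apply: contra_notP => /negP; rewrite -leNgt => yi; apply/cvg_EFin; first exact: nearW.
  rewrite (_ : fine \o _ = fun n => expR (- (n%:R * y i)) * lexp s y); last first.
    by apply/funext => n /=; rewrite lexp_cons.
  apply: cvgM; last exact: cvg_cst.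
  move: yi; rewrite le_eqVlt /off => /predU1P[<-|yi].
    rewrite ltxx/= (_ : (fun n : nat => _) = cst 1); first exact: cvg_cst.
    by apply/funext => n; rewrite mulr0 oppr0 expR0.
  rewrite yi/= (_ : (fun n : nat => _) = fun n => expR (- y i) ^+ n); last first.
    by apply/funext => n; rewrite -mulrN expRM_natl.
  by apply: cvg_expr; rewrite ger0_norm ?expR_ge0// -expR0 ltr_expR oppr_lt0.
- exact: intl.
- exists [set y : paths I R | y i < 0]; split => // y /=.
  apply: contra_notP => /negP; rewrite -leNgt => yi n _.
  rewrite lee_fin ger0_norm ?lexp_ge0// lexp_cons/= ler_piMl ?lexp_ge0//.
  by rewrite -expR0 ler_expR oppr_le0 mulr_ge0.
Qed.

Let resm_lsum s s' a : (forall y, lsum s y = lsum s' y) -> resm mu s a = resm mu s' a.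
Proof.
by move=> ss'; congr fine; apply: eq_integral => y _; rewrite /lexp ss'.
Qed.

Let nn n s : nngs s -> nngs (((n : nat)%:R, i) :: s).
Proof. exact: nngs_cons. Qed.

(** With (n, i) at the end of the list, every factor added by s is computed from a resolvent killed
    at i at rate n, which converges by [thin_cvg]; the division removes the factor of (n, i)
    itself. *)
Let thin_detm_cvg s : nngs s ->
  detm mu (s ++ [:: (n%:R, i)]) / detm mu [:: (n%:R, i)] @[n --> \oo] --> detm thin s.
Proof.
elim: s => [_|[t b] s IH /= /andP[t0 ns]].
  rewrite (_ : (fun n => _) = cst 1); first exact: cvg_cst.
  by apply/funext => n /=; rewrite divff// gt_eqF// mul1r ltr_pwDl// mulr_ge0.
rewrite (_ : (fun n => _) = fun n => detm mu (s ++ [:: (n%:R, i)]) / detm mu [:: (n%:R, i)] *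
    (1 + t * resm mu ((n%:R, i) :: s) b)); last first.
  apply/funext => n /=; rewrite mulrAC; congr (_ * (1 + t * _)).
  by apply: resm_lsum => y; rewrite lsum_cat !lsum_cons lsum_nil addr0 addrC.
apply: cvgM; first exact: IH.
apply: cvgD; first exact: cvg_cst.
by apply: cvgM; [exact: cvg_cst|exact: thin_cvg].
Qed.

(** Moving (n, i) to the head by [gf_sym] makes the ratio equal to [detm mu s] (1 + n A) / (1 + n
    B), with A and B the resolvents at i for s and for the empty list; it tends to [detm mu s] A /
    B. *)
Lemma thin_detm s : nngs s -> detm thin s = detm mu s * (resm mu s i / resm mu [::] i).
Proof.
move=> ns; apply: (cvg_unique _ (thin_detm_cvg ns)) => //.
pose A := resm mu s i; pose B := resm mu [::] i.
have B0 n : 0 < 1 + n%:R * B by rewrite ltr_pwDl// mulr_ge0// ltW.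
rewrite (_ : (fun n => _) = fun n => detm mu s *
    (A / B + (1 - A / B) * (1 + n%:R * B)^-1)); last first.
  apply/funext => n; rewrite (gf_sym gf (s' := (n%:R, i) :: s)) ?nn//.
  - by rewrite /= -/A -/B mul1r -mulrA; congr (_ * _); field; rewrite !gt_eqF.
  - by rewrite /nngs all_cat -/(nngs s) ns /= ler0n.
  - by move=> y; rewrite lsum_cat !lsum_cons lsum_nil addr0 addrC.
apply: cvgM; first exact: cvg_cst.
rewrite -[X in _ --> X]addr0; apply: cvgD; first exact: cvg_cst.
rewrite -[X in _ --> X](mulr0 (1 - A / B)); apply: cvgM; first exact: cvg_cst.
(* Since 1 + n B >= c (n + 1), the remaining term is compared with the harmonic sequence. *)
pose c := Num.min 1 B; have c0 : 0 < c by rewrite lt_min ltr01.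
apply: (@squeeze_cvgr _ _ _ _ (cst 0) (fun n => c^-1 * (n.+1%:R)^-1)).
- apply: nearW => n; rewrite /= invr_ge0 (ltW (B0 n))/= -invfM.
  rewrite lef_pV2 ?posrE ?mulr_gt0// -natr1 mulrDr mulr1 addrC.
  by apply: lerD; rewrite ?ge_min ?lexx// mulrC ler_wpM2l// ge_min lexx orbT.
- exact: cvg_cst.
- rewrite -[X in _ --> X](mulr0 c^-1); apply: cvgM; first exact: cvg_cst.
  exact: cvg_harmonic.
Qed.

Lemma thin_family : green_family thin.
Proof.
split.
- move=> s a ns; apply: (le_lt_trans (cut_le a s)); exact: (gf_lty gf).
- by move=> a x; change (cut a [set y : paths I R | y x < 0] = 0%E); apply: wpush_null; [exact: measurable_neg_coord|exact: gf_neg].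
- move=> a; change (cut a (~` [set y : paths I R | 0 < y a]) = 0%E); apply: wpush_null; last exact: gf_pos.
  by apply: measurableC; exact: measurable_pos_coord.
- move=> s a t ns t0; apply: (cvg_unique _ (thin_cvg ns)) => //.
  rewrite (_ : (fun n => _) = fun n => resm mu ((n%:R, i) :: (t, a) :: s) a *
     (1 + t * resm mu ((n%:R, i) :: s) a)); last first.
    apply/funext => n; rewrite {1}(gf_cons gf a (nn n ns) t0); congr (_ * _).
    by apply: resm_lsum => y; rewrite !lsum_cons addrCA.
  apply: cvgM; first exact/thin_cvg/nngs_cons.
  apply: cvgD; first exact: cvg_cst.
  by apply: cvgM; [exact: cvg_cst|exact: thin_cvg].
- move=> s s' ns ns' ss'; rewrite !thin_detm//.
  by rewrite (gf_sym gf ns ns')// (resm_lsum i ss').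
Qed.

Lemma thin_null a : a = i \/ mu a setT = 0%E -> thin a setT = 0%E.
Proof.
move=> [->|a0].
  change (cut i setT = 0%E); rewrite wpushE -(integral0 (mu i) setT).
  apply: ge0_ae_eq_integral => //.
  - apply: emeasurable_funM; first exact/measurable_EFinP.
    by apply/measurable_EFinP; exact: measurable_indic.
  - by move=> y _; rewrite indicT mule1 lee_fin.
  exists (~` [set y : paths I R | 0 < y i]); split.
  - by apply: measurableC; exact: measurable_pos_coord.
  - exact: gf_pos.
  - by move=> y /= /not_implyP[_ h] yi; apply: h; rewrite /off yi mul0e.
have := cut_le a [::]; under eq_integral do rewrite lexp_nil.
under [X in (_ <= X)%E -> _]eq_integral do rewrite lexp_nil.
rewrite !integral_cst// !mul1e => h.
apply/eqP; rewrite eq_le measure_ge0 andbT; apply: (le_trans h).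
by rewrite le_eqVlt; apply/orP; left; apply/eqP; exact: a0.
Qed.

End thinning.

(** By [thin_detm], the power -k of [detm mu s] is that of the thinned family times the power k of
    [resm mu s i / resm mu [::] i], hence the transform of a convolution. The list l contains every
    state of positive mass; thinning at i removes i and gives mass to no new state. With no mass
    left, [detm] is 1 and the law is the unit mass at the null path. *)
Lemma fractional_law (k : R) mu (l : seq I) : 0 < k -> k <= 2^-1 -> green_family mu ->
  (forall a, a \notin l -> mu a setT = 0%E) ->
  exists rho : probability (paths I R) R,
    (forall x, rho [set y : paths I R | y x < 0] = 0%E) /\
    forall s, nngs s -> (\int[rho]_y (lexp s y)%:E = (detm mu s `^ (- k))%:E)%E.
Proof.
move=> k0 k2; elim: l mu => [|i l IH] mu gf mul.
  have r0 s a : nngs s -> resm mu s a = 0.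
    move=> ns; apply/eqP/negPn/negP => ra.
    have : (\int[mu a]_y (lexp s y)%:E = 0)%E.
      by apply: null_set_integral => //; exact: mul.
    by rewrite -gf_resmE// => -[]; apply/eqP.
  have d1 s : nngs s -> detm mu s = 1.
    by elim: s => [//|c s IHs] /= /andP[c0 ns]; rewrite IHs// r0// mulr0 addr0 mulr1.
  pose z : paths I R := fun=> 0.
  exists (\d_z : probability (paths I R) R); split.
    move=> x; change ((\1_[set y : paths I R | y x < 0] z : R)%:E = 0%E).
    by rewrite indicE memNset//= ltxx.
  move=> s ns; rewrite integral_dirac// diracT mul1e d1// powR1; congr EFin.
  by rewrite /lexp /lsum big1 ?oppr0 ?expR0// => c _; rewrite mulr0.
have [i0|i0] := ltP 0 (resm mu [::] i); last first.
  apply: IH => // a al; have [->|ai] := eqVneq a i.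
    rewrite -gf_resm0//; congr EFin; apply/eqP; rewrite eq_le i0.
    exact: gf_resm_ge0.
  by apply: mul; rewrite inE negb_or ai.
have [|rho1 [n1 l1]] := IH (thin i gf) (thin_family gf i0).
  move=> a al; apply: thin_null; have [->|ai] := eqVneq a i; first by left.
  by right; apply: mul; rewrite inE negb_or ai.
have [rho2 [n2 l2]] := stable_piece gf i0 k0 k2.
exists (convolution rho1 rho2); split; first by move=> x; exact: convolution_neg.
move=> s ns; rewrite convolution_laplace l1// l2// -EFinM; congr EFin.
have q0 : 0 < resm mu s i / resm mu [::] i by rewrite divr_gt0// gf_resm_gt0.
rewrite thin_detm// powRM ?(ltW (gf_detm_gt0 _ _)) ?(ltW q0)// -mulrA.
by rewrite [X in X * _ `^ k]powRN mulVf ?mulr1// gt_eqF// powR_gt0.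
Qed.

End green_family.

(** Iterated product measures. The formula for products of nonnegative functions gives independence,
    the common law and the Laplace transform of the sum all at once. *)
Lemma iid_copies d (T : measurableType d) (R : realType) (rho : probability T R) (m : nat) :
  exists (d1 : measure_display) (Om : measurableType d1) (P : probability Om R)
    (Z : 'I_m -> Om -> T), (forall k, measurable_fun setT (Z k)) /\
    forall f : 'I_m -> T -> \bar R, (forall k, measurable_fun setT (f k)) ->
      (forall k t, 0 <= f k t)%E ->
      (\int[P]_w (\prod_(k < m) f k (Z k w)) = \prod_(k < m) \int[rho]_t f k t)%E.
Proof.
elim: m => [|m [d1 [Om [P [Z [mZ ZE]]]]]].
  exists d, T, rho, (fun _ => id); split; first by case.
  move=> f _ _; rewrite big_ord0.
  under eq_integral do rewrite big_ord0.
  by rewrite integral_cst// mul1e; exact: probability_setT.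
pose Z' (k : 'I_m.+1) (w : T * Om) : T := if unlift ord0 k is Some j then Z j w.2 else w.1.
have Z'0 w : Z' ord0 w = w.1 by rewrite /Z' unlift_none.
have Z'S j w : Z' (lift ord0 j) w = Z j w.2 by rewrite /Z' liftK.
have mZ' k : measurable_fun setT (Z' k).
  rewrite /Z'; case: unliftP => [j _|_]; last exact: measurable_fst.
  exact: (measurableT_comp (mZ j) measurable_snd).
exists _, (T * Om)%type, (rho \x P)%E, Z'; split => // f mf f0.
pose g w := (\prod_(k < m) f (lift ord0 k) (Z k w))%E.
have mg : measurable_fun setT g.
  rewrite /g; elim: (index_enum _) => [|k l IHl].
    by under eq_fun do rewrite big_nil; exact: measurable_cst.
  under eq_fun do rewrite big_cons; apply: emeasurable_funM => //.
  exact: (measurableT_comp (mf _) (mZ k)).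
have g0 w : (0 <= g w)%E by apply: prode_ge0.
have F0 w : (0 <= f ord0 w.1 * g w.2)%E by rewrite mule_ge0.
have mF : measurable_fun setT (fun w : T * Om => f ord0 w.1 * g w.2)%E.
  apply: emeasurable_funM.
    exact: (measurableT_comp (mf ord0) measurable_fst).
  exact: (measurableT_comp mg measurable_snd).
transitivity (\int[(rho \x P)%E]_w (f ord0 w.1 * g w.2))%E.
  apply: eq_integral => w _; rewrite big_ord_recl Z'0; congr (_ * _)%E.
  by apply: eq_bigr => k _; rewrite Z'S.
rewrite (@fubini_tonelli1 _ _ _ _ R rho P _ mF F0) /fubini_F /=.
under eq_integral => t _ do rewrite ge0_integralZl//.
rewrite ge0_integralZr//; last exact: integral_ge0.
by rewrite big_ord_recl (ZE (fun k => f (lift ord0 k))).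
Qed.

(** The sum of m independent copies of rho has Laplace transform r^m, that of Y, hence the law of Y
    by uniqueness on [paths 'I_n R]. The factor c permits the final change of scale from psi/2 to
    psi. *)
Lemma infinitely_divisible_of_roots d (T : measurableType d) (R : realType)
    (Q : probability T R) (n : nat) (Y : 'I_n -> T -> R) (c : R) :
  (forall i, measurable_fun setT (Y i)) ->
  (forall i, Q [set w | Y i w < 0] = 0%E) ->
  (forall m, (0 < m)%N -> exists rho : probability (paths 'I_n R) R,
    (forall i, rho [set y : paths 'I_n R | y i < 0] = 0%E) /\
    forall s, nngs s -> exists2 r : R, (\int[rho]_y (lexp s y)%:E = r%:E)%E &
      (\int[Q]_w (lexp s (Y ^~ w))%:E = (r ^+ m)%:E)%E) ->
  infinitely_divisible_vector Q (fun i w => c * Y i w).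
Proof.
move=> mY Y0 roots m m0; have [rho [rho0 rhoL]] := roots m m0.
have [d1 [Om [P [Z [mZ ZE]]]]] := iid_copies rho m.
have mZi k i : measurable_fun setT (fun w => Z k w i).
  exact: (measurableT_comp (measurable_coord i) (mZ k)).
have mcZ k i : measurable_fun setT (fun w => c * Z k w i).
  by apply: measurable_funM => //; exact: measurable_cst.
pose V k i : {RV P >-> R} := HB.pack (fun w => c * Z k w i)
  (isMeasurableFun.Build _ _ _ _ _ (mcZ k i)).
exists d1, Om, P, V.
pose sc (y : 'I_n -> R) : n.-tuple R := vec (fun i => c * y i).
have msc : measurable_fun setT (fun y : paths 'I_n R => sc y).
  apply/measurable_fun_tnthP => i.
  rewrite (_ : _ \o _ = fun y : paths 'I_n R => c * y i); last first.
    by apply/funext => y /=; rewrite tnth_mktuple.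
  by apply: measurable_funM; [exact: measurable_cst|exact: measurable_coord].
have mpre (B : set (n.-tuple R)) : measurable B ->
    measurable [set y : paths 'I_n R | B (sc y)].
  by move=> mB; rewrite -[X in measurable X]setTI; exact: msc.
have joint (A : 'I_m -> set (paths 'I_n R)) : (forall k, measurable (A k)) ->
    P [set w | forall k, A k (Z k w)] = (\prod_(k < m) rho (A k))%E.
  move=> mA.
  have mE : measurable [set w | forall k, A k (Z k w)].
    rewrite (_ : [set w | _] = \bigcap_k (Z k @^-1` A k)); last first.
      by apply/seteqP; split => w /= h k; [move=> _; exact: h|exact: h].
    apply: fin_bigcap_measurable => // k _; rewrite -[X in measurable X]setTI.
    exact: mZ.
  transitivity (\int[P]_w (\1_[set w | forall k, A k (Z k w)] w)%:E)%E.
    by rewrite integral_indic// setIT.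
  transitivity (\int[P]_w (\prod_(k < m) (\1_(A k) (Z k w))%:E))%E.
    apply: eq_integral => w _; rewrite indicE prodEFin.
    case: (boolP (w \in _)) => [|/negP]; rewrite inE /= => hw.
      by rewrite big1// => k _; rewrite indicE mem_set.
    move/existsNP: hw => [k hk]; rewrite (bigD1 k)//= indicE memNset// mul0r//.
  rewrite (ZE (fun k t => (\1_(A k) t)%:E)).
  - by apply: eq_bigr => k _; rewrite integral_indic// setIT.
  - by move=> k; apply/measurable_EFinP; exact: measurable_indic.
  - by move=> k t; rewrite lee_fin.
have marg k (A : set (paths 'I_n R)) : measurable A -> P [set w | A (Z k w)] = rho A.
  move=> mA; pose A' (j : 'I_m) : set (paths 'I_n R) := if j == k then A else setT.
  have mA' j : measurable (A' j) by rewrite /A'; case: ifP.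
  rewrite (_ : [set w | _] = [set w | forall j, A' j (Z j w)]); last first.
    apply/seteqP; split => w /=; last by move/(_ k); rewrite /A' eqxx.
    by move=> Aw j; rewrite /A'; case: eqP => [->|].
  rewrite joint// (bigD1 k)//= /A' eqxx big1 ?mule1// => j /negbTE ->.
  exact: probability_setT.
have mYp : measurable_fun setT (fun w => (Y ^~ w : paths 'I_n R)).
  by apply: measurable_to_paths => i; exact: mY.
pose S w : paths 'I_n R := fun i => \sum_(k < m) Z k w i.
have mS : measurable_fun setT S.
  by apply: measurable_to_paths => i; apply: measurable_sum => k; exact: mZi.
have law A : measurable A -> image_measure Q mYp A = image_measure P mS A.
  have neg i := @measurable_neg_coord R 'I_n i.
  move=> mA; apply: (@laplace_unique _ _ _ 'I_n (image_measure Q mYp) (image_measure P mS)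
    (fun i y => y i)).
  - exact: paths_generated.
  - by rewrite (_ : image_measure _ _ _ = Q setT)// probability_setT ltry.
  - by rewrite (_ : image_measure _ _ _ = P setT)// probability_setT ltry.
  - exact: measurable_coord.
  - exact: Y0.
  - move=> i; have mSi : measurable (S @^-1` [set y | y i < 0]).
      by rewrite -[X in measurable X]setTI; exact: mS.
    change (P (S @^-1` [set y | y i < 0]) = 0%E); apply/negligibleP => //.
    suff hN : P.-negligible (\big[setU/set0]_(k < m) [set w | Z k w i < 0]).
      apply: negligibleS hN => w /= Sw; apply: contrapT => hw.
      move: Sw; rewrite ltNge => /negP; apply; apply: sumr_ge0 => k _.
      rewrite leNgt; apply/negP => Zk; apply: hw; rewrite -bigcup_seq.
      by exists k => //=; rewrite mem_index_enum.
    elim/big_ind : _ => [|A1 A2 h1 h2|k _]; first exact: negligible_set0.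
      exact: negligibleU.
    apply/negligibleP; last exact: (etrans (marg k _ (neg i)) (rho0 i)).
    have := mZi k i measurableT `]-oo, 0[%classic (measurable_itv _).
    by rewrite setTI; congr measurable; apply/seteqP; split => t /=; rewrite in_itv.
  - move=> s ns; have [r rE QE] := rhoL s ns.
    have ml : measurable_fun setT (fun y : paths 'I_n R => (lexp s y)%:E).
      by apply/measurable_EFinP; exact: (measurable_lexp _ measurable_coord).
    have l0 (y : paths 'I_n R) : (0 <= (lexp s y)%:E)%E by rewrite lee_fin lexp_ge0.
    transitivity (\int[Q]_w (lexp s (Y ^~ w))%:E)%E.
      exact: (@ge0_integral_pushforward _ _ _ _ R _ mYp Q setT (fun y => (lexp s y)%:E)).
    rewrite QE; transitivity (\int[P]_w (lexp s (S w))%:E)%E; last first.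
      by apply/esym; exact: (@ge0_integral_pushforward _ _ _ _ R _ mS P setT (fun y => (lexp s y)%:E)).
    have SE w : ((lexp s (S w))%:E = \prod_(k < m) (lexp s (Z k w))%:E)%E.
      rewrite prodEFin; congr EFin; rewrite /lexp -(big_morph expR (@expRD R) (expR0 R)).
      congr expR; rewrite sumrN; congr (- _); rewrite /lsum exchange_big/=.
      by apply: eq_bigr => c' _; rewrite mulr_sumr.
    under eq_integral do rewrite SE.
    rewrite (ZE (fun k y => (lexp s y)%:E))//.
    by rewrite rE prodEFin prodr_const card_ord.
  - exact: mA.
split.
- move=> B mB; rewrite (joint (fun k => [set y : paths 'I_n R | B k (sc y)])).
    by apply: eq_bigr => k _; rewrite -(marg k)//; exact: mpre.
  by move=> k; exact: mpre.
- by move=> k l B mB; rewrite !(marg _ [set y : paths 'I_n R | B (sc y)])//; exact: mpre.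
- move=> B mB; have := law _ (mpre _ mB).
  rewrite /image_measure/= /pushforward /= => h.
  rewrite (_ : [set w | B (vec (fun i => c * Y i w))] =
    (fun w => (Y ^~ w : paths 'I_n R)) @^-1` [set y | B (sc y)])// h.
  have vE w : sc (S w) = vec (fun i => \sum_(k < m) c * Z k w i).
    by congr (vec _); apply/funext => i; rewrite mulr_sumr.
  by congr (P _); apply/seteqP; split => w; rewrite /= vE.
Qed.

(** * Infinite divisibility of the finite-dimensional marginals *)

Section infinite_divisibility.
Context {R : realType} {E : Type} {d' : measure_display}.
Context {Omega' : measurableType d'}.
Variables (Q : probability Omega' R) (Y : E -> Omega' -> R).
Variable mu : E -> {finite_measure set (paths E R) -> \bar R}.
Hypothesis resm_lty : forall s a, nngs s -> (\int[mu a]_y (lexp s y)%:E < +oo)%E.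
Hypothesis mu_neg : forall a x, mu a [set y : paths E R | y x < 0] = 0%E.
Hypothesis mu_pos : forall a, mu a (~` [set y : paths E R | 0 < y a]) = 0%E.
Hypothesis resm_cons : forall s a t, nngs s -> 0 <= t ->
  resm mu s a = resm mu ((t, a) :: s) a * (1 + t * resm mu s a).
Hypothesis mY : forall x, measurable_fun setT (Y x).
Hypothesis Y_neg : forall x, Q [set w | Y x w < 0] = 0%E.
Hypothesis laplace_Y : forall s, nngs s ->
  (\int[Q]_w (lexp s (Y ^~ w))%:E = (detm mu s `^ (- 2^-1))%:E)%E.

Section marginal.
Variables (n : nat) (x : 'I_n -> E).

Let restr (y : paths E R) : paths 'I_n R := fun i => y (x i).

Let measurable_restr : measurable_fun setT restr.
Proof. by apply: measurable_to_paths => i; exact: measurable_coord. Qed.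

Let img_lty i : (image_measure (mu (x i)) measurable_restr setT < +oo)%E.
Proof.
rewrite /image_measure/= /pushforward preimage_setT.
have := @resm_lty [::] (x i) isT; under eq_integral do rewrite lexp_nil.
by rewrite integral_cst// mul1e.
Qed.

(** The family moved to the index set of a marginal, which is finite and has decidable equality as
    [fractional_law] requires; x need not be injective. *)
Let mux i := finite_meas (img_lty i).

Let lift_seq (s : seq (R * 'I_n)) : seq (R * E) := [seq (c.1, x c.2) | c <- s].

Let nngs_lift s : nngs s -> nngs (lift_seq s).
Proof. by rewrite /nngs /lift_seq all_map; apply: sub_all. Qed.

Let lsum_lift s (y : E -> R) : lsum (lift_seq s) y = lsum s (fun i => y (x i)).
Proof. by rewrite /lsum /lift_seq big_map. Qed.

Let integral_mux s i : (\int[mux i]_y (lexp s y)%:E =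
  \int[mu (x i)]_y (lexp (lift_seq s) y)%:E)%E.
Proof.
transitivity (\int[image_measure (mu (x i)) measurable_restr]_y (lexp s y)%:E)%E; first by [].
rewrite (@ge0_integral_pushforward _ _ _ _ R _ measurable_restr (mu (x i)) setT (fun y => (lexp s y)%:E)) //.
- by apply: eq_integral => y _; rewrite /lexp lsum_lift.
- by apply/measurable_EFinP; exact: (measurable_lexp _ measurable_coord).
- by move=> y _; rewrite lee_fin lexp_ge0.
Qed.

Let resm_mux s i : resm mux s i = resm mu (lift_seq s) (x i).
Proof. by rewrite /resm integral_mux. Qed.

Let detm_mux s : detm mux s = detm mu (lift_seq s).
Proof. by elim: s => [//|c s IH] /=; rewrite IH resm_mux. Qed.

Let mux_family : green_family mux.
Proof.
split.
- by move=> s i ns; rewrite integral_mux; apply: resm_lty; exact: nngs_lift.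
- by move=> i j; exact: mu_neg.
- by move=> i; exact: mu_pos.
- move=> s i t ns t0; rewrite !resm_mux; apply: resm_cons => //; exact: nngs_lift.
- move=> s s' ns ns' ss'; rewrite !detm_mux.
  apply: (@detm_lsum R E d' Omega' Q Y mu) => //; do ?exact: nngs_lift.
  by move=> y; rewrite !lsum_lift.
Qed.

Lemma marginal_infinitely_divisible (c : R) :
  infinitely_divisible_vector Q (fun i w => c * Y (x i) w).
Proof.
apply: (@infinitely_divisible_of_roots _ _ R Q n (fun i => Y (x i))) => //.
(* With k = 1/(2m), the m-th power of the root is the power -1/2 of the determinant. *)
move=> m m0; pose k : R := 2^-1 / m%:R.
have mR : 0 < m%:R :> R by rewrite ltr0n.
have k0 : 0 < k by rewrite divr_gt0.
have k2 : k <= 2^-1 by rewrite ler_pdivrMr// ler_peMr// ler1n.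
have [|rho [rn rl]] := @fractional_law R _ k mux (enum 'I_n) k0 k2 mux_family.
  by move=> i; rewrite mem_enum.
exists rho; split => // s ns; exists (detm mux s `^ (- k)); first exact: rl.
transitivity (\int[Q]_w (lexp (lift_seq s) (Y ^~ w))%:E)%E.
  by apply: eq_integral => w _; rewrite /lexp lsum_lift.
rewrite laplace_Y ?nngs_lift// -detm_mux; congr EFin.
rewrite -powR_mulrn ?powR_ge0// -powRrM; congr (_ `^ _).
by rewrite /k mulNr divfK// gt_eqF.
Qed.

End marginal.

End infinite_divisibility.

(** * Local times of the Markov process *)

Section permanental.
Context {R : realType} {d dE : measure_display}.
Context {Omega : measurableType d} {E : measurableType dE}.
Variables (P : E -> probability Omega R) (X : R -> Omega -> option E).
Variables (theta : R -> Omega -> Omega) (L : E -> R -> Omega -> R).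
Hypothesis MP : markov_process P X theta.
Hypothesis LT : forall x, local_time P X theta x (L x).
Hypothesis TR : transient P L.

Local Notation leb := (@lebR R).

Let hgen (t : R) : set (set Omega) :=
  [set A | exists s B, [/\ 0 <= s <= t, measurable B & A = visits X s B]].
Let hgeny : set (set Omega) :=
  [set A | exists s B, [/\ 0 <= s, measurable B & A = visits X s B]].

(** Omega as a measurable type for the past of t, and next for the whole history: adaptedness
    becomes measurability, to which composition lemmas apply. *)
Let Omt (t : R) := g_sigma_algebraType (hgen t).
Let Omy := g_sigma_algebraType hgeny.

Let clockL x w : clock (L x ^~ w).
Proof.
split; first exact: lt_start (LT x) w.
  by move=> s t; exact: (lt_nondecreasing (LT x)).
exact: (lt_continuous (LT x)).
Qed.

Let history_mono s t A : s <= t -> history X s A -> history X t A.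
Proof.
move=> st; apply: sub_sigma_algebra2 => _ [r [B [/andP[r0 rs] mB ->]]].
by exists r, B; rewrite r0 (le_trans rs st).
Qed.

Let history_le t A : history X t A -> history_infty X A.
Proof.
apply: sub_sigma_algebra2 => _ [r [B [/andP[r0 rs] mB ->]]].
by exists r, B.
Qed.

Let measurable_history A : history_infty X A -> measurable A.
Proof.
apply: smallest_sub; first exact: sigma_algebra_measurable.
by move=> _ [s [B [s0 mB ->]]]; exact: (mp_measurable MP).
Qed.

Let measurable_toOmy : measurable_fun setT (fun w : Omega => w : Omy).
Proof. by move=> _ A mA; rewrite setTI; exact: measurable_history. Qed.

Let measurableLt x s t : 0 <= s -> s <= t ->
  measurable_fun (setT : set (Omt t)) (L x s : Omt t -> R).
Proof.
move=> s0 st _ B mB; rewrite setTI; apply: (history_mono st).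
exact: (lt_adapted (LT x)).
Qed.

Let measurableLy x s : 0 <= s -> measurable_fun (setT : set Omy) (L x s : Omy -> R).
Proof.
move=> s0 _ B mB; rewrite setTI; apply: (@history_le s).
exact: (lt_adapted (LT x)).
Qed.

(** Progressive measurability, used on [0, k] for each k, is the source of joint measurability in
    path and time. *)
Let measurable_visits (B : set E) : measurable B ->
  measurable [set p : Omy * R | 0 <= p.2 /\ visits X p.2 B p.1].
Proof.
move=> mB.
rewrite (_ : [set p | _] = \bigcup_k
    [set p : Omy * R | 0 <= p.2 <= k%:R /\ visits X p.2 B p.1]); last first.
  apply/seteqP; split => [p /= [p0 vp]|p [k _ /= [/andP[p0 _] vp]]//].
  by exists (Num.truncn p.2).+1 => //=; rewrite p0 ltW// truncnS_gt.
apply: bigcupT_measurable => k.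
have := mp_progressive MP (ler0n R k) mB.
set G := (G in <<s G >> _) => GV.
have msw : measurable_fun (setT : set (Omy * R))
    (fun p => (p.2, p.1) : g_sigma_algebraType G).
  apply: (measurability _ (erefl : @measurable _ (g_sigma_algebraType G) = <<s G >>)).
  move=> _ [_ [I [A [mI hA ->]] <-]].
  rewrite setTI (_ : _ @^-1` _ = (A : set Omy) `*` I).
    by apply: measurableX => //; exact: (history_le hA).
  by apply/seteqP; split => [[w t] []|[w t] []].
by have := msw measurableT _ GV; rewrite setTI.
Qed.

(** The pairs of a path and a positive level that L^b reaches. Lebesgue measure in the level turns
    integrals against dL^b_t into integrals over inverse times. *)
Definition occ (b : E) : set (Omega * R) :=
  [set p | 0 < p.2 /\ reached (L b ^~ p.1) p.2].

Definition invl (b : E) (p : Omega * R) : R := hit (L b ^~ p.1) p.2.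

(* local times stopped at the inverse local time of b *)
Definition stopL (b : E) (p : Omega * R) (x : E) : R :=
  if `[< occ b p >] then L x (invl b p) p.1 else 0.

Let measurable_occ b : measurable (occ b : set (Omy * R)).
Proof.
rewrite (_ : occ b = [set p : Omy * R | 0 < p.2] `&`
    \bigcup_k [set p : Omy * R | p.2 <= L b k%:R p.1]).
  apply: measurableI.
    have := @measurable_snd _ _ Omy R measurableT `]0, +oo[%classic (measurable_itv _).
    by rewrite setTI; congr measurable; apply/seteqP; split => p /=; rewrite in_itv/= andbT.
  apply: bigcupT_measurable => k.
  rewrite -[X in measurable X]setTI; apply: measurable_fun_le => //.
  exact: measurableT_comp (measurableLy _ _) _.
apply/seteqP; split => [p [p0 /(reached_nat _ (clockL _ _))[k pk]]|p [p0 [k _ pk]]].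
  by split => //; exists k.
by split => //; apply/(reached_nat _ (clockL _ _)); exists k.
Qed.

Let measurable_stopped b (A : R -> Omega -> R) : (forall w, clock (A ^~ w)) ->
  (forall t, 0 <= t -> measurable_fun (setT : set Omy) (A t : Omy -> R)) ->
  measurable_fun (setT : set (Omy * R))
    (fun p => if `[< occ b p >] then A (invl b p) p.1 else 0).
Proof.
move=> cA mA; apply: (measurability _ (RGenInftyO.measurableE R)) => _ [_ [r ->] <-].
rewrite setTI.
rewrite (_ : _ @^-1` _ = (occ b `&` \bigcup_(q : rat) [set p : Omy * R |
      [/\ 0 <= ratr q :> R, p.2 <= L b (ratr q) p.1 & A (ratr q) p.1 < r]]) `|`
    (~` occ b `&` [set p : Omy * R | 0 < r])).
  apply: measurableU; apply: measurableI => //.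
  - apply: bigcupT_measurable_rat => q.
    have [q0|q0] := leP 0 (ratr q : R); last first.
      by rewrite (_ : [set p | _] = set0)//; apply/seteqP; split => // p [].
    rewrite (_ : [set p | _] = [set p : Omy * R | p.2 <= L b (ratr q) p.1] `&`
      [set p : Omy * R | A (ratr q) p.1 < r]); last first.
      by apply/seteqP; split => [p []|p []].
    apply: measurableI; rewrite -[X in measurable X]setTI.
      apply: measurable_fun_le => //.
      exact: measurableT_comp (measurableLy _ _) _.
    rewrite (_ : [set p | _] = (A (ratr q) \o fst) @^-1` `]-oo, r[).
      by apply: (measurableT_comp (mA _ q0) (@measurable_fst _ _ Omy R)) => //.
    by apply/seteqP; split => p /=; rewrite in_itv.
  - exact: measurableC.
  - by have [r0|r0] := ltP 0 r; [rewrite (_ : [set p | _] = setT)|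
      rewrite (_ : [set p | _] = set0)] => //; apply/seteqP; split.
apply/seteqP; split => p /=; rewrite in_itv/=.
  case: asboolP => op pr; last by right.
  left; split => //.
  have [q [q0 uq gq]] := (clock_lt_rat p.2 r (clockL b p.1) (cA p.1)).1 (conj op.2 pr).
  by exists q.
case: asboolP => op [[op' [q _ h]]|[nop r0]]//.
by have [] := (clock_lt_rat p.2 r (clockL b p.1) (cA p.1)).2 (ex_intro _ q h).
Qed.

Let measurable_stopL b x : measurable_fun (setT : set (Omy * R)) (stopL b ^~ x).
Proof.
apply: measurable_stopped => [w|t t0]; [exact: clockL|exact: measurableLy].
Qed.

Let measurable_invl b : measurable_fun (setT : set (Omy * R))
  (fun p => if `[< occ b p >] then invl b p else 0).
Proof.
apply: (@measurable_stopped b (fun t _ => t)) => [w|t t0].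
  exact: clock_id.
exact: measurable_cst.
Qed.

(** Off [occ b] the value is a measurable default; [shiftl] is always paired with the indicator of
    [occ b]. *)
Let shiftl b (p : Omega * R) : Omega :=
  if `[< occ b p >] then theta (invl b p) p.1 else p.1.

Let measurable_visits_invl b s (B : set E) : 0 <= s -> measurable B ->
  measurable ([set p : Omy * R | occ b p /\ visits X (s + invl b p) B p.1]).
Proof.
move=> s0 mB.
have mV := measurable_visits mB.
have mf : measurable_fun (setT : set (Omy * R))
    (fun p => (p.1, s + (if `[< occ b p >] then invl b p else 0)) : Omy * R).
  apply/measurable_fun_pairP; split => /=; first exact: measurable_fst.
  by apply: measurable_funD => //; exact: measurable_cst.
have := mf measurableT _ mV; rewrite setTI => mW.
rewrite (_ : [set p | _] = occ b `&` (fun p : Omy * R => (p.1, s + (if `[< occ b p >] then invl b p else 0)) : Omy * R)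
    @^-1` [set p | 0 <= p.2 /\ visits X p.2 B p.1]).
  exact: measurableI.
apply/seteqP; split => [p [op vp]|p [op [_ vp]]]; move: vp => /=; rewrite asboolT// => vp; split => //.
split => //; rewrite addr_ge0//; exact: (hit_ge0 op.2).
Qed.

Let measurable_shiftl b : measurable_fun (setT : set (Omy * R)) (shiftl b : _ -> Omy).
Proof.
apply: (measurability _ (erefl : @measurable _ Omy = <<s hgeny >>)).
move=> _ [_ [s [B [s0 mB ->]]] <-]; rewrite setTI.
rewrite (_ : _ @^-1` _ = [set p : Omy * R | occ b p /\ visits X (s + invl b p) B p.1] `|`
    (~` occ b `&` (fst @^-1` (visits X s B : set Omy)))).
  apply: measurableU; first exact: measurable_visits_invl.
  apply: measurableI; first exact: measurableC.
  rewrite -[X in measurable X]setTI; apply: measurable_fst => //.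
  by apply: sub_sigma_algebra; exists s, B.
have XE p : occ b p -> X s (theta (invl b p) p.1) = X (s + invl b p) p.1.
  by move=> op; rewrite (mp_shift MP)//; exact: (hit_ge0 op.2).
apply/seteqP; split => p; rewrite /shiftl /visits /=.
  by case: asboolP => op; [rewrite XE//; left|right].
by case: asboolP => op [[? ?]|[? ?]]//; rewrite XE.
Qed.

(** * The strong Markov property at inverse local times *)

Let m x : {measure set (Omega * R) -> \bar R} := (P x \x leb)%E.

Let measurable_toOmyR : measurable_fun setT (fun p : Omega * R => p : Omy * R).
Proof.
rewrite (_ : (fun p => p) = fun p : Omega * R => (p.1 : Omy, p.2)); last first.
  by apply/funext => -[].
apply: measurable_fun_pair => //.
exact: (measurableT_comp measurable_toOmy measurable_fst).
Qed.

Let measurableOR (A : set (Omy * R)) : measurable A -> measurable (A : set (Omega * R)).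
Proof. by move=> mA; have := measurable_toOmyR measurableT mA; rewrite setTI. Qed.

Let m_ysection x (A : set (Omega * R)) : measurable A ->
  (m x A = \int[leb]_u P x (ysection A u))%E.
Proof.
move=> mA; apply: (@product_measure_unique _ _ _ _ R (P x) leb (P x \x^ leb)%E _ A mA).
by move=> B C mB mC; exact: product_measure2E.
Qed.

Let m_xsection x (A : set (Omega * R)) :
  (m x A = \int[P x]_w leb (xsection A w))%E.
Proof. by []. Qed.

Let occ_invl b p : occ b p -> 0 < invl b p.
Proof.
move=> [p0 rp]; rewrite /invl lt_hitP//.
by rewrite (lt_start (LT b)).
Qed.

(** The map u -> tau_u sends Lebesgue measure to the Stieltjes measure dL^b, since s < tau_u <= t
    exactly when L^b_s < u <= L^b_t. The values of mu are prescribed on positive times only, hence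
    the intersection. *)
Let inverse_time_image b w (mu : {measure set R -> \bar R}) :
  (forall s t, 0 <= s -> s <= t -> mu `]s, t]%classic = (L b t w - L b s w)%:E) ->
  forall Z : set R, measurable Z ->
  leb [set u | occ b (w, u) /\ Z (invl b (w, u))] = mu (Z `&` `]0, +oo[).
Proof.
move=> muE Z mZ.
have mocc : measurable [set u | occ b (w, u)].
  have := @measurable_xsection _ _ Omy R _ w (measurable_occ b); rewrite xsectionE.
  exact.
have minv : measurable_fun (setT : set R) (fun u : R => if `[< occ b (w, u) >] then invl b (w, u) else 0).
  have mpair : measurable_fun (setT : set R) (fun u : R => (w, u) : Omy * R).
    by apply: measurable_fun_pair => //; exact: measurable_cst.
  exact: (measurableT_comp (measurable_invl b) mpair).
have mpre A : measurable A -> measurable ((fun u : R =>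
    if `[< occ b (w, u) >] then invl b (w, u) else 0) @^-1` A).
  by move=> mA; have := minv measurableT A mA; rewrite setTI.
have i0 u : 0 <= \1_[set u | occ b (w, u)] u :> R by rewrite indicE.
pose m1 := wpush leb i0 (measurable_indic mocc) minv.
have mp : measurable (`]0, +oo[%classic : set R) by exact: measurable_itv.
pose m2 : {measure set R -> \bar R} := mrestr mu mp.
have m1E A : measurable A -> m1 A = leb [set u | occ b (w, u) /\ A (invl b (w, u))].
  move=> mA.
  have mA' : measurable [set u | occ b (w, u) /\ A (invl b (w, u))].
    rewrite (_ : [set u | _] = [set u | occ b (w, u)] `&`
      (fun u : R => if `[< occ b (w, u) >] then invl b (w, u) else 0) @^-1` A).
      by apply: measurableI => //; exact: mpre.
    by apply/seteqP; split => u /= [ou]; rewrite asboolT.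
  rewrite /m1 wpushE -[X in _ = leb X]setIT -integral_indic//.
  apply: eq_integral => u _; rewrite -EFinM !indicE -natrM mulnb; congr ((nat_of_bool _)%:R%:E).
  apply/idP/idP; rewrite !inE/=.
    by move=> /andP[]; rewrite !inE/= => ou; rewrite asboolT.
  by move=> [ou Au]; rewrite !mem_set//= asboolT.
have oc0 (s t : R) : 0 <= s -> s <= t -> m1 `]s, t]%classic = (L b t w - L b s w)%:E.
  move=> s0 st; rewrite m1E//.
  have cb := clockL b w; have t0 := le_trans s0 st.
  rewrite -lebR_itvoc; last by case: cb => _ + _; apply.
  congr (leb _); apply/seteqP; split => u /=; rewrite !in_itv/=.
    by move=> [[u0 ru]]; rewrite /invl lt_hitP// hit_leP.
  move=> /andP[su ut]; have ru : reached (L b ^~ w) u by exists t.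
  by rewrite /invl lt_hitP// hit_leP// su ut; split => //; split => //;
    rewrite (le_lt_trans (clock_ge0 cb s0)).
rewrite -m1E// -[RHS]/(m2 Z).
have posit (A : set R) : measurable A -> m1 A = m1 (A `&` `]0, +oo[%classic).
  move=> mA; rewrite !m1E//; last exact: measurableI.
  congr (leb _); apply/seteqP; split => u /= [ou]; last by move=> [].
  by rewrite in_itv/= occ_invl.
have itvI (s t : R) : `]s, t]%classic `&` `]0, +oo[%classic = `]Num.max 0 s, t]%classic.
  apply/seteqP; split => u /=; rewrite !in_itv/= andbT gt_max.
    by move=> [/andP[-> ->] ->].
  by move=> /andP[/andP[-> ->] ->].
apply: measure_unique_oc => //.
  move=> k; rewrite posit; last exact: measurable_itv.
  by rewrite itvI max_l ?oppr_le0// oc0// ltry.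
move=> s t st; rewrite posit; last exact: measurable_itv.
rewrite -[RHS]/(mu (`]s, t]%classic `&` `]0, +oo[%classic)) !itvI.
have [h|h] := leP (Num.max 0 s) t; last first.
  by rewrite set_itv_ge ?measure0// -leNgt bnd_simp ltW.
by rewrite muE ?le_max ?lexx// oc0// le_max lexx.
Qed.

Let measurable_at_state (f : E -> \bar R) : measurable_fun setT f ->
  measurable_fun (setT : set (Omy * R))
    (fun p => if 0 <= p.2 then at_state 0%E f (X p.2 p.1) else 0%E).
Proof.
move=> mf _ B mB; rewrite setTI.
have mVB := measurable_visits (mf measurableT B mB); rewrite setTI in mVB.
have mV := measurable_visits (@measurableT _ E).
have [B0|B0] := pselect (B 0%E).
  rewrite (_ : _ @^-1` B = [set p : Omy * R | 0 <= p.2 /\ visits X p.2 (f @^-1` B) p.1] `|`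
     ~` [set p : Omy * R | 0 <= p.2 /\ visits X p.2 setT p.1]).
    by apply: measurableU => //; exact: measurableC.
  apply/seteqP; split => [[w t]|[w t]] /=; rewrite /visits/=.
    case: ifP => t0; last by move=> _; right; case.
    case: (X t w) => [z|] /= h; first by left; split => //; exists z.
    by right => -[_ [? _]].
  case: ifP => t0 // [[_ [z zB <-]]//|h].
  by case XE : (X t w) => [z|//]; exfalso; apply: h; split => //; rewrite XE; exists z.
rewrite (_ : _ @^-1` B = [set p : Omy * R | 0 <= p.2 /\ visits X p.2 (f @^-1` B) p.1])//.
apply/seteqP; split => [[w t]|[w t]] /=; rewrite /visits/=.
  by case: ifP => // t0; case: (X t w) => [z|]//= h; split => //; exists z.
by move=> [-> [z zB <-]].
Qed.

Let measurable_not_visits b (K : set E) : measurable K ->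
  @measurable _ (Omy * R)%type [set p | occ b p /\ ~ visits X (invl b p) K p.1].
Proof.
move=> mK.
rewrite (_ : [set p | _] = occ b `\`
    [set p : Omy * R | occ b p /\ visits X (0 + invl b p) K p.1]).
  by apply: measurableD => //; exact: measurable_visits_invl.
apply/seteqP; split => p /= [op h]; rewrite ?add0r; split => //.
  by move=> [].
by move=> v; apply: h; rewrite add0r.
Qed.

(** Stated for measurable K containing b because {b} itself need not be measurable. Path by path,
    the levels with X at tau_u different from b lie in the preimage of a set negligible for dL^b. *)
Let local_time_carried b x (K : set E) : measurable K -> K b ->
  m x [set p | occ b p /\ ~ visits X (invl b p) K p.1] = 0%E.
Proof.
move=> mK Kb.
have mN := @measurable_not_visits b K mK.
rewrite m_xsection; apply/eqP; rewrite -[X in _ == X](@integral0 _ _ _ (P x) setT).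
apply/eqP/ge0_ae_eq_integral => //.
  apply: measurable_fun_xsection; exact: measurableOR.
have := lt_carried (LT b) x; apply: filterS => w [mu [muE [Z [mZ Z0 NZ]]]] _ /=.
have mid : measurable_fun setT (fun x : measurableTypeR R => x : R) by [].
have lebZ : leb [set u | occ b (w, u) /\ (Z : set R) (invl b (w, u))] = 0%E.
  rewrite (@inverse_time_image b w (image_measure mu mid))//.
  apply: (subset_measure0 _ mZ) => //; last by move=> ? [].
  by apply: measurableI => //; exact: measurable_itv.
apply: (subset_measure0 _ _ _ lebZ).
- by apply: measurable_xsection; exact: measurableOR.
- have minv : measurable_fun (setT : set R)
      (fun u : R => if `[< occ b (w, u) >] then invl b (w, u) else 0).
    have mpair : measurable_fun (setT : set R) (fun u : R => (w, u) : Omy * R).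
      by apply: measurable_fun_pair => //; exact: measurable_cst.
    exact: (measurableT_comp (measurable_invl b) mpair).
  rewrite (_ : [set u | _] = [set u | occ b (w, u)] `&`
      (fun u : R => if `[< occ b (w, u) >] then invl b (w, u) else 0) @^-1` Z).
    apply: measurableI.
      have := @measurable_xsection _ _ Omy R _ w (measurable_occ b); rewrite xsectionE.
      exact.
    by rewrite -[X in measurable X]setTI; exact: minv.
  by apply/seteqP; split => u /= [ou]; rewrite asboolT.
- move=> u; rewrite xsectionE => -[/= ou nv]; split => //.
  apply: NZ; split; first exact: occ_invl.
  by move=> Xb; apply: nv; rewrite /visits/= Xb; exists b.
Qed.

(** The stopping time is tau_u at a fixed level, +oo when the level is not reached. The point to
    check is that <s, L> at tau_u belongs to the past of tau_u. *)
Let strong_markov_invl b x (u : R) s (B : set R) C : nngs s -> measurable B ->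
  history_infty X C ->
  P x [set w | [/\ occ b (w, u), B (lsum s (stopL b (w, u))),
    visits X (invl b (w, u)) setT w & C (theta (invl b (w, u)) w)]] =
  (\int[P x]_(w in [set w | occ b (w, u) /\ B (lsum s (stopL b (w, u)))])
    at_state 0 (fun z => P z C) (X (invl b (w, u)) w))%E.
Proof.
move=> ns mB hC.
have [u0|u0] := ltP 0 u; last first.
  rewrite (_ : [set w | _] = set0) ?measure0; last first.
    by apply/seteqP; split => w //= [[/=]]; rewrite ltNge u0.
  rewrite (_ : [set w | _] = set0) ?integral_set0//.
  by apply/seteqP; split => w //= [[/=]]; rewrite ltNge u0.
pose T w : \bar R := if `[< reached (L b ^~ w) u >] then (hit (L b ^~ w) u)%:E else +oo%E.
have T_le t w : 0 <= t -> ((T w <= t%:E)%E = (u <= L b t w)).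
  move=> t0; rewrite /T; case: asboolP => ru; first by rewrite lee_fin hit_leP.
  by rewrite leye_eq/=; apply/esym/negbTE; apply/negP => ut; apply: ru; exists t.
pose A := [set w | occ b (w, u) /\ B (lsum s (stopL b (w, u)))].
have mpair : measurable_fun (setT : set Omy) (fun w : Omy => (w, u) : Omy * R).
  by apply: measurable_fun_pair => //; exact: measurable_cst.
have mst : measurable_fun (setT : set (Omy * R)) (fun p => lsum s (stopL b p)).
  exact: (@measurable_lsum _ (Omy * R)%type R E s (fun x p => stopL b p x) (fun x => measurable_stopL b x)).
have hA : history_infty X A.
  have mA : @measurable _ (Omy * R)%type (occ b `&` (fun p : Omy * R => lsum s (stopL b p)) @^-1` B).
    by apply: measurableI => //; rewrite -[X in measurable X]setTI; exact: mst.
  by have := mpair measurableT _ mA; rewrite setTI.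
have sT : stopping_time X T.
  split=> [w|t t0].
    by rewrite /T; case: asboolP => // ru; rewrite lee_fin hit_ge0.
  rewrite (_ : [set w | _] = L b t @^-1` `[u, +oo[%classic).
    exact: (lt_adapted (LT b)).
  by apply/seteqP; split => w /=; rewrite in_itv/= andbT T_le.
have hAT : history_at X T A.
  split => // t t0.
  (* On {tau_u <= t} this is <s, L> at tau_u. It is measurable for the past of t because
     [clock_lt_rat_le] involves times up to t only. *)
  pose phi (w : Omt t) : R := if u <= L b t w then
    lsum s (fun y => L y (hit (L b ^~ w) u) w) else 0.
  have mphi : measurable_fun (setT : set (Omt t)) phi.
    apply: (measurability _ (RGenInftyO.measurableE R)) => _ [_ [r ->] <-].
    rewrite setTI.
    have mlt q : 0 <= q <= t -> (@measurable _ (Omt t)) [set w | lsum s (fun y => L y q w) < r].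
      move=> /andP[q0 qt].
      have := @measurable_lsum _ (Omt t) R E s (fun y w => L y q w)
        (fun y => measurableLt y q0 qt) measurableT `]-oo, r[%classic (measurable_itv _).
      by rewrite setTI; congr measurable; apply/seteqP; split => w /=; rewrite in_itv.
    have mge q : 0 <= q <= t -> (@measurable _ (Omt t)) [set w | u <= L b q w].
      move=> /andP[q0 qt].
      have := @measurableLt b q t q0 qt measurableT `[u, +oo[%classic (measurable_itv _).
      by rewrite setTI; congr measurable; apply/seteqP; split => w /=; rewrite in_itv/= andbT.
    have tt : 0 <= t <= t by rewrite t0 lexx.
    rewrite (_ : _ @^-1` _ = ([set w : Omt t | u <= L b t w] `&`
        ([set w : Omt t | lsum s (fun y => L y t w) < r] `|`
         \bigcup_(q : rat) [set w : Omt t | 0 <= (ratr q : R) <= t /\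
           (u <= L b (ratr q) w /\ lsum s (fun y => L y (ratr q) w) < r)])) `|`
      (~` [set w : Omt t | u <= L b t w] `&` [set w : Omt t | 0 < r])).
      apply: measurableU; apply: measurableI.
      - exact: mge.
      - apply: measurableU; first exact: mlt.
        apply: bigcupT_measurable_rat => q.
        have [qt|qt] := boolP (0 <= (ratr q : R) <= t); last first.
          by rewrite (_ : [set w | _] = set0)//; apply/seteqP; split => // w [].
        rewrite (_ : [set w | _] = [set w : Omt t | u <= L b (ratr q) w] `&`
          [set w : Omt t | lsum s (fun y => L y (ratr q) w) < r]).
          by apply: measurableI; [exact: mge|exact: mlt].
        by apply/seteqP; split => w [].
      - by apply: measurableC; exact: mge.
      - by have [r0|r0] := ltP 0 r; [rewrite (_ : [set w | _] = setT)|
          rewrite (_ : [set w | _] = set0)] => //; apply/seteqP; split.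
    have cls w := @clock_lsum R E s (fun y t => L y t w) ns (fun y => clockL y w).
    apply/seteqP; split => w /=; rewrite in_itv/= /phi.
      case: ifP => ut; last by right; split => //; rewrite ut.
      move=> /(clock_lt_rat_le r (clockL b w) (cls w) t0 ut)[h|[q [qt uq hq]]]; left; split => //.
        by left.
      by right; exists q.
    move=> [[ut h]|[/negP ut r0]]; last by rewrite (negbTE ut).
    rewrite ut; apply/(clock_lt_rat_le r (clockL b w) (cls w) t0 ut).
    by case: h => [h|[q _ [qt [uq hq]]]]; [left|right; exists q].
  rewrite (_ : A `&` _ = (phi @^-1` B) `&` (L b t @^-1` `[u, +oo[%classic)).
    apply: (@measurableI _ (Omt t)).
      by rewrite -[X in measurable X]setTI; exact: mphi.
    exact: (lt_adapted (LT b)).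
  apply/seteqP; split => w /=; rewrite in_itv/= andbT T_le// /phi.
    move=> [[ow Bw] ->]; split => //.
    by move: Bw; rewrite /lsum; congr B; apply: eq_bigr => c _; rewrite /stopL asboolT.
  move=> [+ ut]; rewrite ut => Bw; split => //.
  have ow : occ b (w, u) by split => //; exists t.
  split => //; move: Bw; rewrite /lsum; congr B; apply: eq_bigr => c _.
  by rewrite /stopL asboolT.
have ToE w : occ b (w, u) -> T w = (invl b (w, u))%:E.
  by move=> [_ ru]; rewrite /T asboolT.
have := mp_strong_markov MP x sT hAT hC.
rewrite (_ : A `&` _ = [set w | [/\ occ b (w, u), B (lsum s (stopL b (w, u))),
    visits X (invl b (w, u)) setT w & C (theta (invl b (w, u)) w)]]); last first.
  apply/seteqP; split => w /=.
    by move=> [[ow Bw]]; rewrite ToE// => -[].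
  by move=> [ow Bw ? ?]; split => //; rewrite ToE//; split => //; rewrite ltry.
move=> ->; rewrite (_ : A `&` _ = A); last first.
  by apply/seteqP; split => w /=; [case|move=> Aw; split => //; rewrite ToE ?ltry//; case: Aw].
by apply: eq_integral => w; rewrite inE => -[ow _]; rewrite ToE.
Qed.

(** For almost every pair of path and level, P_z(C) at the position z of X at tau_u can be replaced
    by P_b(C), which turns the strong Markov property into a product. *)
Let markov_sets b x s (B : set R) C : nngs s -> measurable B -> history_infty X C ->
  (m x [set p | [/\ occ b p, B (lsum s (stopL b p)) & C (shiftl b p)]] =
   m x [set p | occ b p /\ B (lsum s (stopL b p))] * P b C)%E.
Proof.
move=> ns mB hC.
have mst : measurable_fun (setT : set (Omy * R)) (fun p => lsum s (stopL b p)).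
  exact: (@measurable_lsum _ (Omy * R)%type R E s (fun x p => stopL b p x) (fun x => measurable_stopL b x)).
have mOB : @measurable _ (Omy * R)%type [set p | occ b p /\ B (lsum s (stopL b p))].
  rewrite (_ : [set p | _] = occ b `&` (fun p => lsum s (stopL b p)) @^-1` B)//.
  by apply: measurableI => //; rewrite -[X in measurable X]setTI; exact: mst.
have mC : @measurable _ (Omy * R)%type ((shiftl b : _ -> Omy) @^-1` C).
  by have := @measurable_shiftl b measurableT C hC; rewrite setTI.
(* K is measurable by [mp_kernel] and contains b, which is all that [local_time_carried] asks. Being
   in K also means that the path is alive at tau_u. *)
pose K := [set z | P z C = P b C].
have mK : measurable K.
  have := mp_kernel MP hC measurableT (emeasurable_set1 (P b C)).
  by rewrite setTI.
pose N := [set p | occ b p /\ ~ visits X (invl b p) K p.1].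
have N0 : m x N = 0%E by exact: local_time_carried.
have mal : @measurable _ (Omy * R)%type [set p | occ b p /\ visits X (invl b p) setT p.1].
  have := @measurable_visits_invl b 0 setT (lexx _) measurableT.
  by under eq_set do rewrite add0r.
pose M1 := [set p | [/\ occ b p, B (lsum s (stopL b p)), visits X (invl b p) setT p.1 & C (shiftl b p)]].
have mM1 : @measurable _ (Omy * R)%type M1.
  rewrite (_ : M1 = [set p | occ b p /\ B (lsum s (stopL b p))] `&`
    [set p | occ b p /\ visits X (invl b p) setT p.1] `&` (shiftl b @^-1` C)).
    by apply: measurableI => //; exact: measurableI.
  by apply/seteqP; split => p /=; [move=> []|move=> [[[? ?] [? ?]] ?]].
transitivity (m x M1).
  apply: (@measure_eq_off_null _ _ _ _ _ _ N).
  - apply: measurableOR.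
    rewrite (_ : [set p | _] = [set p | occ b p /\ B (lsum s (stopL b p))] `&` (shiftl b @^-1` C)).
      exact: measurableI.
    by apply/seteqP; split => p /=; [move=> []|move=> [[? ?] ?]].
  - exact: measurableOR.
  - by apply: measurableOR; exact: measurable_not_visits.
  - exact: N0.
  - move=> p nN; split => /= [[op Bp Cp]|[]//]; split => //.
    have [z _ zX] : visits X (invl b p) K p.1 by apply: contrapT => nv; apply: nN.
    by exists z.
rewrite m_ysection; last exact: measurableOR.
pose F (p : Omega * R) : \bar R := ((\1_[set p | occ b p /\ B (lsum s (stopL b p))] p)%:E *
  at_state 0%E (fun z => P z C) (X (invl b p) p.1))%E.
have mF : measurable_fun setT F.
  have mf : measurable_fun (setT : set (Omy * R))
      (fun p => (p.1, if `[< occ b p >] then invl b p else 0) : Omy * R).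
    by apply: measurable_fun_pair; [exact: measurable_fst|exact: measurable_invl].
  have mG := measurableT_comp (measurable_at_state (mp_kernel MP hC)) mf.
  have mFy : measurable_fun (setT : set (Omy * R)) F.
    rewrite (_ : F = fun p : Omy * R => ((\1_[set p | occ b p /\ B (lsum s (stopL b p))] p)%:E *
      (if (0 <= (if `[< occ b p >] then invl b p else 0))%R
       then at_state 0%E (fun z => P z C) (X (if `[< occ b p >] then invl b p else 0%R) p.1) else 0%E))%E).
      apply: emeasurable_funM; last exact: mG.
      by apply/measurable_EFinP; exact: measurable_indic.
    apply/funext => p; rewrite /F indicE.
    have [/[!inE]/= -[op _]|_] := boolP (p \in _); last by rewrite !mul0e.
    by rewrite asboolT// ifT// ltW// occ_invl.
  exact: (measurableT_comp mFy measurable_toOmyR).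
have F0 p : (0 <= F p)%E.
  by rewrite /F mule_ge0// ?lee_fin//; case: (X _ _).
transitivity (\int[leb]_u \int[P x]_w F (w, u))%E.
  apply: eq_integral => u _; rewrite ysectionE.
  have := @strong_markov_invl b x u s B C ns mB hC.
  rewrite (_ : [set w | [/\ _, _, _ & _]] = (fun w => (w, u)) @^-1` M1); last first.
    by apply/seteqP; split => w /= [ow ? ? h]; split => //; move: h; rewrite /shiftl asboolT.
  move=> ->; rewrite integral_mkcond epatch_indic; apply: eq_integral => w _ /=.
  by rewrite /F muleC.
rewrite -(@fubini_tonelli2 _ _ _ _ R (P x) leb F mF F0).
rewrite -[LHS]/(\int[m x]_p F p)%E.
transitivity (\int[m x]_p ((\1_[set p | occ b p /\ B (lsum s (stopL b p))] p)%:E * P b C))%E.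
  have mOB' := measurableOR mOB.
  apply: ge0_ae_eq_integral => //.
  - apply: emeasurable_funM => //.
    by apply/measurable_EFinP; exact: measurable_indic.
  - by move=> p _; rewrite mule_ge0// lee_fin.
  exists N; split => //.
    by apply: measurableOR; exact: measurable_not_visits.
  move=> p /= /not_implyP[_]; apply: contra_notP => nN; rewrite /F indicE.
  have [/[!inE]/= -[op _]|_] := boolP (p \in _); last by rewrite !mul0e.
  have [z zK <-] : visits X (invl b p) K p.1 by apply: contrapT => nv; apply: nN.
  by rewrite /= zK.
rewrite ge0_integralZr//; last first.
  by apply/measurable_EFinP; apply: measurable_indic; exact: measurableOR.
by rewrite integral_indic ?setIT//; exact: measurableOR.
Qed.

(** * Resolvents killed along the local times *)

Let stopL_ge0 b p x : 0 <= stopL b p x.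
Proof.
rewrite /stopL; case: asboolP => // -[_ rp].
by apply: (clock_ge0 (clockL _ _)); exact: hit_ge0.
Qed.

Let stopL_self b p : occ b p -> stopL b p b = p.2.
Proof.
move=> [p0 rp]; rewrite /stopL asboolT//.
by apply: (clock_hit (clockL _ _)) => //; exact: ltW.
Qed.

(** Integrated over the level for a fixed path, this is the integral of exp(-<s, L_t>) against
    dL^b_t. *)
Definition kern (s : seq (R * E)) (b : E) (p : Omega * R) : R :=
  \1_(occ b) p * lexp s (stopL b p).

Let kern_ge0 s b p : 0 <= kern s b p.
Proof. by rewrite /kern mulr_ge0// lexp_ge0. Qed.

Let measurable_kern s b : measurable_fun (setT : set (Omy * R)) (kern s b).
Proof.
apply: measurable_funM; first exact: measurable_indic.
exact: (@measurable_lexp _ (Omy * R)%type R E s (fun x p => stopL b p x)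
  (fun x => measurable_stopL b x)).
Qed.

Let measurable_kernE s b : measurable_fun setT (fun p : Omega * R => (kern s b p)%:E).
Proof.
apply/measurable_EFinP; exact: (measurableT_comp (measurable_kern s b) measurable_toOmyR).
Qed.

(* resolvent of the process killed at rate <s, L> *)
Definition res (s : seq (R * E)) (x b : E) : \bar R :=
  (\int[m x]_p (kern s b p)%:E)%E.

Let Phi (s : seq (R * E)) (y : E) (w : Omega) : \bar R :=
  (\int[leb]_v (kern s y (w, v))%:E)%E.

Let Phi_ge0 s y w : (0 <= Phi s y w)%E.
Proof. by apply: integral_ge0 => v _; rewrite lee_fin. Qed.

Let measurable_Phi s y : measurable_fun (setT : set Omy) (Phi s y).
Proof.
apply: (@measurable_fun_fubini_tonelli_F _ _ Omy R R leb (fun p => (kern s y p)%:E)).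
- apply/measurable_EFinP; exact: (measurable_kern s y).
- by move=> p; rewrite lee_fin.
Qed.

Let resE s x b : res s x b = (\int[P x]_w Phi s b w)%E.
Proof.
apply: (@fubini_tonelli1 _ _ _ _ R (P x) leb (fun p => (kern s b p)%:E)) => //.
by move=> p; rewrite lee_fin.
Qed.

Lemma res_ge0 s x b : (0 <= res s x b)%E.
Proof. by apply: integral_ge0 => p _; rewrite lee_fin. Qed.

(** The levels reached by time k form the interval ]0, L^b_k], and these intervals increase with k.
    Through [Phi0] this also makes the total local time measurable. *)
Lemma lebR_occ b w : leb [set u | occ b (w, u)] = total_local_time L b w.
Proof.
have cb := clockL b w.
have cnd : nondecreasing_seq (fun k : nat => L b k%:R w).
  by move=> i j ij; case: cb => _ + _; apply => //; rewrite ler_nat.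
have -> : [set u | occ b (w, u)] = \bigcup_k (`]0, L b k%:R w]%classic : set R).
  apply/seteqP; split => u.
    by move=> [/= u0 /(reached_nat _ cb)[k uk]]; exists k => //=; rewrite in_itv/= u0.
  move=> [k _ /=]; rewrite in_itv/= => /andP[u0 uk]; split => //.
  by apply/(reached_nat _ cb); exists k.
have h1 : (L b k%:R w)%:E @[k --> \oo] --> leb (\bigcup_k (`]0, L b k%:R w]%classic : set R)).
  rewrite (_ : (fun k => _) = leb \o (fun k : nat => `]0, L b k%:R w]%classic)).
    apply: nondecreasing_cvg_mu => //.
      exact: bigcupT_measurable.
    move=> i j ij; apply/subsetPset => u /=; rewrite !in_itv/= => /andP[-> h]/=.
    by apply: (le_trans h); exact: cnd.
  by apply/funext => k /=; rewrite lebR_itvoc ?subr0// (clock_ge0 cb).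
have h2 : (L b k%:R w)%:E @[k --> \oo] --> total_local_time L b w.
  rewrite (_ : total_local_time L b w = ereal_sup (range (fun k : nat => (L b k%:R w)%:E))).
    by apply: ereal_nondecreasing_cvgn => i j ij; rewrite lee_fin; exact: cnd.
  apply/eqP; rewrite eq_le; apply/andP; split.
    apply: ge_ereal_sup => _ [t t0 <-]; apply: (@le_trans _ _ (L b (Num.truncn t).+1%:R w)%:E).
      by rewrite lee_fin; case: cb => _ + _; apply => //; rewrite ltW// truncnS_gt.
    by apply: ereal_sup_ubound; exists (Num.truncn t).+1.
  by apply: ge_ereal_sup => _ [k _ <-]; apply: ereal_sup_ubound; exists k%:R => //=.
exact: (cvg_unique _ h1 h2).
Qed.

Let Phi0 y w : Phi [::] y w = total_local_time L y w.
Proof.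
rewrite -lebR_occ /Phi /kern -[X in _ = leb X]setIT -integral_indic//; last first.
  have := @measurable_xsection _ _ Omy R _ w (measurable_occ y); rewrite xsectionE.
  exact.
by apply: eq_integral => v _; rewrite /lexp /lsum big_nil oppr0 expR0 mulr1 !indicE.
Qed.

Lemma res0 x b : res [::] x b = (\int[P x]_w total_local_time L b w)%E.
Proof. by rewrite resE; apply: eq_integral => w _; rewrite Phi0. Qed.

Lemma res_lty s x b : nngs s -> (res s x b < +oo)%E.
Proof.
move=> ns; apply: le_lt_trans (TR x b); rewrite -res0.
apply: ge0_le_integral => //.
- by move=> p _; rewrite lee_fin.
move=> p _; rewrite lee_fin ler_wpM2l//.
rewrite [X in _ <= X](_ : _ = 1); first by apply: lexp_le1 => // z; exact: stopL_ge0.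
by rewrite /lexp /lsum big_nil oppr0 expR0.
Qed.

Lemma greenE x b : green P L x b = fine (res [::] x b).
Proof. by rewrite res0. Qed.

(** From sets to functions in two passes: in the future phi, with <s, L> constrained to a Borel set;
    and in <s, L>, with phi as a weight, up to the function r -> exp(-r). *)
Let markov_invl s b x (phi : Omega -> \bar R) : nngs s ->
  measurable_fun (setT : set Omy) (phi : Omy -> \bar R) -> (forall w, 0 <= phi w)%E ->
  (\int[m x]_p ((kern s b p)%:E * phi (shiftl b p)) =
   res s x b * \int[P b]_w phi w)%E.
Proof.
move=> ns mphi phi0.
have mst : measurable_fun setT (fun p : Omega * R => lsum s (stopL b p)).
  apply: (measurableT_comp _ measurable_toOmyR (f := fun p : Omy * R => lsum s (stopL b p))).
  exact: (@measurable_lsum _ (Omy * R)%type R E s (fun x p => stopL b p x) (fun x => measurable_stopL b x)).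
have msh : measurable_fun setT (shiftl b : Omega * R -> Omy).
  exact: (measurableT_comp (measurable_shiftl b) measurable_toOmyR).
have mocc : measurable (occ b) by exact: measurableOR.
have mocc1 : measurable_fun setT (fun p : Omega * R => (\1_(occ b) p)%:E : \bar R).
  by apply/measurable_EFinP; exact: measurable_indic.
have mphiE : measurable_fun setT (fun w : Omega => phi w).
  exact: (measurableT_comp mphi measurable_toOmy).
have step1 (B : set R) : measurable B ->
    (\int[m x]_p ((\1_(occ b) p * \1_B (lsum s (stopL b p)))%:E * phi (shiftl b p)) =
     m x [set p | occ b p /\ B (lsum s (stopL b p))] * \int[P b]_w phi w)%E.
  move=> mB.
  have mOB : measurable [set p | occ b p /\ B (lsum s (stopL b p))].
    rewrite (_ : [set p | _] = occ b `&` (fun p => lsum s (stopL b p)) @^-1` B)//.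
    by apply: measurableI => //; rewrite -[X in measurable X]setTI; exact: mst.
  rewrite -ge0_integralZl//.
  apply: (@integral_comp_eq _ _ _ _ _ Omy R (m x) (P b) (shiftl b) (fun w => w)
    (fun p => (\1_(occ b) p * \1_B (lsum s (stopL b p)))%:E)
    (fun=> m x [set p | occ b p /\ B (lsum s (stopL b p))])) => //.
  - apply/measurable_EFinP; apply: measurable_funM; first exact: measurable_indic.
    exact: (measurableT_comp (measurable_indic mB) mst).
  - move=> C mC; rewrite ge0_integralZl//; last first.
      by apply/measurable_EFinP; apply: measurable_indic; exact: measurable_history.
    rewrite integral_indic//; last exact: measurable_history.
    rewrite setIT -markov_sets// -[X in m x X]setIT -integral_indic//; last first.
      rewrite (_ : [set p | _] = [set p | occ b p /\ B (lsum s (stopL b p))] `&` (shiftl b @^-1` C)).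
        by apply: measurableI => //; rewrite -[X in measurable X]setTI; exact: msh.
      by apply/seteqP; split => p /=; [move=> []|move=> [[? ?] ?]].
    apply: eq_integral => p _; rewrite -EFinM !indicE -!natrM !mulnb; congr ((nat_of_bool _)%:R%:E).
    apply/idP/idP; rewrite !inE/=; first by move=> /andP[/andP[]]; rewrite !inE.
    by move=> [? ? ?]; rewrite !mem_set.
transitivity (\int[m x]_p (((\1_(occ b) p)%:E * phi (shiftl b p)) * (expR (- lsum s (stopL b p)))%:E))%E.
  by apply: eq_integral => p _; rewrite /kern EFinM -!muleA; congr (_ * _)%E; rewrite muleC.
rewrite (@integral_comp_eq _ _ _ _ _ R R (m x) (m x) (fun p => lsum s (stopL b p)) (fun p => lsum s (stopL b p))
    (fun p => (\1_(occ b) p)%:E * phi (shiftl b p))%E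
    (fun p => (\1_(occ b) p)%:E * \int[P b]_w phi w)%E _ _ _ _ _ _ _ (fun r => (expR (- r))%:E))//.
- rewrite -ge0_integralZr//; last exact: integral_ge0.
  apply: eq_integral => p _.
  by rewrite /kern EFinM -!muleA; congr (_ * _)%E; rewrite muleC.
- by move=> p _; rewrite lee_fin.
- apply: emeasurable_funM => //; exact: (measurableT_comp mphi msh).
- exact: emeasurable_funM.
- by move=> p; rewrite mule_ge0// lee_fin.
- by move=> p; rewrite mule_ge0// ?lee_fin// integral_ge0.
- move=> B mB.
  transitivity (\int[m x]_p ((\1_(occ b) p * \1_B (lsum s (stopL b p)))%:E * phi (shiftl b p)))%E.
    by apply: eq_integral => p _; rewrite EFinM -!muleA; congr (_ * _)%E; rewrite muleC.
  rewrite step1// -[X in m x X]setIT -integral_indic//; last first.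
    rewrite (_ : [set p | _] = occ b `&` (fun p => lsum s (stopL b p)) @^-1` B)//.
    by apply: measurableI => //; rewrite -[X in measurable X]setTI; exact: mst.
  rewrite -ge0_integralZr//; last 2 first.
  + apply/measurable_EFinP; apply: measurable_indic.
    rewrite (_ : [set p | _] = occ b `&` (fun p => lsum s (stopL b p)) @^-1` B)//.
    by apply: measurableI => //; rewrite -[X in measurable X]setTI; exact: mst.
  + exact: integral_ge0.
  apply: eq_integral => p _; rewrite -muleA [(\int[_]__ _ * _)%E]muleC muleA; congr (_ * _)%E.
  rewrite -EFinM !indicE -!natrM !mulnb; congr ((nat_of_bool _)%:R%:E).
  apply/idP/idP; rewrite !inE/=; first by move=> [? ?]; rewrite !mem_set.
  by move=> /andP[]; rewrite !inE.
- apply/measurable_EFinP; apply: measurableT_comp => //; exact: measurableT_comp.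
Qed.

(** Additivity holds almost surely for each state, hence for finitely many at once but not for all
    of E; only y and the linear form of s are asked for. *)
Let additive_at (s : seq (R * E)) (y : E) (w : Omega) : Prop :=
  (forall r t, 0 <= r -> 0 <= t -> L y (t + r) w = L y r w + L y t (theta r w)) /\
  (forall r t, 0 <= r -> 0 <= t ->
    lsum s (fun z => L z (t + r) w) =
    lsum s (fun z => L z r w) + lsum s (fun z => L z t (theta r w))).

Let ae_additive x s y : {ae P x, forall w, additive_at s y w}.
Proof.
have h1 := lt_additive (LT y) x.
suff h2 : {ae P x, forall w, forall r t, 0 <= r -> 0 <= t ->
    lsum s (fun z => L z (t + r) w) =
    lsum s (fun z => L z r w) + lsum s (fun z => L z t (theta r w))}.
  by apply: filterS2 h1 h2 => w a1 a2; split.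
elim: s => [|c s IH].
  by apply: aeW => w r t _ _; rewrite /lsum !big_nil addr0.
have hc := lt_additive (LT c.2) x.
apply: filterS2 hc IH => w a1 a2 r t r0 t0.
by rewrite !lsum_cons a1// a2//; ring.
Qed.

Let measurable_kern_sec s y w : measurable_fun setT (fun v : R => kern s y (w, v)).
Proof.
have mpair : measurable_fun (setT : set R) (fun v : R => (w, v) : Omy * R).
  by apply: measurable_fun_pair => //; exact: measurable_cst.
exact: (measurableT_comp (measurable_kern s y) mpair).
Qed.

Let measurable_stopL_sec y w b : measurable_fun setT (fun v : R => stopL y (w, v) b).
Proof.
have mpair : measurable_fun (setT : set R) (fun v : R => (w, v) : Omy * R).
  by apply: measurable_fun_pair => //; exact: measurable_cst.
exact: (measurableT_comp (measurable_stopL y b) mpair).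
Qed.

Let kern_after s b y w u : additive_at s y w -> occ b (w, u) ->
  (\int[leb]_v (kern s y (w, v) * (u <= stopL y (w, v) b)%R%:R)%:E =
   (lexp s (stopL b (w, u)))%:E * Phi s y (theta (invl b (w, u)) w))%E.
Proof.
move=> [addy adds] ou; set r := invl b (w, u).
have r0 : 0 <= r by rewrite ltW// occ_invl.
pose c := L y r w.
have cy := clockL y w; have cy' := clockL y (theta r w); have cb := clockL b w.
have fgE t : 0 <= t -> L y (t + r) w = L y r w + L y t (theta r w) by move=> t0; exact: addy.
have mk : measurable_fun setT (fun v : R => (kern s y (theta r w, v))%:E).
  exact/measurable_EFinP.
have k0 v : (0 <= (kern s y (theta r w, v))%:E)%E by rewrite lee_fin.
have mkc : measurable_fun setT (fun v : R => (kern s y (theta r w, v - c))%:E).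
  exact: (measurableT_comp mk (measurable_addr (- c))).
rewrite /Phi -(integral_lebR_shift (- c) mk k0) -ge0_integralZl//; last first.
  by rewrite lee_fin lexp_ge0.
apply: ge0_ae_eq_integral => //.
- apply/measurable_EFinP; apply: measurable_funM => //.
  apply: (measurableT_comp (f := fun b : bool => b%:R : R)) => //.
  by apply: measurable_fun_ler => //; exact: measurable_cst.
- exact: measurable_funeM.
- by move=> v _; rewrite lee_fin mulr_ge0.
- by move=> v _; rewrite mule_ge0// lee_fin lexp_ge0.
(* At v = L^y_r the inverse time precedes r if L^y is flat just before r; this single level is
   Lebesgue-null. *)
exists [set c]; split => //; first exact: lebesgue_measure_set1.
move=> v /= /not_implyP[_]; apply: contra_notP => /eqP vc.
rewrite -EFinM; congr (_%:E); rewrite /kern.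
have stE : occ y (w, v) -> stopL y (w, v) b = L b (invl y (w, v)) w.
  by move=> ov; rewrite /stopL asboolT.
have [vltc|vgec] := ltP v c.
  rewrite [X in _ = _ * (X * _)](_ : _ = 0); last first.
    rewrite indicE memNset// => -[/=]; rewrite ltrBDr add0r.
    by rewrite ltNge ltW.
  rewrite mul0r mulr0.
  have [/[!inE] -[/= v0 rv]|nv] := boolP ((w, v) \in occ y); last by rewrite indicE (negbTE nv) !mul0r.
  rewrite stE; last by split.
  suff /negbTE -> : ~~ (u <= L b (invl y (w, v)) w) by rewrite mulr0.
  rewrite -ltNge -(@lt_hitP _ (L b ^~ w) u)//; last 2 first.
  - by case: ou.
  - by rewrite ltW// occ_invl.
  rewrite -/(invl b (w, u)) -/r lt_neqAle {2}/invl (@hit_leP _ (L y ^~ w) v)// (ltW vltc) andbT.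
  apply/eqP => vr; move: vc; rewrite /c -vr.
  by rewrite (clock_hit cy) ?eqxx// ltW.
have vltc : c < v by rewrite lt_neqAle eq_sym vc.
have c0 : 0 <= c by exact: clock_ge0 cy r0.
have v0 : 0 < v by exact: le_lt_trans vltc.
have [rv|nrv] := pselect (reached (L y ^~ w) v); last first.
  rewrite [X in X * _ * _](_ : _ = 0); last by rewrite indicE memNset// => -[].
  rewrite [X in _ = _ * (X * _)](_ : _ = 0) ?mul0r ?mulr0//.
  rewrite indicE memNset// => -[/= _ h]; apply: nrv.
  exact/(reached_shift cy r0 fgE vltc).
have rv' := (reached_shift cy r0 fgE vltc).1 rv.
have hE := hit_shift cy cy' r0 fgE vltc rv.
have ov : occ y (w, v) by [].
have ov' : occ y (theta r w, v - c) by split => //=; rewrite subr_gt0.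
have h0 : 0 <= hit (L y ^~ (theta r w)) (v - c) by exact: hit_ge0.
rewrite !indicE !mem_set// !mul1r stE//.
have -> : u <= L b (invl y (w, v)) w.
  rewrite -(@hit_leP _ (L b ^~ w) u)//; last 2 first.
  - by case: ou.
  - by rewrite ltW// occ_invl.
  by rewrite -/(invl b (w, u)) -/r /invl hE lerDl.
rewrite mulr1 /lexp -expRD -opprD; congr (expR (- _)).
transitivity (lsum s (fun z => L z (invl y (w, v)) w)).
  by congr lsum; apply/funext => z; rewrite /stopL asboolT.
rewrite /invl hE addrC adds//; congr (_ + _).
  by congr lsum; apply/funext => z; rewrite /stopL asboolT.
by congr lsum; apply/funext => z; rewrite /stopL asboolT.
Qed.

(** With l = L^b at tau^y_v, 1 - exp(-t l) is the integral of t exp(-t u) over 0 < u <= l.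
    Exchanging u and v leaves the contribution after tau^b_u, given by [kern_after], and the strong
    Markov property at tau^b_u separates it from the past. *)
Lemma res_cons x y b (t : R) s : nngs s -> 0 <= t ->
  (res s x y = res ((t, b) :: s) x y + t%:E * res ((t, b) :: s) x b * res s b y)%E.
Proof.
move=> ns t0.
have ns' : nngs ((t, b) :: s) by rewrite /nngs/= t0.
pose A (p : Omega * R) : R := kern s y p * (1 - expR (- (t * stopL y p b))).
have A0 p : 0 <= A p.
  by rewrite mulr_ge0// subr_ge0 -expR0 ler_expR oppr_le0 mulr_ge0.
have mA : measurable_fun setT (fun p => (A p)%:E).
  apply/measurable_EFinP; apply: measurable_funM.
    exact: (measurableT_comp (measurable_kern s y) measurable_toOmyR).
  apply: measurable_funB => //; do 2 apply: measurableT_comp => //.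
  apply: measurable_funM => //.
  exact: (measurableT_comp (measurable_stopL y b) measurable_toOmyR).
transitivity (res ((t, b) :: s) x y + \int[m x]_p (A p)%:E)%E.
  rewrite /res -ge0_integralD//; last 2 first.
  - by move=> p _; rewrite lee_fin.
  - by move=> p _; rewrite lee_fin.
  apply: eq_integral => p _; rewrite -EFinD; congr (_%:E).
  by rewrite /A /kern lexp_cons/=; ring.
congr (_ + _)%E.
pose G u : R := t * expR (- (t * u)).
have G0 u : 0 <= G u by rewrite /G mulr_ge0// expR_ge0.
have mG : measurable_fun setT G.
  by apply: measurable_funM => //; do 2 apply: measurableT_comp => //.
have mPhish : measurable_fun setT (fun p : Omega * R => Phi s y (shiftl b p)).
  apply: (measurableT_comp (measurable_Phi s y)).
  exact: (measurableT_comp (measurable_shiftl b) measurable_toOmyR).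
have mR : measurable_fun setT (fun p => (t%:E * ((kern ((t, b) :: s) b p)%:E * Phi s y (shiftl b p)))%E).
  by apply: measurable_funeM; exact: emeasurable_funM.
have R0 p : (0 <= t%:E * ((kern ((t, b) :: s) b p)%:E * Phi s y (shiftl b p)))%E.
  by rewrite !mule_ge0 ?lee_fin.
have A0' p : (0 <= (A p)%:E)%E by rewrite lee_fin.
rewrite -muleA [res s b y]resE.
rewrite -(@markov_invl _ b x (Phi s y) ns' (measurable_Phi s y) (Phi_ge0 s y)).
rewrite -ge0_integralZl//; last 2 first.
- by apply: emeasurable_funM.
- by move=> p _; rewrite mule_ge0 ?lee_fin.
rewrite /m (fubini_tonelli1 _ mA A0') (fubini_tonelli1 _ mR R0).
apply: ge0_ae_eq_integral => //.
- exact: measurable_fun_fubini_tonelli_F.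
- exact: measurable_fun_fubini_tonelli_F.
- by move=> w _; apply: integral_ge0.
- by move=> w _; apply: integral_ge0.
apply: filterS (ae_additive x s y) => w addw _; rewrite /fubini_F.
pose F v u : R := kern s y (w, v) * (u <= stopL y (w, v) b)%R%:R.
have F0 v u : 0 <= F v u by rewrite mulr_ge0.
pose f (q : R * R) : \bar R := ((0 < q.2)%R%:R * G q.2 * F q.1 q.2)%:E.
have mpos : measurable_fun setT (fun u : R => (0 < u)%R%:R : R).
  apply: (measurableT_comp (f := fun b : bool => b%:R : R)) => //.
  by apply: measurable_fun_ltr => //; exact: measurable_cst.
have mf : measurable_fun setT f.
  apply/measurable_EFinP; apply: measurable_funM.
    have mposG : measurable_fun setT (fun u : R => (0 < u)%R%:R * G u).
      exact: measurable_funM.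
    exact: (measurableT_comp mposG measurable_snd).
  apply: measurable_funM; first exact: (measurableT_comp (measurable_kern_sec s y w) measurable_fst).
  apply: (measurableT_comp (f := fun b : bool => b%:R : R)) => //.
  apply: measurable_fun_ler => //.
  exact: (measurableT_comp (measurable_stopL_sec y w b) measurable_fst).
have f0 q : (0 <= f q)%E.
  by rewrite lee_fin; apply: mulr_ge0 => //; exact: mulr_ge0.
transitivity (\int[leb]_v \int[leb]_u f (v, u))%E.
  apply: eq_integral => v _; rewrite /A EFinM -integral_exponential//.
  have ml : measurable_fun setT (fun u : R =>
      ((0 < u <= stopL y (w, v) b)%R%:R * (t * expR (- (t * u))))%:E).
    apply/measurable_EFinP; apply: measurable_funM => //.
    apply: (measurableT_comp (f := fun b : bool => b%:R : R)) => //.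
    apply: measurable_and; [exact: measurable_fun_ltr|exact: measurable_fun_ler].
  have l0 u : (0 <= ((0 < u <= stopL y (w, v) b)%R%:R * (t * expR (- (t * u))))%:E)%E.
    by rewrite lee_fin; apply: mulr_ge0 => //; exact: G0.
  rewrite -ge0_integralZl ?lee_fin//.
  apply: eq_integral => u _; rewrite -EFinM /f /F/= -mulnb natrM; congr (_%:E).
  by rewrite /G; ring.
rewrite (@fubini_tonelli _ _ _ _ R leb leb f mf f0); apply: eq_integral => u _ /=.
transitivity (((0 < u)%R%:R * G u)%:E * \int[leb]_v (F v u)%:E)%E.
  have mFu : measurable_fun setT (fun v : R => (F v u)%:E).
    apply/measurable_EFinP; apply: measurable_funM => //.
    apply: (measurableT_comp (f := fun b : bool => b%:R : R)) => //.
    exact: measurable_fun_ler.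
  have GG0 : (0 <= ((0 < u)%R%:R * G u)%:E)%E by rewrite lee_fin; exact: mulr_ge0.
  have Fu0 v : setT v -> (0 <= (F v u)%:E)%E by rewrite lee_fin.
  by rewrite -ge0_integralZl.
have [ou|nou] := pselect (occ b (w, u)).
  rewrite (kern_after addw ou) /shiftl asboolT//= /kern indicE mem_set// lexp_cons/=.
  (* L^b at tau^b_u equals u, so exp(-t u) is exactly the killing due to the new entry (t, b). *)
  rewrite stopL_self//= (ou.1 : 0 < u) !mul1r muleA muleA -!EFinM; congr (_%:E * _)%E.
  by rewrite /G; ring.
rewrite /kern [\1_(occ b) _]indicE memNset// mul0r mul0e mule0.
have [u0|u0] := ltP 0 u; last by rewrite mul0r mul0e.
rewrite integral0_eq ?mule0// => v _; rewrite /F.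
case: leP => uv; last by rewrite mulr0.
rewrite /kern indicE memNset ?mul0r// => ov; apply: nou; split => //=.
move: uv; rewrite /stopL asboolT// => uv; exists (invl y (w, v)) => //.
by rewrite ltW// occ_invl.
Qed.

(** * Determinants of the Green matrix *)

Definition resR (s : seq (R * E)) (x y : E) : R := fine (res s x y).

Lemma resRE s x y : nngs s -> (resR s x y)%:E = res s x y.
Proof. by move=> ns; rewrite /resR fineK// ge0_fin_numE ?res_ge0// res_lty. Qed.

Lemma resR_cons s x y b (t : R) : nngs s -> 0 <= t ->
  resR s x y = resR ((t, b) :: s) x y + t * resR ((t, b) :: s) x b * resR s b y.
Proof.
move=> ns t0; have ns' : nngs ((t, b) :: s) by rewrite /nngs/= t0.
have := res_cons x y b ns t0.
by rewrite -!resRE// -!EFinM -EFinD => -[].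
Qed.

Lemma greenRE x y : green P L x y = resR [::] x y.
Proof. by rewrite greenE. Qed.

Fixpoint dets (s : seq (R * E)) : R :=
  if s is c :: s' then dets s' * (1 + c.1 * resR s' c.2 c.2) else 1.

(** Only row b differs from the identity, so the cofactors along that row are those of the identity
    matrix. *)
Let det_row_update (n : nat) (H : 'M[R]_n) (b : 'I_n) (t : R) :
  \det (1%:M + t *: (delta_mx b b *m H)) = 1 + t * H b b.
Proof.
set A := (X in \det X).
have dmE i j : (delta_mx b b *m H) i j = (i == b)%:R * H b j.
  rewrite mxE (bigD1 b)//= mxE eqxx andbT big1 ?addr0// => k kb.
  by rewrite mxE (negbTE kb) andbF mul0r.
have AE i j : A i j = (i == j)%:R + t * ((i == b)%:R * H b j).
  by rewrite mxE [X in X + _]mxE [X in _ + X]mxE dmE.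
clearbody A; rewrite (expand_det_row _ b) (bigD1 b)//= big1 ?addr0 => [|j jb].
  have -> : cofactor A b b = 1.
    transitivity ((\adj (1%:M : 'M[R]_n)) b b); last by rewrite adj1 mxE eqxx.
    rewrite mxE /cofactor; congr (_ * \det _); apply/matrixP => k l.
    by rewrite !mxE AE [lift b k == b]eq_sym (negbTE (neq_lift _ _)) mul0r mulr0 addr0.
  by rewrite mulr1 AE !eqxx mul1r.
have -> : cofactor A b j = 0.
  transitivity ((\adj (1%:M : 'M[R]_n)) j b); last by rewrite adj1 mxE (negbTE jb).
  rewrite mxE /cofactor; congr (_ * \det _); apply/matrixP => k l.
  by rewrite !mxE AE [lift b k == b]eq_sym (negbTE (neq_lift _ _)) mul0r mulr0 addr0.
by rewrite mulr0.
Qed.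

(** The induction carries H (I + alpha G) = G along with the determinant: H plays the part of G (I +
    alpha G)^-1 without any inverse being formed. Adding t at b multiplies I + alpha G on the left
    by I + t e_b e_b^T H. *)
Lemma detsE n (x : 'I_n -> E) (s : seq (R * 'I_n)) : nngs s ->
  \det (1%:M + diag_mx (\row_i \sum_(c <- s | c.2 == i) c.1) *m
        \matrix_(i, j) green P L (x i) (x j)) =
  dets [seq (c.1, x c.2) | c <- s].
Proof.
move=> ns; pose al (s : seq (R * 'I_n)) : 'rV[R]_n := \row_i \sum_(c <- s | c.2 == i) c.1.
pose G := \matrix_(i, j) green P L (x i) (x j).
pose xs (s : seq (R * 'I_n)) := [seq (c.1, x c.2) | c <- s].
pose H (s : seq (R * 'I_n)) := \matrix_(i, j) resR (xs s) (x i) (x j).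
suff [] : H s *m (1%:M + diag_mx (al s) *m G) = G /\
  \det (1%:M + diag_mx (al s) *m G) = dets (xs s) by [].
have nxs s' : nngs s' -> nngs (xs s').
  by rewrite /nngs /xs all_map; apply: sub_all.
elim: s ns => [_|[t b] s IH /= /andP[t0 ns]].
  have -> : al [::] = 0 by apply/rowP => i; rewrite !mxE big_nil.
  have -> : diag_mx (0 : 'rV[R]_n) = 0 by apply/matrixP => i j; rewrite !mxE mul0rn.
  rewrite mul0mx addr0 mulmx1 det1; split => //.
  by apply/matrixP => i j; rewrite !mxE greenRE.
have [IHG IHd] := IH ns.
have alE : diag_mx (al ((t, b) :: s)) = diag_mx (al s) + t *: delta_mx b b.
  apply/matrixP => i j; rewrite !mxE big_cons/=.
  case: (eqVneq i j) => [<-|ij] /=; last first.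
    rewrite !mulr0n add0r; case: (eqVneq i b) => [ib|]; last by rewrite mulr0.
    by rewrite -ib eq_sym (negbTE ij) mulr0.
  rewrite !mulr1n andbb eq_sym; case: eqP => _; first by rewrite mulr1 addrC.
  by rewrite mulr0 addr0.
have HE : H s = H ((t, b) :: s) *m (1%:M + t *: (delta_mx b b *m H s)).
  rewrite mulmxDr mulmx1 -scalemxAr mulmxA; apply/matrixP => i j.
  rewrite [RHS]mxE [X in _ + X]mxE [X in _ + _ * X]mxE.
  rewrite (bigD1 b)//= big1 ?addr0 => [|k kb]; last first.
    rewrite [X in X * _]mxE big1 ?mul0r// => l _.
    by rewrite [delta_mx _ _ _ _]mxE (negbTE kb) andbF mulr0.
  rewrite [X in _ = _ + t * (X * _)]mxE (bigD1 b)//= big1 ?addr0 => [|k kb]; last first.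
    by rewrite [delta_mx _ _ _ _]mxE (negbTE kb) mulr0.
  rewrite [delta_mx _ _ _ _]mxE !eqxx mulr1 !mxE /xs/= mulrA.
  exact: resR_cons (nxs _ ns) t0.
have fE : 1%:M + diag_mx (al ((t, b) :: s)) *m G =
    (1%:M + t *: (delta_mx b b *m H s)) *m (1%:M + diag_mx (al s) *m G).
  rewrite [RHS]mulmxDl mul1mx -scalemxAl -mulmxA IHG alE -addrA.
  by congr (_ + _); rewrite mulmxDl -scalemxAl.
split; first by rewrite fE mulmxA -HE.
by rewrite fE det_mulmx det_row_update IHd mulrC /= !mxE.
Qed.

Context {d' : measure_display} {Omega' : measurableType d'}.
Variables (Q : probability Omega' R) (psi : E -> {RV Q >-> R}).
Hypothesis PS : permanental_process2 (green P L) psi.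

Let hpsi (x : E) (w : Omega') : R := psi x w / 2.

(** Positions in the list serve as indices, so repeated states become repeated values of x. The
    factor 1/2 in the definition of the permanental process is absorbed in psi/2. *)
Lemma laplace_psi (s : seq (R * E)) : nngs s ->
  (\int[Q]_w (lexp s (hpsi ^~ w))%:E = ((dets s) `^ (- 2^-1))%:E)%E.
Proof.
move=> ns; have [_ H] := PS.
pose n := size s; pose x (i : 'I_n) := (tnth (in_tuple s) i).2.
pose al : 'rV[R]_n := \row_i (tnth (in_tuple s) i).1.
have al0 i : 0 <= al 0 i.
  by rewrite mxE; move/allP: ns; apply; exact: mem_tnth.
have := H n x al al0; rewrite unlock.
pose s' : seq (R * 'I_n) := [seq ((tnth (in_tuple s) i).1, i) | i <- enum 'I_n].
have ss' : [seq (c.1, x c.2) | c <- s'] = s.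
  rewrite /s' -map_comp -[RHS](map_tnth_enum (in_tuple s)).
  by apply: eq_map => i /=; rewrite /x -surjective_pairing.
have alE : al = \row_i \sum_(c <- s' | c.2 == i) c.1.
  apply/rowP => i; rewrite !mxE big_map /=.
  by rewrite big_enum_cond/= (big_pred1 i).
rewrite alE detsE ?ss'//; last first.
  by rewrite /nngs all_map; apply/allP => i _ /=; have := al0 i; rewrite mxE.
move=> <-; apply: eq_integral => w _; congr (_%:E).
rewrite /lexp /lsum -alE; congr (expR (- _)).
rewrite mulr_sumr (big_tnth _ _ s); apply: eq_bigr => i _.
by rewrite /al mxE /hpsi /x; ring.
Qed.

(** * Discretisation of time *)

Definition grid (N k : nat) : R := k%:R / N.+1%:R.

Let grid_ge0 N k : 0 <= grid N k.
Proof. by rewrite divr_ge0. Qed.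

Let grid_le N j k : (j <= k)%N -> grid N j <= grid N k.
Proof. by move=> jk; rewrite ler_wpM2r ?invr_ge0// ler_nat. Qed.

(** The (N+1)^2 steps of length 1/(N+1) reach time N+1, so the mesh tends to 0 while the grid
    exhausts the half-line. *)
Let grid_last N : grid N (N.+1 * N.+1) = N.+1%:R.
Proof. by rewrite /grid natrM mulfK. Qed.

(* The sum keeps the last grid point before the time [inf D] where D becomes true. *)
Lemma grid_cvg (D : R -> bool) (f : R -> R) : clock f -> ~~ D 0 ->
  (exists2 t, 0 <= t & D t) -> (forall s t, 0 <= s -> s <= t -> D s -> D t) ->
  \sum_(k < N.+1 * N.+1) (~~ D (grid N k) && D (grid N k.+1))%:R * expR (- f (grid N k))
    @[N --> \oo] --> expR (- f (inf [set t | 0 <= t /\ D t])).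
Proof.
move=> cf D0 [t0 t00 Dt0] Dm; set z := inf _.
have lbD : has_lbound [set t | 0 <= t /\ D t] by exists 0 => t [].
have Dz t : 0 <= t -> D t -> z <= t by move=> t1 Dt; exact: ge_inf.
have zD t : 0 <= t -> ~~ D t -> t <= z.
  move=> t1 nDt; apply: lb_le_inf; first by exists t0.
  move=> s [s0 Ds]; rewrite leNgt; apply: contra nDt => /ltW st; exact: Dm Ds.
have z0 : 0 <= z by apply: zD.
suff cvgf : forall e, 0 < e -> \forall N \near \oo,
    exists2 k : nat, `|f z - f (grid N k)| < e &
    \sum_(k < N.+1 * N.+1) (~~ D (grid N k) && D (grid N k.+1))%:R * expR (- f (grid N k)) =
    expR (- f (grid N k)).
  apply/cvgrPdist_lt => e e0.
  have ce : {for - f z, continuous (@expR R)} by exact: continuous_expR.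
  have /cvgrPdist_lt/(_ e e0)[del /= del0 hdel] := ce.
  have := cvgf del del0; apply: filterS => N [k fk ->].
  by apply: hdel; rewrite /= opprK addrC distrC.
move=> e e0; have [dl dl0 fdl] := clock_eps cf z0 e0.
near=> N.
have NR : 0 < N.+1%:R :> R by rewrite ltr0n.
have DN : D (grid N (N.+1 * N.+1)).
  rewrite grid_last; apply: Dm Dt0 => //.
  have : (Num.truncn t0).+1%:R <= N.+1%:R :> R.
    by rewrite ler_nat ltnS; near: N; exact: nbhs_infty_ge.
  by apply: le_trans; rewrite ltW// truncnS_gt.
have exD : exists k, D (grid N k) by exists (N.+1 * N.+1)%N.
(* The first grid point where D holds is not the origin. The only surviving term of the sum is at
   its predecessor, within one mesh of inf D. *)
have [[|k] Dk kmin] := ex_minnP exD; first by move: Dk; rewrite /grid mul0r (negbTE D0).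
have nDk : ~~ D (grid N k) by apply/negP => /kmin; rewrite ltnn.
have kN : (k < N.+1 * N.+1)%N by exact: kmin.
exists k.
  apply: fdl; first exact: grid_ge0.
  have h1 := zD _ (grid_ge0 N k) nDk; have h2 := Dz _ (grid_ge0 N k.+1) Dk.
  rewrite ger0_norm ?subr_ge0//; apply: (@le_lt_trans _ _ (N.+1%:R^-1)).
    by rewrite lerBlDl (le_trans h2)// /grid -natr1 mulrDl mul1r.
  rewrite invf_plt ?posrE//; apply: (@lt_le_trans _ _ (Num.truncn dl^-1).+1%:R).
    exact: truncnS_gt.
  by rewrite ler_nat ltnS; near: N; exact: nbhs_infty_ge.
rewrite (bigD1 (Ordinal kN))//= nDk Dk mul1r big1 ?addr0// => j /negP jk.
case: (boolP (_ && _)) => [/andP[nDj Dj]|]; last by rewrite mul0r.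
exfalso; apply: jk; apply/eqP/val_inj => /=; apply/eqP; rewrite eqn_leq.
apply/andP; split; last by rewrite -ltnS; apply: kmin.
rewrite leqNgt; apply: contra nDj => kj; apply: Dm Dk; first exact: grid_ge0.
exact: grid_le.
Unshelve. all: by end_near. Qed.

(** D may fail at its infimum; continuity of f brings there the constant value taken where D
    holds. *)
Lemma clock_stopped (D : R -> bool) (f : R -> R) t0 : clock f -> 0 <= t0 -> D t0 ->
  (forall s t, 0 <= s -> s <= t -> D s -> f t = f s) ->
  f (inf [set t | 0 <= t /\ D t]) = f t0.
Proof.
move=> cf t00 Dt0 Dc; set z := inf _.
have hi : has_inf [set t | 0 <= t /\ D t] by split; [exists t0|exists 0 => t []].
have z0 : 0 <= z by apply: lb_le_inf; [exists t0|move=> s []].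
apply: contrapT => /eqP; rewrite -subr_eq0 -normr_gt0 => e0.
have [dl dl0 fdl] := clock_eps cf z0 e0.
have [s [s0 Ds] sz] := inf_adherent dl0 hi.
have ts : f t0 = f s.
  by case: (leP s t0) => st; [exact: Dc|rewrite (Dc t0 s)// ltW].
have zs : z <= s by apply: ge_inf => //; exact: hi.2.
have : `|f z - f s| < `|f z - f t0|.
  by apply: fdl => //; rewrite distrC ger0_norm ?subr_ge0// ltrBlDl.
by rewrite ts ltxx.
Qed.

(** * The Markov property at constant times *)

Let measurable_shift t : 0 <= t ->
  measurable_fun (setT : set Omy) (fun w => theta t w : Omy).
Proof.
move=> t0; apply: (measurability _ (erefl : @measurable _ Omy = <<s hgeny >>)).
move=> _ [_ [s [B [s0 mB ->]]] <-]; rewrite setTI.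
rewrite (_ : _ @^-1` _ = visits X (s + t) B).
  by apply: sub_sigma_algebra; exists (s + t), B; rewrite addr_ge0.
by apply/seteqP; split => w; rewrite /visits /= (mp_shift MP).
Qed.

Let aliveN t w : ~ alive X t w -> X t w = None.
Proof.
rewrite /alive /visits /=; case: (X t w) => [z|//] h.
by exfalso; apply: h; exists z.
Qed.

Let history_alive t : 0 <= t -> history X t (alive X t).
Proof. by move=> t0; apply: sub_sigma_algebra; exists t, setT; rewrite t0 lexx. Qed.

Let measurable_at (f : E -> \bar R) t : 0 <= t -> measurable_fun setT f ->
  measurable_fun setT (fun w : Omega => at_state 0%E f (X t w)).
Proof.
move=> t0 mf.
have mpair : measurable_fun (setT : set Omega) (fun w => (w : Omy, t) : Omy * R).
  by apply: measurable_fun_pair => //; exact: measurable_cst.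
have := measurableT_comp (measurable_at_state mf) mpair.
by congr measurable_fun; apply/funext => w /=; rewrite t0.
Qed.

Let markov_const_set a t A C : 0 <= t -> history X t A -> history_infty X C ->
  P a ((A `&` alive X t) `&` [set w | C (theta t w)]) =
  (\int[P a]_w ((\1_A w)%:E * at_state 0 (fun z => P z C) (X t w)))%E.
Proof.
move=> t0 hA hC.
have cstT s (B : bool) : history X s [set w | B].
  case: B; first by rewrite (_ : [set w | true] = setT);
    [exact: (@measurableT _ (Omt s))|apply/seteqP; split].
  by rewrite (_ : [set w | false] = set0);
    [exact: (@measurable0 _ (Omt s))|apply/seteqP; split].
have st : stopping_time X (fun=> t%:E).
  split; first by move=> w; rewrite lee_fin.
  by move=> s s0; exact: cstT.
have hat : history_at X (fun=> t%:E) A.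
  split; first exact: history_le hA.
  move=> s s0; case: (leP t s) => ts.
    rewrite (_ : A `&` _ = A); first exact: history_mono ts hA.
    by apply/seteqP; split => w => [[]//|Aw]; split; rewrite //= lee_fin.
  rewrite (_ : A `&` _ = set0); first exact: (@measurable0 _ (Omt s)).
  by apply/seteqP; split => w // [_] /=; rewrite lee_fin leNgt ts.
have := mp_strong_markov MP a st hat hC.
rewrite (_ : A `&` [set w | [/\ _, _ & _]] =
    (A `&` alive X t) `&` [set w | C (theta t w)]); last first.
  by apply/seteqP; split => w => [[Aw [_ al Cw]]|[[Aw al] Cw]]; split => //=; rewrite ltry.
move=> ->; rewrite integral_mkcond; apply: eq_integral => w _.
rewrite patchE indicE in_setI (_ : (w \in [set w | _]) = true) ?andbT; last first.
  by apply/mem_set; rewrite /= ltry.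
by case: ifP => _; rewrite ?mul1e ?mul0e.
Qed.

Let mean (Psi : Omega -> \bar R) (z : E) : \bar R := (\int[P z]_w Psi w)%E.

(** Measurability of z -> E_z(Psi) goes through the same induction, because each step integrates
    that function at X_t. *)
Let markov_const a t A (Psi : Omega -> \bar R) : 0 <= t -> history X t A ->
  measurable_fun (setT : set Omy) (Psi : Omy -> \bar R) -> (forall w, 0 <= Psi w)%E ->
  measurable_fun setT (mean Psi) /\
  (\int[P a]_w ((\1_(A `&` alive X t) w)%:E * Psi (theta t w)) =
   \int[P a]_w ((\1_A w)%:E * at_state 0%E (mean Psi) (X t w)))%E.
Proof.
move=> t0 hA; have mA := measurable_history (history_le hA).
have mal := measurable_history (history_le (history_alive t0)).
have mAal : measurable (A `&` alive X t) by exact: measurableI.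
have toO (h : Omega -> \bar R) : measurable_fun (setT : set Omy) (h : Omy -> \bar R) ->
    measurable_fun setT h.
  by move=> mh; exact: (measurableT_comp mh measurable_toOmy).
have toOt (h : Omega -> \bar R) : measurable_fun (setT : set Omy) (h : Omy -> \bar R) ->
    measurable_fun setT (fun w => h (theta t w)).
  by move=> mh; apply: toO; exact: (measurableT_comp mh (measurable_shift t0)).
have mI (B : set Omega) : measurable B -> measurable_fun setT (fun w => (\1_B w)%:E : \bar R).
  by move=> mB; apply/measurable_EFinP; exact: measurable_indic.
have at0 (f : E -> \bar R) w : (forall z, 0 <= f z)%E -> (0 <= at_state 0%E f (X t w))%E.
  by move=> f0; case: (X t w).
move: Psi; apply: (@ge0_measurable_ind _ Omy R (fun Psi => measurable_fun setT (mean Psi) /\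
  (\int[P a]_w ((\1_(A `&` alive X t) w)%:E * Psi (theta t w)) =
   \int[P a]_w ((\1_A w)%:E * at_state 0%E (mean Psi) (X t w)))%E)).
- have m0 : mean (cst 0%E) = cst 0%E by apply/funext => z; rewrite /mean integral0.
  split; first by rewrite m0; exact: measurable_cst.
  rewrite m0 !integral0_eq// => w _; last by rewrite mule0.
  by case: (X t w) => [z|]/=; rewrite mule0.
- move=> k B g k0 mB mg g0 [mgm gE].
  have mBo : measurable (B : set Omega) by exact: measurable_history.
  have mgo := toO _ mg.
  have B0 w : (0 <= k%:E * (\1_B w)%:E)%E by rewrite mule_ge0 ?lee_fin.
  have mkB : measurable_fun setT (fun w : Omega => k%:E * (\1_B w)%:E)%E.
    exact: measurable_funeM (mI _ mBo).
  have meanE z : mean (fun w => k%:E * (\1_B w)%:E + g w)%E z = (k%:E * P z B + mean g z)%E.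
    rewrite /mean ge0_integralD// ge0_integralZl//; [|exact: mI].
    by rewrite integral_indic// setIT.
  have mPB : measurable_fun setT (fun z => P z B) by exact: (mp_kernel MP mB).
  have mean0 z : (0 <= mean g z)%E by exact: integral_ge0.
  have -> : mean (fun w => k%:E * (\1_B w)%:E + g w)%E = (fun z => k%:E * P z B + mean g z)%E.
    by apply/funext.
  split.
    by apply: emeasurable_funD => //; exact: measurable_funeM.
  transitivity (k%:E * (\int[P a]_w (\1_((A `&` alive X t) `&` [set w | B (theta t w)]) w)%:E) +
      \int[P a]_w ((\1_(A `&` alive X t) w)%:E * g (theta t w)))%E.
    have mS : measurable [set w | B (theta t w)].
      have := measurable_shift t0 measurableT mB; rewrite setTI => h.
      exact: measurable_history h.
    rewrite -ge0_integralZl//; [|by apply: mI; exact: measurableI].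
    rewrite -ge0_integralD//.
    + apply: eq_integral => w _; rewrite ge0_muleDr; [|exact: B0|exact: g0].
      have iE : \1_((A `&` alive X t) `&` [set w | B (theta t w)]) w =
          \1_(A `&` alive X t) w * \1_B (theta t w) :> R.
        rewrite !indicE in_setI -natrM mulnb.
        by rewrite (_ : (w \in [set w | B (theta t w)]) = (theta t w \in B)).
      by rewrite iE EFinM [in RHS]muleCA.
    + by move=> w _; rewrite mule_ge0 ?lee_fin.
    + by apply: measurable_funeM; apply: mI; exact: measurableI.
    + by move=> w _; rewrite mule_ge0 ?lee_fin.
    + by apply: emeasurable_funM; [exact: mI|exact: toOt].
  have mS : measurable [set w | B (theta t w)].
    have := measurable_shift t0 measurableT mB; rewrite setTI => h.
    exact: measurable_history h.
  rewrite integral_indic ?setIT//; last exact: measurableI.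
  rewrite [X in (k%:E * X + _)%E](_ : _ =
    \int[P a]_w ((\1_A w)%:E * at_state 0 (fun z => P z B) (X t w)))%E; last first.
    exact: markov_const_set.
  rewrite gE -ge0_integralZl//; last 2 first.
  + by apply: emeasurable_funM; [exact: mI|exact: measurable_at].
  + by move=> w _; rewrite mule_ge0 ?lee_fin ?at0.
  rewrite -ge0_integralD//; last 4 first.
  + by move=> w _; rewrite mule_ge0 ?lee_fin// mule_ge0 ?lee_fin ?at0.
  + by apply: measurable_funeM; apply: emeasurable_funM; [exact: mI|exact: measurable_at].
  + by move=> w _; rewrite mule_ge0 ?lee_fin ?at0.
  + by apply: emeasurable_funM; [exact: mI|exact: measurable_at].
  apply: eq_integral => w _; case: (X t w) => [z|]/=; last by rewrite !mule0 adde0.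
  have kP0 : (0 <= k%:E * P z B)%E by rewrite mule_ge0 ?lee_fin.
  by rewrite (ge0_muleDr _ kP0 (mean0 z)) [in RHS]muleCA.
- move=> h mh h0 ndh hE.
  have ndw w : nondecreasing_seq (h ^~ w) := ndh w.
  have mho n := toO _ (mh n).
  have meanE z : mean (fun w => limn (h ^~ w)) z = limn (fun n => mean (h n) z).
    by rewrite /mean monotone_convergence// => w _; exact: ndw.
  have ndm z : nondecreasing_seq (fun n => mean (h n) z).
    move=> p q pq; apply: ge0_le_integral => //.
    by move=> w _; exact: ndw.
  have cvm z : cvgn (fun n => mean (h n) z) by exact: ereal_nondecreasing_is_cvgn.
  split.
    rewrite (_ : mean _ = fun z => limn (fun n => mean (h n) z)); last exact/funext.
    apply: (@emeasurable_fun_cvg _ _ _ _ (fun n => mean (h n))) => [n|z _].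
      by have [] := hE n.
    exact: cvm.
  transitivity (limn (fun n => \int[P a]_w ((\1_(A `&` alive X t) w)%:E * h n (theta t w))))%E.
    rewrite -monotone_convergence//.
    + apply: eq_integral => w _; apply/esym/cvg_lim => //; apply: cvgeMl => //.
      exact: ereal_nondecreasing_is_cvgn.
    + by move=> n; apply: emeasurable_funM; [exact: mI|exact: toOt].
    + by move=> n w _; rewrite mule_ge0 ?lee_fin.
    + by move=> w _ p q pq; rewrite lee_wpmul2l ?lee_fin// ndw.
  under eq_fun do rewrite (hE _).2.
  rewrite -monotone_convergence//.
  + apply: eq_integral => w _; case: (X t w) => [z|]/=; last first.
      exact: lim_cst.
    rewrite meanE; apply/cvg_lim => //; apply: cvgeMl => //; exact: cvm.
  + by move=> n; apply: emeasurable_funM; [exact: mI|apply: measurable_at => //; exact: (hE n).1].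
  + move=> n w _; rewrite mule_ge0 ?lee_fin//; apply: at0 => z; exact: integral_ge0.
  + move=> w _ p q pq; rewrite lee_wpmul2l ?lee_fin//.
    by case: (X t w) => [z|]//=; exact: ndm.
Qed.

Let after b t : set (Omega * R) := [set p | occ b p /\ L b t p.1 < p.2].

Let measurable_after b t : 0 <= t -> @measurable _ (Omy * R)%type (after b t).
Proof.
move=> t0; rewrite (_ : after b t = (occ b : set (Omy * R)) `\`
    [set p : Omy * R | p.2 <= L b t p.1]); last first.
  apply/seteqP; split => p [op h]; split => //=.
    by apply/negP; rewrite -ltNge.
  by rewrite ltNge; apply/negP.
apply: measurableD => //; rewrite -[X in measurable X]setTI.
apply: measurable_fun_le => //; exact: measurableT_comp (measurableLy _ _) _.
Qed.

(** By additivity the levels above L^b_t are those of the shifted path translated by L^b_t; a path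
    dead at t has none left. *)
Let after_sec b t w A : 0 <= t -> additive_at [::] b w ->
  leb [set u | A w /\ after b t (w, u)] =
  ((\1_(A `&` alive X t) w)%:E * total_local_time L b (theta t w))%E.
Proof.
move=> t0 [add _]; have cb := clockL b w.
have none : ~ (A `&` alive X t) w -> [set u | A w /\ after b t (w, u)] = set0.
  move=> h; apply/seteqP; split => // u [Aw [[/= u0 [s s0 us]] ut]].
  have /aliveN Xt : ~ alive X t w by move=> al; apply: h.
  move: us; apply/negP; rewrite -ltNge; apply: le_lt_trans ut.
  have [st|/ltW ts] := leP s t; first by case: cb => _ + _; apply.
  by rewrite (lt_cemetery (LT b) t0 ts Xt).
have [Aal|nAal] := pselect ((A `&` alive X t) w); last first.
  by rewrite none// measure0 indicE memNset// mul0e.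
rewrite indicE mem_set// mul1e -lebR_occ.
have mo : measurable [set v | occ b (theta t w, v)].
  have mpair : measurable_fun (setT : set R) (fun v : R => (theta t w, v) : Omy * R).
    by apply: measurable_fun_pair => //; exact: measurable_cst.
  by have := mpair measurableT _ (measurable_occ b); rewrite setTI.
have fgE s : 0 <= s -> L b (s + t) w = L b t w + L b s (theta t w) by exact: add.
rewrite -(lebR_shift (- L b t w) mo); congr lebR; apply/seteqP; split => u /=.
  move=> [_ [[u0 ru] tu]]; split; first by rewrite /= subr_gt0.
  exact/(reached_shift cb t0 fgE tu).
move=> [/=]; rewrite subr_gt0 => tu ru; split; first by case: Aal.
split; last exact: tu.
split; first exact: le_lt_trans (clock_ge0 cb t0) tu.
exact/(reached_shift cb t0 fgE tu).
Qed.

(** * The h-transform *)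

Section doob_transform.
Variables (a : E) (Pt : probability Omega R).
Hypotheses (g0 : 0 < green P L a a) (HT : h_transform P X L a Pt).

Let g : R := green P L a a.

Let meanL z : mean (fun w => total_local_time L a w) z = (green P L z a)%:E.
Proof. by rewrite greenE res0 fineK// -res0 ge0_fin_numE ?res_ge0// res_lty. Qed.

(** By the Markov property g(X_t, a) is the conditional mean of the local time at a gained after t,
    that is, of the length of the levels u with tau_u > t. So being alive at t under the transform
    corresponds to tau_u > t under P_a and du. *)
Lemma doob_alive t A : 0 <= t -> history X t A ->
  (g%:E * Pt (A `&` alive X t) = m a [set p | A p.1 /\ after a t p])%E.
Proof.
move=> t0 hA; rewrite HT//.
have tl0 w : (0 <= total_local_time L a w)%E by rewrite -lebR_occ measure_ge0.
have mtl : measurable_fun (setT : set Omy) (total_local_time L a : Omy -> \bar R).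
  by have := measurable_Phi [::] a; congr measurable_fun; apply/funext => w; exact: Phi0.
have [mm mE] := markov_const a t0 hA mtl tl0.
have mA : measurable A by exact: measurable_history (history_le hA).
have mI (B : set Omega) : measurable B -> measurable_fun setT (fun w => (\1_B w)%:E : \bar R).
  by move=> mB; apply/measurable_EFinP; exact: measurable_indic.
have at0 w : (0 <= at_state 0%E (mean (total_local_time L a)) (X t w))%E.
  by case: (X t w) => [z|]//=; exact: integral_ge0.
rewrite m_xsection; transitivity (\int[P a]_w
    ((\1_A w)%:E * at_state 0%E (mean (total_local_time L a)) (X t w)))%E.
  transitivity (g%:E * \int[P a]_w ((g^-1)%:E *
      ((\1_A w)%:E * at_state 0%E (mean (total_local_time L a)) (X t w))))%E.
    congr (_ * _)%E; rewrite integral_mkcond; apply: eq_integral => w _.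
    rewrite patchE indicE; case: ifP => _; last by rewrite mul0e mule0.
    rewrite mul1e; case: (X t w) => [z|]/=; last by rewrite mul0r mule0.
    by rewrite meanL -EFinM mulrC.
  rewrite ge0_integralZl//.
  - by rewrite muleA -EFinM divff ?mul1e// gt_eqF.
  - by apply: emeasurable_funM; [exact: mI|exact: measurable_at].
  - by move=> w _; rewrite mule_ge0 ?lee_fin.
  - by rewrite lee_fin invr_ge0 ltW.
have mtlt : measurable_fun setT (fun w => total_local_time L a (theta t w)).
  exact: (measurableT_comp (measurableT_comp mtl (measurable_shift t0)) measurable_toOmy).
have mal := measurable_history (history_le (history_alive t0)).
have mS : measurable [set p | A p.1 /\ after a t p].
  rewrite (_ : [set p | _] = (A `*` setT) `&` after a t).
    apply: measurableI; first exact: measurableX.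
    exact: measurableOR (measurable_after a t0).
  by apply/seteqP; split => p [] => [Ap ap|[Ap _] ap].
rewrite -mE; apply: ge0_ae_eq_integral => //.
- by apply: emeasurable_funM; [exact/mI/measurableI|exact: mtlt].
- exact: measurable_fun_xsection.
- by move=> w _; rewrite mule_ge0 ?lee_fin.
- have [N [mN N0 NE]] := ae_additive a [::] a.
  exists N; split => // w /= /not_implyP[_ h]; apply: NE => /= add; apply: h.
  rewrite -(after_sec A t0 add); congr lebR.
  by apply/seteqP; split => u; rewrite xsectionE.
Qed.

Let eadd_cancel (x c c' : \bar R) : x \is a fin_num -> (x + c = x + c')%E -> c = c'.
Proof. by move=> xf /(congr1 (fun u => u - x)%E); rewrite ![(x + _)%E]addeC !addeK. Qed.

Let doob_fun t (phi : Omega -> R) : 0 <= t ->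
  measurable_fun (setT : set (Omt t)) (phi : Omt t -> R) -> (forall w, 0 <= phi w) ->
  (g%:E * \int[Pt]_w ((\1_(alive X t) w)%:E * (phi w)%:E) =
   \int[m a]_p ((\1_(after a t) p)%:E * (phi p.1)%:E))%E.
Proof.
move=> t0 mphi phi0.
have mal := measurable_history (history_le (history_alive t0)).
have maf : measurable (after a t : set (Omega * R)) := measurableOR (measurable_after a t0).
have toOmt : measurable_fun setT (fun w : Omega => w : Omt t).
  by move=> _ B mB; rewrite setTI; exact: measurable_history (history_le mB).
have g0' : (0 <= g%:E)%E by rewrite lee_fin ltW.
have mI d1 (T : measurableType d1) (B : set T) : measurable B ->
    measurable_fun setT (fun w => (\1_B w)%:E : \bar R).
  by move=> mB; apply/measurable_EFinP; exact: measurable_indic.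
have mphiE : measurable_fun (setT : set (Omt t)) (fun w : Omt t => (phi w)%:E).
  exact/measurable_EFinP.
rewrite -ge0_integralZl//; last 2 first.
- by apply: emeasurable_funM; [exact: mI|exact: (measurableT_comp mphiE toOmt)].
- by move=> w _; rewrite mule_ge0 ?lee_fin.
under eq_integral do rewrite muleA.
apply: (@integral_comp_eq _ _ _ Omega (Omega * R)%type (Omt t) R Pt (m a)
  (fun w => w) fst (fun w => g%:E * (\1_(alive X t) w)%:E)%E
  (fun p => (\1_(after a t) p)%:E) _ _ _ _ _ _ _ (fun w : Omt t => (phi w)%:E)) => //.
- exact: (measurableT_comp toOmt measurable_fst).
- by apply: measurable_funeM; exact: mI.
- exact: mI.
- by move=> w; rewrite mule_ge0 ?lee_fin.
- move=> A hA; have mA : measurable (A : set Omega) := measurable_history (history_le hA).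
  transitivity (g%:E * \int[Pt]_w (\1_(A `&` alive X t) w)%:E)%E.
    rewrite -ge0_integralZl//.
    + apply: eq_integral => w _.
      have iE : \1_(A `&` alive X t) w = \1_(alive X t) w * \1_A w :> R.
        by rewrite !indicE in_setI andbC -natrM mulnb.
      by rewrite iE EFinM muleA.
    + by apply: mI; exact: measurableI.
  rewrite integral_indic ?setIT//; last exact: measurableI.
  rewrite [LHS](doob_alive t0 hA) -[in LHS](setIT [set p | _]).
  rewrite -integral_indic//; last first.
    rewrite (_ : [set p | _] = (A `*` setT) `&` after a t).
      by apply: measurableI => //; exact: measurableX.
    by apply/seteqP; split => p [] => [Ap ap|[Ap _] ap].
  apply: eq_integral => p _; rewrite -EFinM; congr EFin; rewrite !indicE -natrM mulnb.
  congr (nat_of_bool _)%:R; apply/idP/andP.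
    by rewrite inE => -[Ap ap]; split; exact/mem_set.
  by move=> [/set_mem ap /set_mem Ap]; apply/mem_set.
Qed.

Let alive_mono s t w : 0 <= s -> s <= t -> alive X t w -> alive X s w.
Proof.
move=> s0 st al; apply: contrapT => /aliveN Xs.
by move: al; rewrite /alive /visits /= (mp_cemetery MP s0 st Xs) => -[].
Qed.

Let after_mono s t p : 0 <= s -> s <= t -> after a t p -> after a s p.
Proof.
move=> s0 st [op tp]; split => //; apply: le_lt_trans tp.
exact: (lt_nondecreasing (LT a)).
Qed.

(** The difference of [doob_fun] at s and t, for a functional of the past of s: death within the
    cell corresponds to tau_u falling in it. The bound by 1 makes the cancelled term finite. *)
Let doob_cell s t (phi : Omega -> R) : 0 <= s -> s <= t ->
  measurable_fun (setT : set (Omt s)) (phi : Omt s -> R) -> (forall w, 0 <= phi w <= 1) ->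
  (g%:E * \int[Pt]_w (\1_(alive X s `\` alive X t) w * phi w)%:E =
   \int[m a]_p (\1_(after a s `\` after a t) p * phi p.1)%:E)%E.
Proof.
move=> s0 st mphi phi01; have t0 := le_trans s0 st.
have phi0 w : 0 <= phi w by have /andP[] := phi01 w.
have mphit : measurable_fun (setT : set (Omt t)) (phi : Omt t -> R).
  move=> _ B mB; have := mphi measurableT B mB; rewrite !setTI => h.
  exact: history_mono st h.
have mphio : measurable_fun setT phi.
  move=> _ B mB; have := mphi measurableT B mB; rewrite !setTI => h.
  exact: measurable_history (history_le h).
have mal r : 0 <= r -> measurable (alive X r).
  by move=> r0; exact: measurable_history (history_le (history_alive r0)).
have maf r : 0 <= r -> measurable (after a r : set (Omega * R)).
  by move=> r0; exact: measurableOR (measurable_after a r0).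
have split d1 (T : measurableType d1) (mu : {measure set T -> \bar R}) (B C : set T)
    (f : T -> R) : measurable B -> measurable C -> C `<=` B -> measurable_fun setT f ->
    (forall x, 0 <= f x) -> (\int[mu]_x ((\1_B x)%:E * (f x)%:E) =
    \int[mu]_x ((\1_C x)%:E * (f x)%:E) + \int[mu]_x (\1_(B `\` C) x * f x)%:E)%E.
  move=> mB mC CB mf f0; rewrite -ge0_integralD//.
  - apply: eq_integral => x _; rewrite -!EFinM -EFinD -mulrDl; congr (_ * _)%:E.
    rewrite !indicE in_setD; have [Cx|Cx] := boolP (x \in C).
      by rewrite (mem_set (CB _ (set_mem Cx))) andbF addr0.
    by rewrite andbT add0r.
  - by move=> x _; rewrite -EFinM lee_fin mulr_ge0.
  - by apply: emeasurable_funM; apply/measurable_EFinP => //; exact: measurable_indic.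
  - by move=> x _; rewrite lee_fin mulr_ge0.
  - apply/measurable_EFinP; apply: measurable_funM => //.
    by apply: measurable_indic; exact: measurableD.
have E1 := split _ _ Pt _ _ _ (mal _ s0) (mal _ t0) (fun w => alive_mono s0 st) mphio phi0.
have E2 := split _ _ (m a) _ _ _ (maf _ s0) (maf _ t0) (fun p => after_mono s0 st)
  (measurableT_comp mphio measurable_fst) (fun p => phi0 p.1).
have Ds := doob_fun s0 mphi phi0; have Dt := doob_fun t0 mphit phi0.
move: Ds; rewrite E1 E2 ge0_muleDr; last 2 first.
- by apply: integral_ge0 => w _; rewrite -EFinM lee_fin mulr_ge0.
- by apply: integral_ge0 => w _; rewrite lee_fin mulr_ge0.
have xfin : (g%:E * \int[Pt]_x ((\1_(alive X t) x)%:E * (phi x)%:E))%E \is a fin_num.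
  rewrite fin_numM// ge0_fin_numE.
    apply: (@le_lt_trans _ _ (\int[Pt]_w (cst 1 w))%E); last first.
      rewrite integral_cst// mul1e; apply: (le_lt_trans (probability_le1 Pt measurableT)).
      exact: ltry.
    apply: ge0_le_integral => //.
    - by move=> w _; rewrite -EFinM lee_fin mulr_ge0.
    - apply: emeasurable_funM; apply/measurable_EFinP => //.
      by apply: measurable_indic; exact: mal.
    - move=> w _; rewrite -EFinM lee_fin; have /andP[_ p1] := phi01 w.
      by rewrite indicE; case: (_ \in _); rewrite ?mul1r ?mul0r.
  by apply: integral_ge0 => w _; rewrite -EFinM lee_fin mulr_ge0.
by rewrite -Dt => /(eadd_cancel xfin).
Qed.

Let gsum (D : R -> bool) (f : R -> R) (N : nat) : R :=
  \sum_(k < N.+1 * N.+1) (~~ D (grid N k) && D (grid N k.+1))%:R * expR (- f (grid N k)).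

(** Each term is bounded by the increment of the indicator of D, which is monotone, and the
    increments telescope. *)
Let gsum01 (D : R -> bool) (f : R -> R) N :
  (forall s t, 0 <= s -> s <= t -> D s -> D t) -> (forall t, 0 <= t -> 0 <= f t) ->
  0 <= gsum D f N <= 1.
Proof.
move=> Dm f0; rewrite /gsum sumr_ge0/=; last by move=> k _; rewrite mulr_ge0// expR_ge0.
apply: (@le_trans _ _ (\sum_(k < N.+1 * N.+1) ((D (grid N k.+1))%:R - (D (grid N k))%:R))).
  apply: ler_sum => k _; have := Dm _ _ (grid_ge0 N k) (grid_le N (leqnSn k)).
  case: (D (grid N k)) => [->//|_]; first by rewrite mul0r subrr.
  case: (D (grid N k.+1)); rewrite ?mul0r ?subr0// mul1r.
  by rewrite -expR0 ler_expR oppr_le0 f0.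
rewrite -(big_mkord xpredT (fun k => (D (grid N k.+1))%:R - (D (grid N k))%:R : R)).
by rewrite telescope_sumr//; case: (D _); case: (D _); rewrite ?subrr ?subr0 ?sub0r.
Qed.

Section doob_sums.
Variable s : seq (R * E).
Hypothesis ns : nngs s.

Let ls (w : Omega) (t : R) : R := lsum s (fun x => L x t w).

Let ls_ge0 w t : 0 <= t -> 0 <= ls w t.
Proof. move=> t0; apply: (lsum_ge0 ns) => x; exact: (clock_ge0 (clockL x w) t0). Qed.

Let clock_ls w : clock (ls w).
Proof. exact: (@clock_lsum _ _ s (fun x t => L x t w)). Qed.

Let dead (w : Omega) (t : R) : bool := `[< ~ alive X t w >].

(** The value of exp(-<s, L>) at the last grid point before the lifetime; [GN] does the same before
    tau_u. Each cell uses the past of its left end only, as [doob_cell] requires. *)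
Let FN (N : nat) (w : Omega) : R := gsum (dead w) (ls w) N.

Let GN (N : nat) (p : Omega * R) : R :=
  \1_(occ a) p * gsum (fun t => p.2 <= L a t p.1) (ls p.1) N.

Let measurable_ls t : 0 <= t -> measurable_fun (setT : set (Omt t)) (ls ^~ t : Omt t -> R).
Proof.
move=> t0; apply: (@measurable_lsum _ (Omt t) R E s (fun x w => L x t w)) => x.
by apply: measurableLt.
Qed.

Let mexp_ls t : 0 <= t -> measurable_fun (setT : set (Omt t)) (fun w : Omt t => expR (- ls w t)).
Proof.
by move=> t0; do 2 apply: measurableT_comp => //; exact: measurable_ls.
Qed.

Let exp_ls01 w t : 0 <= t -> 0 <= expR (- ls w t) <= 1.
Proof.
by move=> t0; rewrite expR_ge0 -expR0 ler_expR oppr_le0 ls_ge0.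
Qed.

Let mexp_lso t : 0 <= t -> measurable_fun setT (fun w : Omega => expR (- ls w t)).
Proof.
move=> t0 _ B mB; have := mexp_ls t0 measurableT mB; rewrite !setTI => h.
exact: measurable_history (history_le h).
Qed.

Let FNE N w : FN N w = \sum_(k < N.+1 * N.+1)
  (\1_(alive X (grid N k) `\` alive X (grid N k.+1)) w * expR (- ls w (grid N k))).
Proof.
apply: eq_bigr => k _; congr ((nat_of_bool _)%:R * _).
rewrite in_setD /dead asbool_neg negbK asbool_neg.
by congr andb.
Qed.

Let GNE N p : GN N p = \sum_(k < N.+1 * N.+1)
  (\1_(after a (grid N k) `\` after a (grid N k.+1)) p * expR (- ls p.1 (grid N k))).
Proof.
rewrite /GN /gsum mulr_sumr; apply: eq_bigr => k _; rewrite mulrA; congr (_ * _).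
rewrite !indicE in_setD -natrM mulnb; congr (nat_of_bool _)%:R.
apply/and3P/andP => [[/set_mem op h1 h2]|[/set_mem[op h1] h2]].
  split; first by apply/mem_set; split => //; rewrite ltNge.
  by apply: contraL h2 => /set_mem[_ /=]; rewrite -ltNge.
split; [exact/mem_set|by rewrite -ltNge|].
by rewrite leNgt; apply: contra h2 => h; apply/mem_set.
Qed.

Let mal r : 0 <= r -> measurable (alive X r).
Proof. by move=> r0; exact: measurable_history (history_le (history_alive r0)). Qed.

Let maf r : 0 <= r -> measurable (after a r : set (Omega * R)).
Proof. by move=> r0; exact: measurableOR (measurable_after a r0). Qed.

Let mcellP N k : measurable_fun setT (fun w : Omega =>
  \1_(alive X (grid N k) `\` alive X (grid N k.+1)) w * expR (- ls w (grid N k))).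
Proof.
apply: measurable_funM.
  by apply: measurable_indic; apply: measurableD; apply: mal.
exact: mexp_lso (grid_ge0 N k).
Qed.

Let mcellM N k : measurable_fun setT (fun p : Omega * R =>
  \1_(after a (grid N k) `\` after a (grid N k.+1)) p * expR (- ls p.1 (grid N k))).
Proof.
apply: measurable_funM.
  by apply: measurable_indic; apply: measurableD; apply: maf.
exact: (measurableT_comp (mexp_lso (grid_ge0 N k)) measurable_fst).
Qed.

Let doob_sum N : (g%:E * \int[Pt]_w (FN N w)%:E = \int[m a]_p (GN N p)%:E)%E.
Proof.
under eq_integral do rewrite FNE -sumEFin.
under [RHS]eq_integral do rewrite GNE -sumEFin.
rewrite !ge0_integral_sum//; last 2 first.
- by move=> k; apply/measurable_EFinP; exact: mcellM.
- by move=> k; apply/measurable_EFinP; exact: mcellP.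
rewrite ge0_sume_distrr; last first.
  by move=> k _; apply: integral_ge0 => w _; rewrite lee_fin mulr_ge0// expR_ge0.
apply: eq_bigr => k _; apply: (@doob_cell (grid N k) (grid N k.+1) (fun w => expR (- ls w (grid N k)))) => //.
- exact: grid_le.
- exact: mexp_ls.
- by move=> w; exact: exp_ls01.
Qed.

Let GN_cvg p : GN N p @[N --> \oo] --> kern s a p.
Proof.
rewrite /GN /kern; have [op|nop] := pselect (occ a p); last first.
  by rewrite indicE memNset// !mul0r; under eq_fun do rewrite mul0r; exact: cvg_cst.
apply: cvgM; first exact: cvg_cst.
have -> : lexp s (stopL a p) = expR (- ls p.1 (inf [set t | 0 <= t /\ p.2 <= L a t p.1])).
  by rewrite /lexp /stopL asboolT.
case: op => p0 rp; apply: grid_cvg => //.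
  by rewrite (lt_start (LT a)) -ltNge.
by move=> t r t0 tr h; apply: (le_trans h); exact: (lt_nondecreasing (LT a)).
Qed.

Let mass_occ : m a (occ a) = g%:E.
Proof.
rewrite /g greenE fineK; last by rewrite ge0_fin_numE ?res_ge0// res_lty.
have mo : measurable (occ a : set (Omega * R)) := measurableOR (measurable_occ a).
transitivity (\int[m a]_p (\1_(occ a) p)%:E)%E; first by rewrite integral_indic// setIT.
rewrite /res; apply: eq_integral => p _.
by rewrite /kern lexp_nil mulr1.
Qed.

Let after0 : after a 0 = occ a.
Proof.
apply/seteqP; split => p [] //= p0 rp; split => //=.
by rewrite (lt_start (LT a)).
Qed.

Let scale_fin (x : \bar R) (c : R) : x \is a fin_num -> (g%:E * x = c%:E)%E ->
  x = (c / g)%:E.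
Proof.
by move=> /fineK <-; rewrite -EFinM => -[<-]; rewrite mulrAC divff ?mul1r// gt_eqF.
Qed.

(** Multiplied by g, the probability of being alive at n is the mass of {tau_u > n}, which decreases
    to 0 because each level of [occ a] is reached in finite time. At time 0 that mass is g. *)
Let doob_dies : {ae Pt, forall w, alive X 0 w /\ exists n : nat, ~ alive X n%:R w}.
Proof.
have maln n : measurable (alive X n%:R) by exact: mal.
have mcap : measurable (\bigcap_n (alive X n%:R : set Omega)) by exact: bigcapT_measurable.
have gfin : g%:E \is a fin_num by [].
have doobT t : 0 <= t -> (g%:E * Pt (alive X t) = m a (after a t))%E.
  move=> t0; have := doob_alive t0 (@measurableT _ (Omt t)); rewrite setTI => ->.
  by congr (m a _); apply/seteqP; split => p //= [].
have P1 : Pt (alive X 0) = 1%E.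
  have := doobT 0 (lexx _); rewrite after0 mass_occ.
  move/(scale_fin (fin_num_measure Pt _ (mal (lexx 0)))) ->.
  by rewrite divff// gt_eqF.
have P0 : Pt (\bigcap_n (alive X n%:R : set Omega)) = 0%E.
  have cv : m a (after a n%:R) @[n --> \oo] --> m a (\bigcap_n (after a n%:R : set (Omega * R))).
    apply: nonincreasing_cvg_mu.
    - by rewrite after0 mass_occ ltry.
    - by move=> n; exact: maf.
    - by apply: bigcapT_measurable => n; exact: maf.
    - move=> i j ij; apply/subsetPset => p; apply: after_mono => //.
      by rewrite ler_nat.
  have cap0 : \bigcap_n (after a n%:R : set (Omega * R)) = set0.
    apply/seteqP; split => // p h; have [[p0 rp] _] := h 0%N I.
    have [k pk] := (reached_nat p.2 (clockL a p.1)).1 rp.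
    by have [_] := h k I; rewrite ltNge pk.
  rewrite cap0 measure0 in cv.
  have : (g%:E * Pt (\bigcap_n (alive X n%:R : set Omega)) <= 0)%E.
    rewrite -(cvg_lim _ cv)//; apply: lime_ge; first by apply/cvg_ex; exists 0%E.
    apply: nearW => n; rewrite -doobT//; apply: lee_wpmul2l; first by rewrite lee_fin ltW.
    by apply: le_measure; rewrite ?inE//; exact: bigcap_inf.
  move=> h; have /(scale_fin (fin_num_measure Pt _ mcap)) -> :
      (g%:E * Pt (\bigcap_n (alive X n%:R : set Omega)) = 0%:E)%E.
    by apply/eqP; rewrite eq_le h mule_ge0// lee_fin ltW.
  by rewrite mul0r.
exists (~` alive X 0 `|` \bigcap_n (alive X n%:R : set Omega)); split.
- by apply: measurableU => //; apply: measurableC; exact: mal.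
- apply/eqP; rewrite eq_le measure_ge0 andbT.
  apply: (le_trans (measureU2 _ _ _)) => //; first by apply: measurableC; exact: mal.
  have P1C : Pt (~` alive X 0) = 0%E.
    by rewrite probability_setC ?P1 ?subee//; exact: mal.
  rewrite [X in (X + _)%E](_ : _ = 0%E) ?[X in (_ + X)%E](_ : _ = 0%E) ?adde0//.
- move=> w /= /not_andP[h|h]; [by left|right => n _].
  by apply: contrapT => hn; apply: h; exists n.
Qed.

Let dead_const x w t r : 0 <= t -> t <= r -> dead w t -> L x r w = L x t w.
Proof.
by move=> t0 tr /asboolP/aliveN; exact: (lt_cemetery (LT x)).
Qed.

Let total_dead x w t : 0 <= t -> dead w t -> total_local_time L x w = (L x t w)%:E.
Proof.
move=> t0 dt; apply/eqP; rewrite eq_le; apply/andP; split; last first.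
  by apply: ereal_sup_ubound; exists t.
apply: ge_ereal_sup => _ [r r0 <-]; rewrite lee_fin; have [rt|/ltW tr] := leP r t.
  exact: (lt_nondecreasing (LT x)).
by rewrite (dead_const x t0 tr dt).
Qed.

Let Linf x w : R := fine (total_local_time L x w).

(** Local times are frozen after death, so by continuity their value at the lifetime is the total
    local time, even for a path still alive at that instant. *)
Let FN_cvg w : alive X 0 w -> (exists n : nat, ~ alive X n%:R w) ->
  FN N w @[N --> \oo] --> lexp s (Linf ^~ w).
Proof.
move=> al [n /asboolP dn].
have -> : lexp s (Linf ^~ w) = expR (- ls w (inf [set t | 0 <= t /\ dead w t])).
  rewrite (@clock_stopped (dead w) (ls w) n%:R)//.
    rewrite /lexp /ls; congr (expR (- lsum s _)); apply/funext => x.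
    by rewrite /Linf (total_dead x _ dn).
  move=> t r t0 tr dt; rewrite /ls; congr (lsum s _); apply/funext => x.
  exact: dead_const dt.
apply: grid_cvg => //.
- by rewrite /dead asbool_neg negbK; apply/asboolP.
- by exists n%:R.
- move=> t r t0 tr; rewrite /dead !asbool_neg; apply: contra => /asboolP h.
  by apply/asboolP; exact: alive_mono tr h.
Qed.

Let measurable_Linf x : measurable_fun setT (Linf x).
Proof.
apply: measurableT_comp => //.
have := measurableT_comp (measurable_Phi [::] x) measurable_toOmy.
by congr measurable_fun; apply/funext => w; exact: Phi0.
Qed.

(** The grid sums have matching integrals by [doob_sum]. They are bounded by 1 on one side and by
    the indicator of [occ a] on the other, both of finite mass, so dominated convergence applies to
    each. *)
Lemma doob_laplace : (g%:E * \int[Pt]_w (lexp s (Linf ^~ w))%:E = res s a a)%E.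
Proof.
have mFN N : measurable_fun setT (FN N).
  by rewrite (funext (FNE N)); apply: measurable_sum => k; exact: mcellP.
have mGN N : measurable_fun setT (GN N).
  by rewrite (funext (GNE N)); apply: measurable_sum => k; exact: mcellM.
have mo : measurable (occ a : set (Omega * R)) := measurableOR (measurable_occ a).
have mL : measurable_fun setT (fun w => lexp s (Linf ^~ w)).
  exact: (measurable_lexp _ measurable_Linf).
have FN01 N w : 0 <= FN N w <= 1.
  apply: gsum01 => [t r t0 tr|t t0]; last exact: ls_ge0.
  by rewrite /dead !asbool_neg; apply: contra => /asboolP h; apply/asboolP; exact: alive_mono tr h.
have gs01 N p : 0 <= gsum (fun t => p.2 <= L a t p.1) (ls p.1) N <= 1.
  apply: gsum01 => [t r t0 tr h|t t0]; last exact: ls_ge0.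
  by apply: (le_trans h); exact: (lt_nondecreasing (LT a)).
have cP : (\int[Pt]_w (FN N w)%:E @[N --> \oo] --> \int[Pt]_w (lexp s (Linf ^~ w))%:E)%E.
  have [//|||||_ _] := @dominated_convergence _ _ R Pt setT measurableT
    (fun N w => (FN N w)%:E) (fun w => (lexp s (Linf ^~ w))%:E) (cst 1%E); last exact.
  - by move=> N; exact/measurable_EFinP.
  - exact/measurable_EFinP.
  - apply: filterS doob_dies => w [al dw] _; apply/cvg_EFin; first exact: nearW.
    exact: FN_cvg.
  - apply/integrableP; split; first exact: measurable_cst.
    under eq_integral do rewrite abse1.
    rewrite integral_cst// mul1e; apply: (le_lt_trans (probability_le1 Pt measurableT)).
    exact: ltry.
  - apply: aeW => w N _; have /andP[F0 F1] := FN01 N w.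
    by rewrite lee_fin ger0_norm.
have cM : (\int[m a]_p (GN N p)%:E @[N --> \oo] --> \int[m a]_p (kern s a p)%:E)%E.
  have [//|||||_ _] := @dominated_convergence _ _ R (m a) setT measurableT
    (fun N p => (GN N p)%:E) (fun p => (kern s a p)%:E) (fun p => (\1_(occ a) p)%:E); last exact.
  - by move=> N; exact/measurable_EFinP.
  - exact: measurable_kernE.
  - by apply: aeW => p _; apply/cvg_EFin; [exact: nearW|exact: GN_cvg].
  - apply/integrableP; split; first by apply/measurable_EFinP; exact: measurable_indic.
    under eq_integral do rewrite gee0_abs//.
    by rewrite integral_indic// setIT mass_occ ltry.
  - apply: aeW => p N _; have /andP[F0 F1] := gs01 N p.
    rewrite lee_fin ger0_norm ?mulr_ge0//.
    by rewrite /GN -[leRHS]mulr1 ler_wpM2l.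
have cg : (g%:E * \int[Pt]_w (FN N w)%:E @[N --> \oo] -->
    g%:E * \int[Pt]_w (lexp s (Linf ^~ w))%:E)%E by exact: cvgeMl.
move: cg; rewrite (funext doob_sum) => cg.
exact: (cvg_unique _ cg cM).
Qed.

End doob_sums.

End doob_transform.

(** * The occupation law and its identification under the h-transform *)

Let stopP (a : E) (p : Omega * R) : paths E R := stopL a p.

Let measurable_stopP a : measurable_fun setT (stopP a).
Proof.
apply: measurable_to_paths => x.
exact: (measurableT_comp (measurable_stopL a x) measurable_toOmyR).
Qed.

Let occ_ind_ge0 a (p : Omega * R) : 0 <= \1_(occ a) p :> R.
Proof. by []. Qed.

Let measurable_occ_ind a : measurable_fun setT (\1_(occ a) : Omega * R -> R).
Proof. by apply: measurable_indic; exact: measurableOR (measurable_occ a). Qed.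

Let occ_law a : {measure set (paths E R) -> \bar R} :=
  wpush (m a) (occ_ind_ge0 a) (measurable_occ_ind a) (measurable_stopP a).

Let occ_law_laplace a s : (\int[occ_law a]_y (lexp s y)%:E = res s a a)%E.
Proof.
rewrite integral_wpush//.
- by apply/measurable_EFinP; exact: (measurable_lexp _ measurable_coord).
- by move=> y; rewrite lee_fin lexp_ge0.
Qed.

Let occ_law_lty a : (occ_law a setT < +oo)%E.
Proof.
have := @res_lty [::] a a isT; rewrite -occ_law_laplace.
by under eq_integral do rewrite lexp_nil; rewrite integral_cst// mul1e.
Qed.

(* the law of the local times stopped at the inverse local time of [a], under
   P_a and Lebesgue measure for the level *)
Definition occupation_law (a : E) : {finite_measure set (paths E R) -> \bar R} :=
  finite_meas (occ_law_lty a).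

Let occupation_laplace a s : (\int[occupation_law a]_y (lexp s y)%:E = res s a a)%E.
Proof. exact: occ_law_laplace. Qed.

Let resm_occupation s a : resm occupation_law s a = resR s a a.
Proof. by rewrite /resm occupation_laplace. Qed.

Let detm_occupation s : detm occupation_law s = dets s.
Proof. by elim: s => [//|c s IH] /=; rewrite IH resm_occupation. Qed.

Let occupation_lty s a : nngs s -> (\int[occupation_law a]_y (lexp s y)%:E < +oo)%E.
Proof. by move=> ns; rewrite occupation_laplace res_lty. Qed.

Let occupation_neg a x : occupation_law a [set y : paths E R | y x < 0] = 0%E.
Proof.
change (occ_law a [set y : paths E R | y x < 0] = 0%E).
apply: wpush_null; first exact: measurable_neg_coord.
rewrite (_ : _ @^-1` _ = set0) ?measure0//; apply/seteqP; split => // p /=.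
by rewrite /stopP ltNge stopL_ge0.
Qed.

Let occupation_pos a : occupation_law a (~` [set y : paths E R | 0 < y a]) = 0%E.
Proof.
change (occ_law a (~` [set y : paths E R | 0 < y a]) = 0%E).
rewrite wpushE; apply: integral0_eq => p _; have [op|nop] := pselect (occ a p).
  rewrite [X in (_ * X%:E)%E]indicE memNset ?mule0//=.
  by rewrite /stopP stopL_self//; case: op => p0 _; apply.
by rewrite [X in (X%:E * _)%E]indicE memNset// mul0e.
Qed.

Let occupation_cons s a (t : R) : nngs s -> 0 <= t ->
  resm occupation_law s a = resm occupation_law ((t, a) :: s) a * (1 + t * resm occupation_law s a).
Proof.
move=> ns t0; rewrite !resm_occupation {1}(resR_cons a a a ns t0).
by rewrite mulrDr mulr1 mulrCA mulrA [t * _]mulrC -!mulrA.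
Qed.

Let measurable_hpsi x : measurable_fun setT (hpsi x).
Proof. by apply: measurable_funM => //; exact: measurable_funP. Qed.

Let hpsi_neg x : Q [set w | hpsi x w < 0] = 0%E.
Proof.
have mN : measurable [set w | hpsi x w < 0].
  have := measurable_hpsi x measurableT (@measurable_itv R `]-oo, 0[).
  by rewrite setTI; congr measurable; apply/seteqP; split => w /=; rewrite in_itv.
have [[N [mN' N0 NE]] _] : {ae Q, forall w, 0 <= psi x w} /\ True.
  by split => //; exact: (proj1 PS).
apply: (subset_measure0 mN mN' _ N0) => w /= hw; apply: NE => /= pw.
by move: hw; rewrite /hpsi ltNge divr_ge0.
Qed.

Let laplace_hpsi s : nngs s ->
  (\int[Q]_w (lexp s (hpsi ^~ w))%:E = (detm occupation_law s `^ (- 2^-1))%:E)%E.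
Proof. by move=> ns; rewrite detm_occupation laplace_psi. Qed.

Section law_under_transform.
Variables (a : E) (Pt : probability Omega R).
Hypotheses (g0 : 0 < green P L a a) (HT : h_transform P X L a Pt).

Let g : R := green P L a a.
Let Linf x w : R := fine (total_local_time L x w).
Let LinfP (w : Omega) : paths E R := Linf ^~ w.

Let measurable_LinfP : measurable_fun setT LinfP.
Proof.
apply: measurable_to_paths => x; change (measurable_fun setT (Linf x)).
apply: measurableT_comp => //; have := measurableT_comp (measurable_Phi [::] x) measurable_toOmy.
by congr measurable_fun; apply/funext => w; exact: Phi0.
Qed.

Let gc_ge0 (w : Omega) : 0 <= g. Proof. exact: ltW. Qed.

Let scaled : {measure set (paths E R) -> \bar R} :=
  wpush Pt gc_ge0 (@measurable_cst _ _ Omega R setT g) measurable_LinfP.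

Let scaled_laplace s : nngs s -> (\int[scaled]_y (lexp s y)%:E = res s a a)%E.
Proof.
move=> ns.
have ml : measurable_fun setT (fun y : paths E R => (lexp s y)%:E).
  by apply/measurable_EFinP; exact: (measurable_lexp _ measurable_coord).
rewrite integral_wpush//; last by move=> y; rewrite lee_fin lexp_ge0.
rewrite ge0_integralZl//; last 3 first.
- exact: (measurableT_comp ml measurable_LinfP).
- by move=> w _; rewrite lee_fin lexp_ge0.
- by rewrite lee_fin ltW.
exact: doob_laplace.
Qed.

Let total_mass (mu : {measure set (paths E R) -> \bar R}) :
  mu setT = (\int[mu]_y (lexp ([::] : seq (R * E)) y)%:E)%E.
Proof. by under eq_integral do rewrite lexp_nil; rewrite integral_cst// mul1e. Qed.

(** Both measures have transform [res s a a], one by construction and the other by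
    [doob_laplace]. *)
Lemma law_total_local_times A : measurable A -> scaled A = occupation_law a A.
Proof.
move=> mA; apply: (@laplace_unique _ _ _ E scaled (occupation_law a) (fun x y => y x)) => //.
- by rewrite total_mass scaled_laplace// res_lty.
- by rewrite total_mass occupation_laplace res_lty.
- exact: measurable_coord.
- move=> x; apply: wpush_null; first exact: measurable_neg_coord.
  rewrite (_ : _ @^-1` _ = set0) ?measure0//; apply/seteqP; split => // w /=.
  by rewrite /LinfP /Linf ltNge fine_ge0// -lebR_occ measure_ge0.
- by move=> x; exact: occupation_neg.
- by move=> s ns; rewrite scaled_laplace// occupation_laplace.
Qed.

(** The density 1/(2 y_a) is carried over to the total local times; on A the coordinate at a is
    positive, so [invp] is the true inverse there. *)
Lemma num_total_local_times (A : set (paths E R)) : measurable A -> A `<=` [set y | 0 < y a] ->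
  num occupation_law a A =
  (\int[Pt]_(w in [set w | A (Linf ^~ w)]) (g / (2 * Linf a w))%:E)%E.
Proof.
move=> mA Aa.
have mi : measurable_fun setT (fun y : paths E R => (invp (y a) / 2)%:E * (\1_A y)%:E)%E.
  apply: emeasurable_funM; apply/measurable_EFinP; last exact: measurable_indic.
  apply: measurable_funM => //.
  exact: (measurableT_comp measurable_invp (measurable_coord a)).
have i0 (y : paths E R) : (0 <= (invp (y a) / 2)%:E * (\1_A y)%:E)%E.
  by rewrite mule_ge0 ?lee_fin// divr_ge0// invp_ge0.
transitivity (\int[scaled]_y ((invp (y a) / 2)%:E * (\1_A y)%:E))%E.
  by apply/esym/eq_measure_integral => B mB _; exact: law_total_local_times.
rewrite integral_wpush// [RHS]integral_mkcond; apply: eq_integral => w _.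
rewrite patchE; have [Aw|nAw] := boolP (w \in [set w | A (Linf ^~ w)]).
  have Aw' : A (LinfP w) by exact: set_mem Aw.
  rewrite indicE mem_set// mule1 -EFinM; congr EFin.
  have /= L0 := Aa _ Aw'; rewrite (invpE L0) /LinfP invfM; ring.
by rewrite indicE memNset ?mule0// => Aw; move/negP: nAw; apply; exact: mem_set.
Qed.

End law_under_transform.

Let Linf x w : R := fine (total_local_time L x w).

Lemma permanental_infinitely_divisible :
  infinitely_divisible_process Q (fun x => psi x : Omega' -> R).
Proof.
move=> n x; rewrite (_ : (fun i => psi (x i) : Omega' -> R) =
    (fun i w => 2 * hpsi (x i) w)); last first.
  by apply/funext => i; apply/funext => w; rewrite /hpsi mulrC divfK.
exact: (marginal_infinitely_divisible occupation_lty occupation_neg occupation_pos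
  occupation_cons measurable_hpsi hpsi_neg laplace_hpsi).
Qed.

Let preimage_pos n (x : 'I_n -> E) i (B : set (n.-tuple R)) :
  B `<=` [set y | 0 < tnth y i] ->
  [set y : paths E R | B (vec (fun j => y (x j)))] `<=` [set y | 0 < y (x i)].
Proof. by move=> Bi y /Bi /=; rewrite tnth_mktuple. Qed.

Let measurable_preimage n (x : 'I_n -> E) (B : set (n.-tuple R)) : measurable B ->
  measurable [set y : paths E R | B (vec (fun j => y (x j)))].
Proof. by move=> mB; rewrite -[X in measurable X]setTI; exact: measurable_vec. Qed.

Lemma levy_marginal_law n (x : 'I_n -> E) i (Pt : probability Omega R)
    (nu : {measure set (n.-tuple R) -> \bar R}) (B : set (n.-tuple R)) :
  0 < green P L (x i) (x i) -> h_transform P X L (x i) Pt ->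
  levy_measure_vector Q (fun i => hpsi (x i)) nu ->
  measurable B -> B `<=` [set y | 0 < tnth y i] ->
  nu B = (\int[Pt]_(w in [set w | B (vec (fun j => Linf (x j) w))])
    (green P L (x i) (x i) / (2 * Linf (x i) w))%:E)%E.
Proof.
move=> g0 HT nuL mB Bi.
rewrite (marginals_of_levy_vector occupation_lty occupation_neg occupation_pos
  occupation_cons laplace_hpsi nuL mB Bi).
exact: (num_total_local_times g0 HT (measurable_preimage x mB) (preimage_pos (x := x) Bi)).
Qed.

Lemma levy_vector_characterized n (x : 'I_n -> E) (Pt : 'I_n -> probability Omega R)
    (nu : {measure set (n.-tuple R) -> \bar R}) :
  (forall i, 0 < green P L (x i) (x i)) -> (forall i, h_transform P X L (x i) (Pt i)) ->
  nu (~` orthant n) = 0%E -> nu [set vec (fun=> 0)] = 0%E ->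
  (forall i (B : set (n.-tuple R)), measurable B -> B `<=` [set y | 0 < tnth y i] ->
    nu B = (\int[Pt i]_(w in [set w | B (vec (fun j => Linf (x j) w))])
      (green P L (x i) (x i) / (2 * Linf (x i) w))%:E)%E) ->
  levy_measure_vector Q (fun i => hpsi (x i)) nu.
Proof.
move=> g0 HT nuo nu0 nuE.
apply: (levy_vector_of_marginals occupation_lty occupation_pos occupation_cons
  laplace_hpsi nuo nu0) => i B mB Bi.
rewrite (nuE i B mB Bi).
apply/esym; exact: (num_total_local_times (g0 i) (HT i) (measurable_preimage x mB) (preimage_pos (x := x) Bi)).
Qed.

Lemma path_levy_measure : exists nu : {measure set (paths E R) -> \bar R},
  levy_measure_process Q hpsi nu.
Proof.
by eexists; exact: (path_levyP occupation_lty occupation_neg occupation_pos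
  occupation_cons laplace_hpsi).
Qed.

Lemma path_levy_law (nu : {measure set (paths E R) -> \bar R}) a
    (Pt : probability Omega R) (B : set (paths E R)) :
  levy_measure_process Q hpsi nu -> 0 < green P L a a -> h_transform P X L a Pt ->
  measurable B -> B `<=` [set y | 0 < y a] ->
  nu B = (\int[Pt]_(w in [set w | B (Linf ^~ w)])
    (green P L a a / (2 * Linf a w))%:E)%E.
Proof.
move=> nuL g0 HT mB Ba.
rewrite (path_levy_unique occupation_lty occupation_neg occupation_pos
  occupation_cons laplace_hpsi nuL mB Ba).
exact: (num_total_local_times g0 HT mB Ba).
Qed.

End permanental.

Theorem corollary3p4 (R : realType) (d dE d' : measure_display)
    (Omega : measurableType d) (E : measurableType dE)
    (P : E -> probability Omega R) (X : R -> Omega -> option E)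
    (theta : R -> Omega -> Omega) (L : E -> R -> Omega -> R)
    (Omega' : measurableType d') (Q : probability Omega' R)
    (psi : E -> {RV Q >-> R}) :
  markov_process P X theta ->
  (forall x, local_time P X theta x (L x)) ->
  transient P L ->
  permanental_process2 (green P L) psi ->
  let g := green P L in
  let Linf := fun (x : E) (w : Omega) => fine (total_local_time L x w) in
  let half_psi := fun (x : E) (w : Omega') => psi x w / 2 in
  [/\ infinitely_divisible_process Q (fun x => psi x : Omega' -> R),
      (* the marginals, as measures on {y_1 > 0}, where the density
         g(a,a) / (2 y_1) is defined; nu may also charge {y_1 = 0} *)
      (forall (a : E) (Pt : probability Omega R),
        0 < g a a -> h_transform P X L a Pt ->
        forall (n : nat) (x : 'I_n.+1 -> E), x ord0 = a ->
        forall nu : {measure set (n.+1.-tuple R) -> \bar R},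
        levy_measure_vector Q (fun i => half_psi (x i)) nu ->
        forall B : set (n.+1.-tuple R), measurable B ->
          B `<=` [set y | 0 < tnth y ord0] ->
          nu B = (\int[Pt]_(w in [set w | B (vec (fun i => Linf (x i) w))])
                    (g a a / (2 * Linf a w))%:E)%E),
      (* these marginals characterize it *)
      (forall (n : nat) (x : 'I_n -> E) (Pt : 'I_n -> probability Omega R),
        (forall i, 0 < g (x i) (x i)) ->
        (forall i, h_transform P X L (x i) (Pt i)) ->
        forall nu : {measure set (n.-tuple R) -> \bar R},
        nu (~` orthant n) = 0%E -> nu [set vec (fun=> 0)] = 0%E ->
        (forall (i : 'I_n) (B : set (n.-tuple R)), measurable B ->
          B `<=` [set y | 0 < tnth y i] ->
          nu B = (\int[Pt i]_(w in [set w | B (vec (fun j => Linf (x j) w))])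
                    (g (x i) (x i) / (2 * Linf (x i) w))%:E)%E) ->
        levy_measure_vector Q (fun i => half_psi (x i)) nu),
      (* psi / 2 has a Levy measure on the path space *)
      (exists nu : {measure set (paths E R) -> \bar R},
        levy_measure_process Q half_psi nu) &
      (* which is the law of the total local times under g(a,a)/(2 L^a) P~_a *)
      (forall nu : {measure set (paths E R) -> \bar R},
        levy_measure_process Q half_psi nu ->
        forall (a : E) (Pt : probability Omega R),
        0 < g a a -> h_transform P X L a Pt ->
        forall B : set (paths E R), measurable B ->
          B `<=` [set y | 0 < y a] ->
          nu B = (\int[Pt]_(w in [set w | B (fun x => Linf x w)])
                    (g a a / (2 * Linf a w))%:E)%E)].
Proof.
move=> MP LT TR PS g Linf half_psi; split.
- exact: (permanental_infinitely_divisible MP LT TR PS).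
- move=> a Pt g0 HT n x xa; rewrite -xa in g0 HT * => nu nuL B mB B0.
  exact: (levy_marginal_law MP LT TR PS g0 HT nuL mB B0).
- move=> n x Pt g0 HT nu nuo nu0 nuE.
  exact: (levy_vector_characterized MP LT TR PS g0 HT nuo nu0 nuE).
- exact: (path_levy_measure MP LT TR PS).
- move=> nu nuL a Pt g0 HT B mB Ba.
  exact: (path_levy_law MP LT TR PS nuL g0 HT mB Ba).
Qed.
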